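(* Let $q\in[0,1]$ be a constant. Assume: (i) $\mu\mapsto\inf_{y\in\mathcal Y}\partial_\mu^2L(y,\mu)$ is positive and continuous, and there is a constant $L_u>0$ such that $|\partial_\mu L(y,\mu_1)-\partial_\mu L(y,\mu_2)|\le L_u|\mu_1-\mu_2|$ for all $y\in\mathcal Y$, $\mu_1,\mu_2\in\mathbb R$; (ii) $X_1$ is sub-gaussian with $\|X_1\|_{\psi_2}=K_x$, $\partial_\mu L(Y_1,0)$ is sub-gaussian with $\|\partial_\mu L(Y_1,0)\|_{\psi_2}=K_y$, and $\lambda_{\min}(\mathbf\Sigma)\ge\kappa_l$, where $\mathbf\Sigma$ is the covariance matrix of $X_1$ and $K_x,K_y,\kappa_l$ are positive constants; (iii) $\|\beta^*_{(k)}\|_2\le K_\beta$ for all $k\in[K]$ with a constant $K_\beta>0$; and for each $k\in[K]$ and $\delta\in(0,1)$, with probability at least $1-4\exp(-n\delta^2)$, the bounds $\|\hat\beta_{(k)}-\beta^*_{(k)}\|_2\le T^{(2)}_{n,q}(\delta)$ and $\|\hat\beta_{(k)}-\beta^*_{(k)}\|_1\le T^{(1)}_{n,q}(\delta)$ hold simultaneously; and likewise for each $k\in[K]$, $m\in[J]$, $\delta\in(0,1)$, the same two bounds hold simultaneously for $\hat\beta^{[-m]}_{(k)}-\beta^*_{(k)}$ with probability at least $1-4\exp(-n_{-1}\delta^2)$. Then there exist positive constants $c,c_1,c_2,C_1,C_2$, not depending on $n$, such that if $T_{n,q}\le c_1$, then for any $w^*\in\operatorname{argmin}_{w\in\mathcal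 W^K}\mathbb E L(Y_1,\langle B^*w,X_1\rangle)$, with probability at least $1-C_2(pK)^{-1}-C_2e^{-cn}$, the inequality $$\|\hat w-w^*\|_1\le C_1\frac{|S_*|}{\phi^2(S_* )}T_{n,q}+C_1\|w^*_{S_*^c}\|_1+C_1\sqrt{\frac{|S_*|}{\phi^2(S_* )}\Psi_{n,q}\|w^*_{S_*^c}\|_1}$$ holds uniformly over all (nonempty) $S_*\subseteq[K]$ with $|S_*|\le c_2\,\phi^2(S_* )\,\Psi_{n,q}^{-1}$.
   Context: Notation: $[N]=\{1,\dots,N\}$; $a\vee b=\max(a,b)$; $\|v\|_0$ is the number of nonzero entries, $\|v\|_q=(\sum_j|v_j|^q)^{1/q}$ for $q\in(0,\infty)$; $v_S$ is the restriction of $v$ to coordinates in $S$; $\partial_\mu L,\partial^2_\mu L$ are derivatives of $L(y,\mu)$ in $\mu$. For a random variable $u$, $\|u\|_{\psi_2}=\inf\{t>0:\mathbb E\exp(u^2/t^2)\le2\}$; for a random vector $V$, $\|V\|_{\psi_2}=\sup_{\|v\|_2=1}\|\langle V,v\rangle\|_{\psi_2}$. ''Constants'' do not depend on $n$; $p,K$, the index sets and the distribution may depend on $n$. Data: $(Y_i,\mathbf x_i)$, $1\le i\le n$, are i.i.d., $\mathbf x_i=(\mathrm x_{i1},\mathrm x_{i2},\dots)^\top$ infinite-dimensional, $Y_i=g(\sum_{j\ge1}\beta_j\mathrm x_{ij},\varepsilon_i)\in\mathcal Y$ with $g$ a known function, $\varepsilon_i$ independent of $\mathbf x_i$, $\boldsymbol\beta=(\beta_1,\beta_2,\dots)^\top$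 unknown. $L:\mathcal Y\times\mathbb R\to\mathbb R$ is convex in the second argument, and $\boldsymbol\beta$ minimizes $\mathbb E L(Y_1,\sum_j\theta_j\mathrm x_{1j})$ over $\{\theta\in\mathbb R^{\mathbb N}:\sum_j\theta_j^2<\infty\}$. Observed covariates: $X_i=(\mathrm x_{i1},\dots,\mathrm x_{ip})^\top$. Candidate models: index sets $\mathcal A_k\subseteq[p]$, $k\in[K]$. With a coordinatewise-additive regularizer $r_\lambda(\beta)=\sum_{j=1}^pr_\lambda(\beta_j)$ and tuning parameters $\lambda_{n,k}$, $\lambda^{[-m]}_{n,k}$, $$\hat\beta_{(k)}=\operatorname{argmin}_{\beta\in\mathbb R^p,\ \beta_{\mathcal A_k^c}=0}\frac1n\sum_{i=1}^nL(Y_i,\langle\beta,X_i\rangle)+r_{\lambda_{n,k}}(\beta).$$ Split $[n]$ into a fixed number $J\ge2$ of folds $\mathcal I_1,\dots,\mathcal I_J$ of equal size $n_1=n/J$, $n_{-1}=n-n_1$, and let $$\hat\beta_{(k)}^{[-m]}=\operatorname{argmin}_{\beta\in\mathbb R^p,\ \beta_{\mathcal A_k^c}=0}\frac1{n_{-1}}\sum_{i\in[n]\setminus\mathcal I_m}L(Y_i,\langle\beta,X_i\rangle)+r_{\lambda^{[-m]}_{n,k}}(\beta),\quad \hat B^{[-m]}=(\hat\beta^{[-m]}_{(1)},\dots,\hat\beta^{[-m]}_{(K)}).$$ $\mathcal W^K=\{w\in[0,1]^K:\sum_kw_k=1\}$, $CV(w)=\sum_{m=1}^J\sum_{i\in\mathcal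 I_m}L(Y_i,\langle\hat B^{[-m]}w,X_i\rangle)$, and $\hat w\in\operatorname{argmin}_{w\in\mathcal W^K}CV(w)$. Pseudo-true values: $\beta^*_{(k)}=\operatorname{argmin}_{\beta\in\mathbb R^p,\beta_{\mathcal A_k^c}=0}\mathbb E L(Y_1,\langle\beta,X_1\rangle)$, $B^*=(\beta^*_{(1)},\dots,\beta^*_{(K)})$. Rates: $p_u=\max_k|\mathcal A_k|$, $s_u=\max_k\|\beta^*_{(k)}\|_0$, $h_{q,u}=\max_k\|\beta^*_{(k)}\|_q$. With a positive constant $C_0$: for $q=0$, $T^{(2)}_{n,0}(\delta)=C_0\sqrt{s_u}(\delta+\sqrt{\log p_u/n})$, $T^{(1)}_{n,0}(\delta)=C_0s_u(\delta+\sqrt{\log p_u/n})$; for $q\in(0,1]$, $T^{(2)}_{n,q}(\delta)=C_0h_{q,u}^{q/2}(\delta+\sqrt{\log p_u/n})^{1-q/2}$, $T^{(1)}_{n,q}(\delta)=C_0h_{q,u}^q(\delta+\sqrt{\log p_u/n})^{1-q}$. For $q=0$: $T_{n,0}=\Psi_{n,0}=\sqrt{s_u}\sqrt{\log(pK)/n}$. For $q\in(0,1]$: $T_{n,q}=h_{q,u}^{q/2}(\log(pK)/n)^{1/2-q/4}$ and $\Psi_{n,q}=\big(h_{q,u}^{2/(2-q)}\sqrt{\log(pK)/n}\big)\vee T_{n,q}$. Compatibility factor: for $S_*\subseteq[K]$, $\mathbb C(S_*,w^* )=\{\Delta\in\mathcal W^K-w^*:\ \|\Delta_{S_*^c}\|_1-2\|w^*_{S_*^c}\|_1\le\|\Delta_{S_*}\|_1\}$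 and $$\phi^2(S_* )=\phi^2(S_*,B^*,w^* )=\min\Big\{\frac{|S_*|\,\|B^*\Delta\|_2^2}{\|\Delta_{S_*}\|_1^2}:\ \Delta\in\mathbb C(S_*,w^* )\Big\},$$ the minimum (infimum) being over those $\Delta$ with $\Delta_{S_*}\ne0$. *)

(* Defs.v *)
From HB Require Import structures.
From mathcomp Require Export all_boot all_order all_algebra.
From mathcomp Require Export all_classical all_reals all_analysis.

#[export] Set Implicit Arguments.
#[export] Unset Strict Implicit.
#[export] Unset Printing Implicit Defensive.

Export Order.TTheory GRing.Theory Num.Theory.
Export numFieldNormedType.Exports.

#[global] Open Scope classical_set_scope.
#[global] Open Scope ring_scope.

Definition argmin d (T : Type) (V : porderType d) (D : set T) (f : T -> V) :
    set T :=
  [set x | D x /\ forall y, D y -> (f x <= f y)%O].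

Section Vectors.
Variable R : realType.

Definition dotv p (u v : 'cV[R]_p) : R := \sum_j u j 0 * v j 0.

(* Only used for 0 < a; the number of nonzero entries is [l0norm]. *)
Definition lnorm (a : R) p (v : 'cV[R]_p) : R :=
  (\sum_j `|v j 0| `^ a) `^ a^-1.

Definition l0norm p (v : 'cV[R]_p) : nat := #|[set j | v j 0 != 0]%SET|.

(* The restriction v_S, padded with zeros outside S. *)
Definition vrestr p (S : {set 'I_p}) (v : 'cV[R]_p) : 'cV[R]_p :=
  \col_j (if j \in S then v j 0 else 0).

Definition supported p (S : {set 'I_p}) : set 'cV[R]_p :=
  [set v | vrestr (~: S) v = 0].

Definition simplex K : set 'cV[R]_K :=
  [set w | (forall k, 0 <= w k 0 <= 1) /\ \sum_k w k 0 = 1].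

Definition mxcols p K (b : 'I_K -> 'cV[R]_p) : 'M[R]_(p, K) :=
  \matrix_(j, k) b k j 0.

(* The smallest eigenvalue of a symmetric matrix. *)
Definition lambda_min p (M : 'M[R]_p) : R := inf [set a | eigenvalue M a].

Definition ell2 : set (nat -> R) :=
  [set theta : nat -> R | cvgn (series (fun j => theta j ^+ 2 : R^o))].

Definition coord_preimages : set (set (nat -> R)) :=
  [set (fun u : nat -> R => u jB.1) @^-1` jB.2
     | jB in [set jB : nat * set R | measurable jB.2]].

(* R^N with the product (cylinder) sigma-algebra. *)
Definition covariates := g_sigma_algebraType coord_preimages.

Definition first_covariates p (u : covariates) : 'cV[R]_p := \col_j u j.

End Vectors.

Section Probability.
Context (R : realType) (d : measure_display) (Omega : measurableType d).
Variable P : probability Omega R.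

(* It is +oo when u is not sub-gaussian. *)
Definition psi2_norm (u : Omega -> R) : \bar R :=
  ereal_inf [set t%:E | t in
    [set t : R | 0 < t
               /\ ('E_P[fun omega => expR (u omega ^+ 2 / t ^+ 2)%R]
                   <= 2%:E)%E]].

Definition psi2_vnorm p (V : Omega -> 'cV[R]_p) : \bar R :=
  ereal_sup [set psi2_norm (fun omega => dotv (V omega) v)
             | v in [set v : 'cV[R]_p | lnorm 2 v = 1]].

Definition random_vector p (V : Omega -> 'cV[R]_p) : Prop :=
  forall j, measurable_fun setT (fun omega => V omega j 0).

Definition covariance_matrix p (V : Omega -> 'cV[R]_p) : 'M[R]_p :=
  \matrix_(j, l) fine (covariance P (fun omega => V omega j 0)
                                    (fun omega => V omega l 0)).

Definition independent2 d1 d2 (T1 : measurableType d1) (T2 : measurableType d2)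
    (U : Omega -> T1) (V : Omega -> T2) : Prop :=
  forall (C : set T1) (D : set T2), measurable C -> measurable D ->
    P ((U @^-1` C) `&` (V @^-1` D)) = (P (U @^-1` C) * P (V @^-1` D))%E.

(* The product rule for subfamilies is the case C i = setT for the other i. *)
Definition mutually_independent d1 (T : measurableType d1) n
    (Z : 'I_n -> Omega -> T) : Prop :=
  forall C : 'I_n -> set T, (forall i, measurable (C i)) ->
    P (\bigcap_i (Z i @^-1` C i)) = (\prod_(i < n) P (Z i @^-1` C i))%E.

Definition identically_distributed d1 (T : measurableType d1) n
    (Z : 'I_n -> Omega -> T) : Prop :=
  forall (i l : 'I_n) (C : set T), measurable C ->
    P (Z i @^-1` C) = P (Z l @^-1` C).

Definition iid d1 (T : measurableType d1) n (Z : 'I_n -> Omega -> T) : Prop :=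
  [/\ forall i, measurable_fun setT (Z i), mutually_independent Z
    & identically_distributed Z].

(* [s] is the sum of the series of the theta_j x_j. The series is only required
   to converge in probability, which a.s. and L^2 convergence both imply. *)
Definition linear_predictor (theta : nat -> R) (x : Omega -> covariates R)
    (s : Omega -> R) : Prop :=
  measurable_fun setT s /\
  forall e : R, 0 < e ->
    (fun N => P [set omega |
       e < `| \sum_(j < N) theta j * x omega j - s omega |]) @ \oo --> 0%E.

End Probability.

Section Model.
Context (R : realType) (dY : measure_display) (calY : measurableType dY).
Variable L : calY -> R -> R.

Definition convex_loss : Prop :=
  forall y, convex_function (setT : set R^o) (L y : R^o -> R^o).

Definition smooth_loss (L_u : R) : Prop :=
  [/\ forall y mu, derivable (L y : R -> R) mu 1
        /\ derivable (derive1 (L y)) mu 1,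
      (let curv mu := inf [set derive1n 2 (L y) mu | y in setT] in
       (forall mu, 0 < curv mu) /\ continuous curv)
    & forall y mu1 mu2,
        `| derive1 (L y) mu1 - derive1 (L y) mu2 | <= L_u * `|mu1 - mu2| ].

Context (d : measure_display) (Omega : measurableType d).
Variable P : probability Omega R.

Definition eloss (Y : Omega -> calY) (s : Omega -> R) : \bar R :=
  'E_P[fun omega => L (Y omega) (s omega)].

Definition finite_eloss (Y : Omega -> calY) (s : Omega -> R) : Prop :=
  P.-integrable setT (fun omega => (L (Y omega) (s omega))%:E).

Definition risk p (Y : Omega -> calY) (X : Omega -> 'cV[R]_p) (b : 'cV[R]_p) :
    \bar R :=
  eloss Y (fun omega => dotv b (X omega)).

(* beta minimizes E L(Y, sum_j theta_j x_j) over l^2 and eta is its linear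
   predictor; competitors whose series or expected loss is undefined or infinite
   impose no constraint. *)
Definition true_parameter (Y : Omega -> calY) (x : Omega -> covariates R)
    (beta : nat -> R) (eta : Omega -> R) : Prop :=
  [/\ ell2 beta, linear_predictor P beta x eta, finite_eloss Y eta
    & forall theta s, ell2 theta -> linear_predictor P theta x s ->
        finite_eloss Y s -> (eloss Y eta <= eloss Y s)%E].

(* The objective (1/|I|) sum_(i in I) L(y_i, <b, x_i>) + sum_j rho(b_j). *)
Definition penalized_loss n p (y : 'I_n -> calY) (x : 'I_n -> 'cV[R]_p)
    (I : {set 'I_n}) (rho : R -> R) (b : 'cV[R]_p) : R :=
  #|I|%:R^-1 * (\sum_(i in I) L (y i) (dotv b (x i)))
  + \sum_j rho (b j 0).

Definition CV n p K J (y : 'I_n -> calY) (x : 'I_n -> 'cV[R]_p)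
    (I : 'I_J -> {set 'I_n}) (B : 'I_J -> 'M[R]_(p, K)) (w : 'cV[R]_K) : R :=
  \sum_(m < J) \sum_(i in I m) L (y i) (dotv (B m *m w) (x i)).

End Model.

Definition equal_folds n J (n1 : nat) (I : 'I_J -> {set 'I_n}) : Prop :=
  [/\ n = (J * n1)%N, forall m, #|I m| = n1,
      forall m m', m != m' -> (I m :&: I m')%SET = finset.set0
    & (\bigcup_(m < J) I m)%SET = [set: 'I_n]%SET].

Section Rates.
Context (R : realType) (p K : nat).
Variables (A : 'I_K -> {set 'I_p}) (bs : 'I_K -> 'cV[R]_p).
Variables (n : nat) (q C0 : R).

Definition p_u : nat := \max_(k < K) #|A k|.
Definition s_u : nat := \max_(k < K) l0norm (bs k).
Definition h_u : R := \big[Num.max/0]_(k < K) lnorm q (bs k).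

(* ln 0 = 0, so that this is 0 when all the candidate models are empty. *)
Definition base_rate (delta : R) : R :=
  delta + Num.sqrt (ln p_u%:R / n%:R).

Definition rateT2 (delta : R) : R :=
  if q == 0 then C0 * Num.sqrt s_u%:R * base_rate delta
  else C0 * h_u `^ (q / 2) * base_rate delta `^ (1 - q / 2).

Definition rateT1 (delta : R) : R :=
  if q == 0 then C0 * s_u%:R * base_rate delta
  else C0 * h_u `^ q * base_rate delta `^ (1 - q).

Definition rateT : R :=
  if q == 0 then Num.sqrt s_u%:R * Num.sqrt (ln (p * K)%:R / n%:R)
  else h_u `^ (q / 2) * (ln (p * K)%:R / n%:R) `^ (1 / 2 - q / 4).

Definition ratePsi : R :=
  if q == 0 then rateT
  else Num.max (h_u `^ (2 / (2 - q)) * Num.sqrt (ln (p * K)%:R / n%:R)) rateT.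

Definition cone (S : {set 'I_K}) (ws : 'cV[R]_K) : set 'cV[R]_K :=
  [set D | (exists2 w, simplex w & D = w - ws) /\
     lnorm 1 (vrestr (~: S) D) - 2 * lnorm 1 (vrestr (~: S) ws)
     <= lnorm 1 (vrestr S D)].

(* The infimum is +oo if no element of the cone is nonzero on S. This occurs for
   nonempty S only when K = 1. *)
Definition phi2 (S : {set 'I_K}) (ws : 'cV[R]_K) : \bar R :=
  ereal_inf [set (#|S|%:R * lnorm 2 (mxcols bs *m D) ^+ 2
                  / lnorm 1 (vrestr S D) ^+ 2)%:E
             | D in [set D | cone S ws D /\ vrestr S D != 0]].

End Rates.

(* Main.v *)
From HB Require Import structures.
From mathcomp Require Import ring lra.
Require Import Defs.
From mathcomp Require Import measurable_realfun.

(** Write D = hat w - w*, a = ||D||_1 and rho = sqrt(log(pK)/n).  D always lies in the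
cone, so unless a <= 4 ||w*_{S^c}||_1 the compatibility factor satisfies
phi^2 a^2 <= 16 |S| ||B* D||_2^2.  It remains to find an event, not depending on S, on
which ||B* D||_2^2 <= C T a.  If rho is not small this is not needed, since the bound on
|S| then excludes a > 4 ||w*_{S^c}||_1.

The basic inequality CV(hat w) <= CV(w* ) and the positive curvature of L on bounded sets
bound a truncated empirical quadratic form at B* D by the score at w* in the direction D
and by the errors of the fold estimators.  The expected score is nonnegative by optimality
of w*, and Bernstein's inequality in the K directions beta*_(k) controls its fluctuations.

The quadratic forms are controlled by Maurey's empirical method: a combination of vectors
with bounded l1 norm of the coefficients is the mean of averages of N signed vectors, and
Jensen's inequality reduces a bound for it to bounds for these averages.  There are only
(2m)^N of them, so for N of order n / log(pK) Chernoff's bound and a union bound suffice.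
Applied to the unit vectors of R^p, this bounds the empirical norm of the error of every
fold estimator simultaneously, so that the independence of an estimator from its
validation fold is never used. *)

(** * Maurey's empirical method *)

Section Maurey.
Variable R : realType.

(** The size N of the averages balances two demands. A union bound over the averages costs a factor
    exp(2 N log(pK)), which tails of order exp(-c n) absorb while N rho^2 is below a small constant.
    Conversely, approximating a combination with l1 norm r and atoms of length at most h leaves an
    error r^2 h^2 / N, so N must reach the order rho^{-2}. For the weights this error is of order (a
    rho h)^2, with h the largest l2 norm of a candidate, and rho h is at most a constant times T.
    For the fold estimators it is of order (rho T1)^2, with T1 their l1 rate, and rho T1 is at most
    a constant times T^2. With T <= 1 every remainder becomes linear in a T.

    Truncation is forced by the curvature, which is bounded below only on bounded sets. A
    nonnegative variable with a finite second moment has an exponentially small lower tail for its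
    averages, so fourth moments of the predictions control both this tail and the loss due to
    truncation.

    The rates of the fold estimators are used at delta = 2 rho: each fails with probability at most
    4 (pK)^{-2}, which leaves 4 J (pK)^{-1} for all of them. *)

Lemma product_weights (T : finType) N (w : T -> R) (g : 'I_N -> T -> R) :
  \sum_(s : {ffun 'I_N -> T}) (\prod_j w (s j)) * (\prod_j g j (s j))
  = \prod_j \sum_t w t * g j t.
Proof.
rewrite bigA_distr_bigA; apply: eq_bigr => s _.
by rewrite -big_split.
Qed.

(** The law [pi] is chosen before [y], so that one law serves all coordinates of a vector and all
    its predictions at once. *)
Lemma maurey (T : finType) N (w : T -> R) : (0 < N)%N ->
  (forall t, 0 <= w t) -> \sum_t w t = 1 ->
  exists pi : {ffun 'I_N -> T} -> R,
    [/\ forall s, 0 <= pi s, \sum_s pi s = 1 &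
     forall y : T -> R,
       \sum_s pi s * (N%:R^-1 * \sum_j y (s j)) = \sum_t w t * y t /\
       \sum_s pi s * (N%:R^-1 * \sum_j y (s j) - \sum_t w t * y t) ^+ 2
         <= N%:R^-1 * \sum_t w t * y t ^+ 2].
Proof.
move=> N0 w0 w1; have NR0 : (N%:R : R) != 0 by rewrite pnatr_eq0 -lt0n.
(* The law of N independent draws from w: the empirical mean of y is unbiased
   and its variance is at most 1/N times the second moment of y. *)
pose pi (s : {ffun 'I_N -> T}) := \prod_j w (s j).
have E (g : 'I_N -> T -> R) :
    \sum_s pi s * \prod_j g j (s j) = \prod_j \sum_t w t * g j t.
  exact: product_weights.
have pi1 : \sum_s pi s = 1.
  have := E (fun _ _ => 1); rewrite [RHS]big1; last first.
    by move=> j _; under eq_bigr do rewrite mulr1.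
  by move=> <-; apply: eq_bigr => s _; rewrite big1 ?mulr1.
have E1 (y : T -> R) (j : 'I_N) : \sum_s pi s * y (s j) = \sum_t w t * y t.
  transitivity (\prod_i \sum_t w t * (if i == j then y t else 1)).
    rewrite -E; apply: eq_bigr => s _.
    by rewrite -big_mkcond big_pred1_eq.
  rewrite (bigD1 j)//= eqxx [X in _ * X]big1 ?mulr1// => i /negPf ->.
  by under eq_bigr do rewrite mulr1.
(* Distinct draws are independent, hence uncorrelated for centred [y]; only the diagonal of the
   double sum below survives. *)
have E2 (y : T -> R) (j l : 'I_N) : j != l -> \sum_t w t * y t = 0 ->
    \sum_s pi s * (y (s j) * y (s l)) = 0.
  move=> jl y0.
  transitivity (\prod_i \sum_t w t * (if i \in [:: j; l] then y t else 1)).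
    rewrite -E; apply: eq_bigr => s _.
    rewrite -big_mkcond -big_uniq /=; last by rewrite inE jl.
    by rewrite big_cons big_seq1.
  by rewrite (bigD1 j)//= inE eqxx /= y0 mul0r.
exists pi; split => //; first by move=> s; apply: prodr_ge0.
move=> y; split.
  under eq_bigr do rewrite mulrCA mulr_sumr.
  rewrite -mulr_sumr exchange_big /=.
  under eq_bigr do rewrite E1.
  by rewrite sumr_const card_ord -[X in _ * X]mulr_natl mulrA mulVf// mul1r.
set m := \sum_t w t * y t.
pose yc t := y t - m.
have yc0 : \sum_t w t * yc t = 0.
  under eq_bigr do rewrite mulrBr.
  by rewrite sumrB -mulr_suml w1 mul1r subrr.
have -> : \sum_s pi s * (N%:R^-1 * \sum_j y (s j) - m) ^+ 2 =
    N%:R^-1 ^+ 2 * \sum_j \sum_l \sum_s pi s * (yc (s j) * yc (s l)).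
  transitivity (\sum_s N%:R^-1 ^+ 2 *
      \sum_j \sum_l pi s * (yc (s j) * yc (s l))).
    apply: eq_bigr => s _.
    have -> : N%:R^-1 * \sum_j y (s j) - m = N%:R^-1 * \sum_j yc (s j).
      rewrite sumrB sumr_const card_ord mulrBr -[X in _ = _ - _ * X]mulr_natl.
      by rewrite [X in _ = _ - X]mulrA mulVf// mul1r.
    rewrite exprMn mulrCA [X in _ * (_ * X)]expr2 big_distrlr /=.
    congr (_ * _); rewrite mulr_sumr.
    by apply: eq_bigr => j _; rewrite mulr_sumr.
  rewrite -mulr_sumr exchange_big /=; congr (_ * _); apply: eq_bigr => j _.
  by rewrite exchange_big.
have -> : \sum_j \sum_l \sum_s pi s * (yc (s j) * yc (s l)) =
    N%:R * \sum_t w t * yc t ^+ 2.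
  rewrite (eq_bigr (fun=> \sum_t w t * yc t ^+ 2)); last first.
    move=> j _; rewrite (bigD1 j)//= [X in _ + X]big1 ?addr0.
      by rewrite -(E1 (fun t => yc t ^+ 2) j); apply: eq_bigr => s _; rewrite expr2.
    by move=> l lj; apply: E2 => //; rewrite eq_sym.
  by rewrite sumr_const card_ord mulr_natl.
rewrite expr2 -mulrA (mulrA _ N%:R) mulVf// mul1r ler_wpM2l ?invr_ge0//.
have -> : \sum_t w t * yc t ^+ 2 = \sum_t w t * y t ^+ 2 - m ^+ 2.
  transitivity (\sum_t (w t * y t ^+ 2 - 2 * m * (w t * y t) + m ^+ 2 * w t)).
    by apply: eq_bigr => t _; rewrite /yc; ring.
  by rewrite big_split /= sumrB -!mulr_sumr w1 -/m; ring.
by rewrite lerBlDr lerDl sqr_ge0.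
Qed.

(** [true] encodes the sign -1. Signed atoms allow coefficients of either sign while the weights
    stay nonnegative. *)
Definition signed_avg m N (y : 'I_m -> R) (s : {ffun 'I_N -> 'I_m * bool}) : R :=
  N%:R^-1 * \sum_j (-1) ^+ (s j).2 * y (s j).1.

(** Draw [k] with probability proportional to [|th k|] and attach the sign of [th k]: a signed
    combination becomes its l1 norm times the mean of a probability law on 2m atoms. *)
Lemma maurey_signed m N (th : 'I_m -> R) : (0 < N)%N -> 0 < \sum_k `|th k| ->
  exists pi : {ffun 'I_N -> 'I_m * bool} -> R,
    [/\ forall s, 0 <= pi s, \sum_s pi s = 1 &
     forall y : 'I_m -> R,
       \sum_s pi s * ((\sum_k `|th k|) * signed_avg y s) = \sum_k th k * y k /\
       \sum_s pi s * ((\sum_k `|th k|) * signed_avg y s - \sum_k th k * y k) ^+ 2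
         <= (\sum_k `|th k|) * (N%:R^-1 * \sum_k `|th k| * y k ^+ 2)].
Proof.
move=> N0; set r : R := \sum_k _ => r0; have rn0 : r != 0 by rewrite gt_eqF.
(* The positive part leaves mass only on the sign that agrees with that of [th]. *)
pose w (t : 'I_m * bool) : R := Num.max ((-1) ^+ t.2 * th t.1) 0 / r.
have sumT (F : 'I_m -> bool -> R) :
    \sum_(t : 'I_m * bool) F t.1 t.2 = \sum_k (F k true + F k false).
  rewrite -(pair_bigA _ F) /=; apply: eq_bigr => k _.
  by rewrite big_bool.
have w0 t : 0 <= w t by rewrite /w divr_ge0 ?le_max ?lexx ?orbT// ltW.
have maxp k : Num.max (th k) 0 = (`|th k| + th k) / 2.
  by case: (lerP 0 (th k)) => t0; [rewrite ger0_norm|rewrite ltr0_norm] => //; lra.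
have maxn k : Num.max (- th k) 0 = (`|th k| - th k) / 2.
  by case: (leP (- th k) 0) => t0; [rewrite ger0_norm|rewrite ltr0_norm] => //; lra.
have wabs k : w (k, true) + w (k, false) = `|th k| / r.
  by rewrite /w /= expr1 expr0 mulN1r mul1r maxp maxn; field.
have wdif k : w (k, false) - w (k, true) = th k / r.
  by rewrite /w /= expr1 expr0 mulN1r mul1r maxp maxn; field.
have w1 : \sum_t w t = 1.
  have := sumT (fun k b => w (k, b)).
  under eq_bigr do rewrite -surjective_pairing.
  move=> ->; under eq_bigr do rewrite wabs.
  by rewrite -mulr_suml divff.
have [pi [pi0 pi1 piP]] := maurey N0 w0 w1; exists pi; split => // y.
have [] := piP (fun t => (-1) ^+ t.2 * y t.1).
have -> : \sum_t w t * ((-1) ^+ t.2 * y t.1) = (\sum_k th k * y k) / r.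
  have := sumT (fun k b => w (k, b) * ((-1) ^+ b * y k)).
  under eq_bigr do rewrite -surjective_pairing.
  move=> ->; rewrite mulr_suml; apply: eq_bigr => k _.
  by rewrite [RHS]mulrAC -wdif expr1 expr0; ring.
have -> : \sum_t w t * ((-1) ^+ t.2 * y t.1) ^+ 2 = (\sum_k `|th k| * y k ^+ 2) / r.
  have := sumT (fun k b => w (k, b) * ((-1) ^+ b * y k) ^+ 2).
  under eq_bigr do rewrite -surjective_pairing.
  move=> ->; rewrite mulr_suml; apply: eq_bigr => k _.
  by rewrite [RHS]mulrAC -wabs expr1 expr0; ring.
move=> e1 e2; split.
  under eq_bigr do rewrite mulrCA.
  by rewrite -mulr_sumr e1 mulrC divfK.
have -> : \sum_s pi s * (r * signed_avg y s - \sum_k th k * y k) ^+ 2 =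
    r ^+ 2 * \sum_s pi s * (signed_avg y s - (\sum_k th k * y k) / r) ^+ 2.
  rewrite mulr_sumr; apply: eq_bigr => s _.
  by rewrite [RHS]mulrCA -exprMn mulrBr (mulrC r (_ / r)) divfK.
apply: (le_trans (ler_wpM2l (sqr_ge0 r) e2)).
rewrite le_eqVlt; apply/orP; left; apply/eqP; field; by rewrite rn0 pnatr_eq0 -lt0n N0.
Qed.

End Maurey.

(** * Chernoff's bound for i.i.d. samples *)

Section Independence.
Import HBNNSimple.
Context (R : realType) (d dT : measure_display) (Omega : measurableType d).
Context (T : measurableType dT) (P : probability Omega R).
Local Open Scope ereal_scope.

(** For indicators the hypothesis is a product rule in which [a] plays the role of the mean of
    [phi]. Linearity extends it to nonnegative simple functions, monotone convergence to nonnegative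
    measurable ones. *)
Lemma factor_integral (phi : Omega -> R) (Z : Omega -> T) (a : R) :
  measurable_fun setT phi -> (forall w, (0 <= phi w)%R) ->
  measurable_fun setT Z -> (0 <= a)%R ->
  (forall C, measurable C ->
     \int[P]_w (phi w * \1_C (Z w))%:E = a%:E * P (Z @^-1` C)) ->
  forall f : T -> R, measurable_fun setT f -> (forall z, (0 <= f z)%R) ->
    \int[P]_w (phi w * f (Z w))%:E = a%:E * \int[P]_w (f (Z w))%:E.
Proof.
move=> mphi phi0 mZ a0 phiC f mf f0.
have mZf (h : T -> R) : measurable_fun setT h ->
    measurable_fun setT (fun w => (h (Z w))%:E).
  by move=> mh; apply/measurable_EFinP; exact: measurableT_comp.
have mpZf (h : T -> R) : measurable_fun setT h ->
    measurable_fun setT (fun w => (phi w * h (Z w))%:E).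
  move=> mh; apply/measurable_EFinP; apply: measurable_funM => //.
  exact: measurableT_comp.
have simple (h : {nnsfun T >-> R}) :
    \int[P]_w (phi w * h (Z w))%:E = a%:E * \int[P]_w (h (Z w))%:E.
  have h1 (y : R) : measurable (h @^-1` [set y]) by exact: measurable_funPTI.
  have hy (y : R) : y \in range h -> (0 <= y)%R.
    by rewrite inE => -[x _ <-].
  transitivity (\int[P]_w (\sum_(y \in range h)
      y%:E * (phi w * \1_(h @^-1` [set y]) (Z w))%:E)).
    apply: eq_integral => w _; rewrite fimfunE EFinM -fsumEFin//.
    rewrite ge0_mule_fsumr; last by move=> r; rewrite EFinM nnfun_muleindic_ge0.
    by apply: eq_fsbigr => y _; rewrite -!EFinM; congr EFin; ring.
  have -> : \int[P]_w (h (Z w))%:E =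
      \int[P]_w (\sum_(y \in range h) (y * \1_(h @^-1` [set y]) (Z w))%:E).
    by apply: eq_integral => w _; rewrite fimfunE -fsumEFin//.
  rewrite !ge0_integral_fsum//; last 4 first.
  - move=> y; apply: (mZf (fun z => y * \1_(h @^-1` [set y]) z)%R).
    exact: measurable_funM.
  - by move=> y w _; rewrite EFinM nnfun_muleindic_ge0.
  - by move=> y; apply: measurable_funeM; exact: (mpZf (\1_(h @^-1` [set y]))).
  (* Outside the range of [h] the value [y] may be negative, but then its preimage is empty. *)
  - move=> y w _; have [yr|yr] := boolP (y \in range h).
      by rewrite -EFinM lee_fin; apply: mulr_ge0; [exact: hy|apply: mulr_ge0].
    rewrite -EFinM indicE memNset ?mulr0//= => yZ; apply: (negP yr).
    by rewrite inE; exists (Z w).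
  rewrite ge0_mule_fsumr; last first.
    by move=> y; apply: integral_ge0 => w _; rewrite EFinM nnfun_muleindic_ge0.
  apply: eq_fsbigr => y yr; rewrite ge0_integralZl_EFin ?hy//; last 2 first.
  - by move=> w _; rewrite lee_fin mulr_ge0.
  - exact: (mpZf (\1_(h @^-1` [set y]))).
  rewrite phiC//; under [in RHS]eq_integral do rewrite EFinM.
  rewrite ge0_integralZl_EFin ?hy//; last exact: (mZf (\1_(h @^-1` [set y]))).
  have -> : \int[P]_w (\1_(h @^-1` [set y]) (Z w))%:E = P (Z @^-1` (h @^-1` [set y])).
    rewrite -(setIT (Z @^-1` _)) -integral_indic//.
    by rewrite -(setTI (_ @^-1` _)); exact: mZ.
  by rewrite muleCA.
pose f_ := nnsfun_approx measurableT (proj2 (measurable_EFinP _ _) mf).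
have cvgf w : (f_ n w)%:E @[n --> \oo] --> (f w)%:E.
  by apply: cvg_nnsfun_approx => // x _; rewrite lee_fin.
have ndf w n m : (n <= m)%N -> (f_ n w <= f_ m w)%R.
  by move=> nm; exact/lefP/nd_nnsfun_approx.
have c1 : \int[P]_w (f_ n (Z w))%:E @[n --> \oo] --> \int[P]_w (f (Z w))%:E.
  have -> : \int[P]_w (f (Z w))%:E = \int[P]_w (limn (fun n => (f_ n (Z w))%:E)).
    by apply: eq_integral => w _; apply/esym/cvg_lim => //; exact: cvgf.
  apply: cvg_monotone_convergence => //.
  - by move=> n; exact: mZf.
  - by move=> n w _; rewrite lee_fin.
  - by move=> w _ n m nm; rewrite lee_fin ndf.
have c2 : \int[P]_w (phi w * f_ n (Z w))%:E @[n --> \oo] -->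
    \int[P]_w (phi w * f (Z w))%:E.
  have -> : \int[P]_w (phi w * f (Z w))%:E =
      \int[P]_w (limn (fun n => (phi w * f_ n (Z w))%:E)).
    apply: eq_integral => w _; apply/esym/cvg_lim => //.
    under eq_fun do rewrite EFinM.
    by rewrite EFinM; apply: cvgeZl => //; exact: cvgf.
  apply: cvg_monotone_convergence => //.
  - by move=> n; exact: mpZf.
  - by move=> n w _; rewrite lee_fin mulr_ge0.
  - by move=> w _ n m nm; rewrite lee_fin ler_wpM2l// ndf.
apply: (cvg_unique _ c2) => //.
rewrite (_ : (fun n => _) = (fun n => a%:E * \int[P]_w (f_ n (Z w))%:E)).
  exact: cvgeZl.
by apply/funext => n; exact: simple.
Qed.

End Independence.

Lemma integral_indic_preimage dO dT (R : realType) (Omega : measurableType dO)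
    (T : measurableType dT) (P : probability Omega R) (Z : Omega -> T) (C : set T) :
  measurable_fun setT Z -> measurable C ->
  (\int[P]_w (\1_C (Z w))%:E = P (Z @^-1` C))%E.
Proof.
move=> mZ mC; rewrite -(setIT (Z @^-1` _)) -integral_indic//.
by rewrite -(setTI (_ @^-1` _)); exact: mZ.
Qed.

Section Chernoff.
Context (R : realType) (d dT : measure_display) (Omega : measurableType d).
Context (T : measurableType dT) (P : probability Omega R).

(** Induction on [k]: the functions at indices below [k] are arbitrary, the others are indicators.
    The case [k = 0] is mutual independence; the step frees the function at one index by
    [factor_integral], the remaining product serving as [phi]. *)
Lemma independent_integral_prod_indic n k (Z : 'I_n -> Omega -> T)
    (f : 'I_n -> T -> R) (e : 'I_n -> R) :
  (forall i, measurable_fun setT (Z i)) -> mutually_independent P Z ->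
  (forall i, measurable_fun setT (f i)) -> (forall i z, 0 <= f i z) ->
  (forall i, \int[P]_w (f i (Z i w))%:E = (e i)%:E)%E ->
  (forall i : 'I_n, (k <= i)%N -> exists2 C, measurable C & f i = \1_C) ->
  (\int[P]_w (\prod_i f i (Z i w))%:E = (\prod_i e i)%:E)%E.
Proof.
move=> mZ indep; elim: k f e => [|k IH] f e mf f0 fe fC.
  have /choice[C C_] : forall i, exists C, measurable C /\ f i = \1_C.
    by move=> i; have [C mC fiC] := fC i isT; exists C.
  have eC i : (e i)%:E = P (Z i @^-1` C i).
    rewrite -fe (C_ i).2; apply: integral_indic_preimage => //.
    exact: (C_ i).1.
  rewrite -prodEFin.
  under [RHS]eq_bigr do rewrite eC.
  rewrite -indep; last by move=> i; exact: (C_ i).1.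
  have mI : measurable (\bigcap_i (Z i @^-1` C i)).
    apply: fin_bigcap_measurable => // i _.
    by rewrite -(setTI (_ @^-1` _)); apply: mZ => //; exact: (C_ i).1.
  rewrite -[in RHS](setIT (\bigcap_i _)) -integral_indic//.
  apply: eq_integral => w _; congr EFin.
  rewrite indicE; have [wI|wI] := boolP (w \in _).
    rewrite big1// => i _; rewrite (C_ i).2 indicE mem_set//.
    by move: wI; rewrite inE => /(_ i I).
  have [i ZC] : exists i, ~ C i (Z i w).
    by apply: contrapT => /forallNP H; apply: (negP wI); rewrite inE => i _; exact: contrapT (H i).
  by rewrite (bigD1 i)//= (C_ i).2 indicE memNset// mul0r.
(* If [n <= k], no index equals [k] and the induction hypothesis applies as it stands. *)
have [kn|nk] := ltnP k n; last first.
  by apply: IH => // i ki; have := leq_trans nk ki; rewrite leqNgt ltn_ord.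
pose j := Ordinal kn.
rewrite (bigD1 j)//= mulrC EFinM -fe.
under eq_integral do rewrite (bigD1 j)//= mulrC.
apply: (@factor_integral _ _ _ _ _ _ (fun w => \prod_(i | i != j) f i (Z i w))
  (Z j) (\prod_(i | i != j) e i) _ _ _ _ _ (f j)) => //.
- rewrite (_ : (fun w => _) = fun w => \prod_(i <- index_enum 'I_n) if i != j then f i (Z i w) else 1%R).
    apply: measurable_prod => i _; case: (i != j) => //.
    exact: measurableT_comp.
  by apply/funext => w; rewrite big_mkcond.
- by move=> w; apply: prodr_ge0.
- apply: prodr_ge0 => i _; rewrite -lee_fin -fe; apply: integral_ge0 => w _.
  by rewrite lee_fin.
move=> C mC.
pose f' i := if i == j then \1_C else f i.
pose e' i := if i == j then fine (P (Z j @^-1` C)) else e i.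
have mZC : measurable (Z j @^-1` C).
  by rewrite -(setTI (_ @^-1` _)); exact: mZ.
have e'j : e' j = fine (P (Z j @^-1` C)) by rewrite /e' eqxx.
have f'j : f' j = \1_C by rewrite /f' eqxx.
have := IH f' e'; rewrite (bigD1 j)//= e'j mulrC EFinM.
rewrite fineK ?fin_num_measure//.
have -> : \prod_(i | i != j) e' i = \prod_(i | i != j) e i.
  by apply: eq_bigr => i /negPf ij; rewrite /e' ij.
move=> <-.
- apply: eq_integral => w _; rewrite [in RHS](bigD1 j)//= f'j mulrC.
  by congr (EFin (_ * _)); apply: eq_bigr => i /negPf ij; rewrite /f' ij.
- by move=> i; rewrite /f'; case: ifP => // _.
- by move=> i z; rewrite /f'; case: ifP => // _.
- move=> i; rewrite /f' /e'; case: ifP => [/eqP ->|_]; last exact: fe.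
  by rewrite integral_indic_preimage// fineK ?fin_num_measure.
- move=> i ki; rewrite /f'; case: ifP => [_|ij]; first by exists C.
  apply: fC; rewrite ltn_neqAle ki andbT eq_sym.
  by move: ij; rewrite -val_eqE /= => ->.
Qed.

(** The parameter of the exponential moment is absorbed in [h] and [t], so that one statement yields
    upper tails and, with a negative multiple of the variable, lower tails. *)
Lemma chernoff n (Z : 'I_n -> Omega -> T) (i1 : 'I_n) (h : T -> R) (c t : R) :
  iid P Z -> measurable_fun setT h ->
  (\int[P]_w (expR (h (Z i1 w)))%:E <= (expR c)%:E)%E ->
  (P [set w | (t <= \sum_i h (Z i w))%R] <= (expR (n%:R * c - t))%:E)%E.
Proof.
move=> [mZ indep ident] mh hc.
have mexp : measurable_fun setT (fun z => expR (h z)).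
  exact: measurableT_comp.
have mhZ i : measurable_fun setT (fun w => h (Z i w)) by exact: measurableT_comp.
pose e := fine (\int[P]_w (expR (h (Z i1 w)))%:E).
have eE : (\int[P]_w (expR (h (Z i1 w)))%:E = e%:E)%E.
  rewrite /e fineK// ge0_fin_numE; first exact: le_lt_trans hc (ltry _).
  by apply: integral_ge0 => w _; rewrite lee_fin expR_ge0.
have eiE i : (\int[P]_w (expR (h (Z i w)))%:E = e%:E)%E.
  rewrite -eE.
  have E l : (\int[P]_w (expR (h (Z l w)))%:E =
      \int[pushforward P (Z l)]_z (expR (h z))%:E)%E.
    pose mfs := isMeasurableFun.Build _ _ _ _ _ (mZ l).
    pose Zl : {mfun Omega >-> T} := HB.pack (Z l) mfs.
    rewrite (ge0_integral_pushforward (phi := Zl))//.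
    exact/measurable_EFinP.
  rewrite !E; apply: eq_measure_integral => A mA _.
  by rewrite /pushforward; exact: ident.
have e0 : 0 <= e by rewrite -lee_fin -eE; apply: integral_ge0 => w _; rewrite lee_fin expR_ge0.
have ec : e <= expR c by rewrite -lee_fin -eE.
have prodE : (\int[P]_w (\prod_i expR (h (Z i w)))%:E = (\prod_(i < n) e)%:E)%E.
  apply: (independent_integral_prod_indic (k := n) (f := fun _ z => expR (h z))
    (e := fun=> e)) => //.
  by move=> i; rewrite leqNgt ltn_ord.
have mS : measurable_fun setT (fun w => \sum_i h (Z i w)).
  exact: measurable_sum.
have mA : measurable [set w | t <= \sum_i h (Z i w)].
  rewrite -[X in measurable X]setTI.
  by apply: measurable_fun_le.
rewrite -[X in (P X <= _)%E]setIT -integral_indic//.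
apply: (@le_trans _ _ (\int[P]_w ((expR (- t))%:E * (\prod_i expR (h (Z i w)))%:E))%E).
  apply: ge0_le_integral => //.
  - by apply/measurable_EFinP.
  - apply: measurable_funeM; apply/measurable_EFinP; apply: measurable_prod => i _.
    exact: measurableT_comp.
  move=> w _; rewrite -EFinM lee_fin -expR_sum -expRD indicE.
  have [|_] := boolP (w \in _); last by rewrite expR_ge0.
  rewrite inE /= => tS; apply: le_trans (expR_ge1Dx _).
  by rewrite lerDl addrC subr_ge0.
rewrite ge0_integralZl_EFin ?expR_ge0//; last 2 first.
- by move=> w _; rewrite lee_fin prodr_ge0// => i _; exact: expR_ge0.
- apply/measurable_EFinP; apply: measurable_prod => i _; exact: measurableT_comp.
rewrite prodE -EFinM lee_fin expRD mulrC ler_wpM2r ?expR_ge0//.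
rewrite prodr_const card_ord expRM_natl.
by rewrite lerXn2r ?nnegrE ?expR_ge0.
Qed.

End Chernoff.

(** * Curvature and the basic inequality *)

Section ExpBounds.
Variable R : realType.
Implicit Types x y l : R.

Lemma expR_sub1_le x : expR x - 1 <= x * expR x.
Proof.
have := expR_ge1Dx (- x); rewrite expRN => h.
have e0 := expR_gt0 x.
have : (1 - x) * expR x <= 1.
  by rewrite -ler_pdivlMr// div1r.
lra.
Qed.

Lemma expR_taylor1_le x : expR x <= 1 + x + x ^+ 2 * expR `|x|.
Proof.
have h := expR_sub1_le x; have e1 := expR_ge1Dx x.
have [x0|x0] := leP 0 x.
  rewrite ger0_norm//.
  have : x * (expR x - 1) <= x * (x * expR x) by rewrite ler_wpM2l.
  rewrite expr2; lra.
have : x * (expR x - 1) <= x * x by rewrite (ler_wnM2l (ltW x0))//; lra.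
have : x * x * 1 <= x * x * expR `|x|.
  rewrite ler_wpM2l//; first by rewrite -expr2 sqr_ge0.
  by rewrite -expR0 ler_expR.
rewrite expr2; lra.
Qed.

Lemma expRN_le x : 0 <= x -> expR (- x) <= 1 - x + x ^+ 2.
Proof.
move=> x0; have h := expR_sub1_le (- x); have e1 := expR_ge1Dx (- x).
have : x * (1 - expR (- x)) <= x * x by rewrite ler_wpM2l//; lra.
rewrite expr2; lra.
Qed.

Lemma sqr_le_expR x : 0 <= x -> x ^+ 2 <= 4 * expR x.
Proof.
move=> x0; have e1 := expR_ge1Dx (x / 2).
have -> : expR x = expR (x / 2) ^+ 2 by rewrite -expRM_natr; congr expR; field.
have : (x / 2) ^+ 2 <= expR (x / 2) ^+ 2 by rewrite lerXn2r ?nnegrE ?expR_ge0//; lra.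
rewrite !expr2; lra.
Qed.

(** Half of the exponent bounds the exponential in the Taylor remainder, the other half absorbs
    [x ^+ 2]: [sqr_le_expR] at [|x| / 2] gives the constant 16. *)
Lemma expR_bernstein l x : `|l| <= 1 / 2 ->
  expR (l * x) <= 1 + l * x + 16 * l ^+ 2 * expR `|x|.
Proof.
move=> l2; apply: (le_trans (expR_taylor1_le _)); rewrite lerD2l.
have xl : `|l * x| <= `|x| / 2.
  by rewrite normrM mulrC ler_wpM2l//; lra.
have h : x ^+ 2 <= 16 * expR (`|x| / 2).
  have := sqr_le_expR (divr_ge0 (normr_ge0 x) (ler0n R 2)).
  by rewrite exprMn real_normK ?num_real// exprVn => h; lra.
have -> : expR `|x| = expR (`|x| / 2) * expR (`|x| / 2).
  by rewrite -expRD; congr expR; field.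
rewrite exprMn -(mulrA (l ^+ 2)) (mulrC 16) -[leRHS]mulrA.
rewrite ler_wpM2l ?sqr_ge0// mulrA.
by apply: ler_pM; rewrite ?sqr_ge0 ?expR_ge0 ?ler_expR.
Qed.

End ExpBounds.

Section Curvature.
Variables (R : realType) (phi G H : R -> R).
Hypothesis dphi : forall x : R, is_derive x (1 : R) phi (G x).
Hypothesis dG : forall x : R, is_derive x (1 : R) G (H x).

Lemma MVT_between (f df : R -> R) a b : (forall x : R, is_derive x (1 : R) f (df x)) ->
  exists2 c, (a <= c <= b) || (b <= c <= a) & f b - f a = df c * (b - a).
Proof.
move=> dfP.
have cf : continuous f.
  by move=> x; apply/differentiable_continuous/derivable1_diffP; case: (dfP x).
have [ab|ba] := leP a b.
  have [|c cab e] := @MVT_segment _ f df a b ab (fun x _ => dfP x).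
    exact: continuous_subspaceT.
  by exists c => //; move: cab; rewrite in_itv /= => ->.
have [|c cab e] := @MVT_segment _ f df b a (ltW ba) (fun x _ => dfP x).
  exact: continuous_subspaceT.
exists c; first by move: cab; rewrite in_itv /= => ->; rewrite orbT.
by rewrite -opprB e; ring.
Qed.

(** A single use of the mean value theorem, with the increment of [G] bounded by K |v| on the whole
    segment, gives [K] in place of the sharp [K / 2]. *)
Lemma tangent_upper (K u v : R) : (forall a b, `|G a - G b| <= K * `|a - b|) ->
  phi (u + v) - phi u <= G u * v + K * v ^+ 2.
Proof.
move=> lipG; have [c cuv ->] := MVT_between u (u + v) dphi.
rewrite addrAC subrr add0r -lerBlDl -mulrBl.
apply: (le_trans (ler_norm _)); rewrite normrM.
apply: (@le_trans _ _ (K * `|v| * `|v|)).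
  rewrite ler_wpM2r//; apply: (le_trans (lipG _ _)).
  have K0 : 0 <= K.
    by have := le_trans (normr_ge0 _) (lipG 1 0); rewrite subr0 normr1 mulr1.
  rewrite ler_wpM2l//; case/orP: cuv => /andP[h1 h2].
    by rewrite !ger0_norm; lra.
  by rewrite !ler0_norm; lra.
by rewrite -mulrA -normrM -expr2 ger0_norm// sqr_ge0.
Qed.

Lemma tangent_lower (k M u v : R) : (forall x, `|x| <= M -> k <= H x) ->
  `|u| <= M -> `|u + v| <= M ->
  G u * v + k / 2 * v ^+ 2 <= phi (u + v) - phi u.
Proof.
move=> kH uM uvM.
(* The gap [h] between [phi] and its quadratic minorant at [u] has derivative (H e - k)(s - u) for
   some [e] between [u] and [s], so it grows away from [u]. *)
pose h s := phi s - phi u - G u * (s - u) - k / 2 * (s - u) ^+ 2.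
pose dh s := G s - G u - k * (s - u).
have dhP (s : R) : is_derive s (1 : R) h (dh s).
  by rewrite /h /dh; apply: is_derive_eq; rewrite /GRing.scale/=; field.
have [c cuv] := MVT_between u (u + v) dhP.
have [e ecu eE] := MVT_between u c dG.
have eM : `|e| <= M.
  move: uM uvM; rewrite !ler_norml => /andP[? ?] /andP[? ?].
  by apply/andP; case/orP: cuv => /andP[? ?]; case/orP: ecu => /andP[? ?]; split; lra.
have -> : h (u + v) - h u = phi (u + v) - phi u - G u * v - k / 2 * v ^+ 2.
  by rewrite /h; ring.
rewrite /dh eE => E.
suff : 0 <= (H e - k) * (c - u) * v.
  have -> : (H e - k) * (c - u) * v = (H e * (c - u) - k * (c - u)) * (u + v - u) by ring.
  by rewrite -E; lra.
rewrite -mulrA mulr_ge0//; first by rewrite subr_ge0 kH.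
case/orP: cuv => /andP[? ?]; first by apply: mulr_ge0; lra.
by rewrite -mulrNN; apply: mulr_ge0; lra.
Qed.

Lemma deriv_nondecreasing : (forall x, 0 <= H x) -> {homo G : x y / x <= y}.
Proof.
move=> H0 x y xy; have [c _ e] := MVT_between x y dG.
by rewrite -subr_ge0 e mulr_ge0// subr_ge0.
Qed.

End Curvature.

(** * Empirical averages and the Cauchy-Schwarz inequality *)

Section Averages.
Variable R : realType.

Definition avg n (f : 'I_n -> R) : R := n%:R^-1 * \sum_i f i.

Lemma eq_avg n (f g : 'I_n -> R) : f =1 g -> avg f = avg g.
Proof. by move=> fg; congr (_ * _); apply: eq_bigr => i _. Qed.

Lemma avgD n (f g : 'I_n -> R) : avg (fun i => f i + g i) = avg f + avg g.
Proof. by rewrite /avg big_split mulrDr. Qed.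

Lemma avgZ n c (f : 'I_n -> R) : avg (fun i => c * f i) = c * avg f.
Proof. by rewrite /avg -mulr_sumr mulrCA. Qed.

Lemma avg_sum n (T : finType) (f : T -> 'I_n -> R) :
  avg (fun i => \sum_t f t i) = \sum_t avg (f t).
Proof. by rewrite /avg exchange_big mulr_sumr. Qed.

Lemma ler_avg n (f g : 'I_n -> R) : (forall i, f i <= g i) -> avg f <= avg g.
Proof. by move=> fg; rewrite ler_wpM2l ?invr_ge0// ler_sum. Qed.

Lemma avg_ge0 n (f : 'I_n -> R) : (forall i, 0 <= f i) -> 0 <= avg f.
Proof. by move=> f0; rewrite mulr_ge0 ?invr_ge0// sumr_ge0. Qed.

Lemma cauchy_schwarz (T : finType) (f g : T -> R) :
  (\sum_t f t * g t) ^+ 2 <= (\sum_t f t ^+ 2) * (\sum_t g t ^+ 2).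
Proof.
(* Lagrange's identity: this double sum is twice the defect in the Cauchy-Schwarz inequality. *)
have : 0 <= \sum_s \sum_t (f s * g t - f t * g s) ^+ 2.
  by apply: sumr_ge0 => s _; apply: sumr_ge0 => t _; exact: sqr_ge0.
have -> : \sum_s \sum_t (f s * g t - f t * g s) ^+ 2 =
    2 * ((\sum_t f t ^+ 2) * (\sum_t g t ^+ 2) - (\sum_t f t * g t) ^+ 2).
  transitivity (\sum_s \sum_t (f s ^+ 2 * g t ^+ 2 + g s ^+ 2 * f t ^+ 2
      - 2 * ((f s * g s) * (f t * g t)))).
    by apply: eq_bigr => s _; apply: eq_bigr => t _; ring.
  under eq_bigr do rewrite sumrB big_split /= -!mulr_sumr.
  by rewrite sumrB big_split /= -!mulr_sumr -!mulr_suml; ring.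
by rewrite pmulr_rge0// subr_ge0.
Qed.

Lemma avg_mul_le n (f g : 'I_n -> R) (a b : R) : 0 <= a -> 0 <= b ->
  avg (fun i => f i ^+ 2) <= a ^+ 2 -> avg (fun i => g i ^+ 2) <= b ^+ 2 ->
  avg (fun i => `|f i| * `|g i|) <= a * b.
Proof.
move=> a0 b0 fa gb.
have ab0 : 0 <= a * b by exact: mulr_ge0.
have fg0 : 0 <= avg (fun i => `|f i| * `|g i|) by apply: avg_ge0 => i; rewrite mulr_ge0.
rewrite -ler_sqr ?nnegrE//.
rewrite [leRHS]exprMn.
apply: (@le_trans _ _ (avg (fun i => f i ^+ 2) * avg (fun i => g i ^+ 2))).
  rewrite /avg exprMn [leRHS]mulrACA -expr2 ler_wpM2l ?sqr_ge0//.
  apply: (le_trans (cauchy_schwarz _ _)).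
  by rewrite le_eqVlt; apply/orP; left; apply/eqP; congr (_ * _);
    apply: eq_bigr => i _; rewrite real_normK ?num_real.
by apply: ler_pM => //; apply: avg_ge0 => i; exact: sqr_ge0.
Qed.

(** Cauchy-Schwarz with weights [|d t|]. When these sum to 1 it is Jensen's inequality for the
    square, the form used with Maurey's law. *)
Lemma sqr_comb_le (T : finType) (d z : T -> R) :
  (\sum_t d t * z t) ^+ 2 <= (\sum_t `|d t|) * \sum_t `|d t| * z t ^+ 2.
Proof.
have sq t : Num.sqrt `|d t| ^+ 2 = `|d t| by rewrite sqr_sqrtr.
have := cauchy_schwarz (fun t => Num.sqrt `|d t|)
  (fun t => Num.sqrt `|d t| * (Num.sg (d t) * z t)).
have -> : \sum_t Num.sqrt `|d t| * (Num.sqrt `|d t| * (Num.sg (d t) * z t)) =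
    \sum_t d t * z t.
  apply: eq_bigr => t _.
  by rewrite mulrA -expr2 sq mulrA mulrC [_ * Num.sg _]mulrC -numEsg mulrC.
move=> /le_trans; apply.
under eq_bigr do rewrite sq.
rewrite ler_wpM2l ?sumr_ge0// ler_sum// => t _.
rewrite exprMn sq ler_wpM2l// exprMn -[leRHS]mul1r ler_wpM2r ?sqr_ge0//.
by rewrite sqr_sg; case: (d t != 0) => /=.
Qed.

Lemma avg_comb_le n (T : finType) (d : T -> R) (z : T -> 'I_n -> R) (b : R) :
  (forall t, avg (fun i => z t i ^+ 2) <= b ^+ 2) ->
  avg (fun i => (\sum_t d t * z t i) ^+ 2) <= ((\sum_t `|d t|) * b) ^+ 2.
Proof.
move=> zb; rewrite exprMn expr2 -mulrA.
apply: (@le_trans _ _ (avg (fun i => (\sum_t `|d t|) * \sum_t `|d t| * z t i ^+ 2))).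
  by apply: ler_avg => i; exact: sqr_comb_le.
rewrite avgZ ler_wpM2l ?sumr_ge0// avg_sum mulr_suml ler_sum// => t _.
by rewrite avgZ ler_wpM2l.
Qed.

End Averages.

(** * The basic inequality for the weights *)

Section BasicInequality.
Variables (R : realType) (n K : nat).
Variables (phi G H : 'I_n -> R -> R) (Lu kappa M : R).
Hypothesis dphi : forall i (x : R), is_derive x (1 : R) (phi i) (G i x).
Hypothesis dG : forall i (x : R), is_derive x (1 : R) (G i) (H i x).
Hypothesis H0 : forall i x, 0 <= H i x.
Hypothesis Hk : forall i x, `|x| <= 2 * M -> kappa <= H i x.
Hypothesis lipG : forall i a b, `|G i a - G i b| <= Lu * `|a - b|.
Hypotheses (M0 : 0 < M) (kappa0 : 0 < kappa) (Lu0 : 0 < Lu).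

(** If [|vs| <= M / 2] but [|v| > M], then [|v - vs|] is at least [M / 2] and the error term alone
    pays for [vs ^+ 2]. Halving the threshold is the price for moving the truncation from [v] to
    [vs]. *)
Lemma truncated_sqr_ge (v vs : R) :
  1 / 2 * vs ^+ 2 * (`|vs| <= M / 2)%R%:R - (v - vs) ^+ 2 <= v ^+ 2 * (`|v| <= M)%R%:R.
Proof.
have vv : 0 <= v ^+ 2 * (`|v| <= M)%R%:R by rewrite mulr_ge0 ?sqr_ge0 ?ler0n.
have [vsM|vsM] := leP `|vs| (M / 2); last first.
  by rewrite mulr0 sub0r (le_trans _ vv)// oppr_le0 sqr_ge0.
rewrite mulr1; have [vM|vM] := leP `|v| M.
  rewrite mulr1 -subr_ge0.
  have -> : v ^+ 2 - (1 / 2 * vs ^+ 2 - (v - vs) ^+ 2) =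
    1 / 2 * (2 * v - vs) ^+ 2 by field.
  by rewrite mulr_ge0// sqr_ge0.
rewrite mulr0; have M20 : 0 <= M / 2 by rewrite divr_ge0// ltW.
have d : M / 2 <= `|v - vs|.
  by have := ler_normD (v - vs) vs; rewrite subrK; lra.
have h1 : vs ^+ 2 <= (M / 2) ^+ 2.
  by rewrite -(real_normK (num_real vs)) lerXn2r ?nnegrE ?normr_ge0.
have h2 : (M / 2) ^+ 2 <= (v - vs) ^+ 2.
  by rewrite -(real_normK (num_real (v - vs))) lerXn2r ?nnegrE ?normr_ge0.
have := sqr_ge0 vs; lra.
Qed.

(** If [|us| <= M / 2] but [|u| > M], then [|vs| <= M / 2 <= |u - us|]. Bounding the lost square by
    the product [|vs| * |u - us|] keeps a factor [vs], hence a factor of the weight error. *)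
Lemma truncated_quadratic_ge (u us v vs : R) :
  1 / 2 * (vs ^+ 2 * (`|vs| <= M / 2)%R%:R * (`|us| <= M / 2)%R%:R)
    - (v - vs) ^+ 2 - 1 / 2 * (`|vs| * `|u - us|)
  <= v ^+ 2 * (`|v| <= M)%R%:R * (`|u| <= M)%R%:R.
Proof.
have tr := truncated_sqr_ge v vs.
have f0 := sqr_ge0 (v - vs).
have p0 : 0 <= `|vs| * `|u - us| by rewrite mulr_ge0.
have vv : 0 <= v ^+ 2 * (`|v| <= M)%R%:R by rewrite mulr_ge0 ?sqr_ge0 ?ler0n.
have v0 := sqr_ge0 vs.
have rhs0 : 0 <= v ^+ 2 * (`|v| <= M)%R%:R * (`|u| <= M)%R%:R by rewrite mulr_ge0 ?ler0n.
have [usM|usM] := leP `|us| (M / 2); last by rewrite mulr0; lra.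
have [vsM|vsM] := leP `|vs| (M / 2); last by rewrite !(mulr0, mul0r); lra.
rewrite vsM mulr1 in tr; rewrite !mulr1.
have [uM|uM] := leP `|u| M; first by rewrite mulr1; lra.
rewrite mulr0; have d : M / 2 <= `|u - us| by have := ler_normD (u - us) us; rewrite subrK; lra.
suff : vs ^+ 2 <= `|vs| * `|u - us| by lra.
rewrite -(real_normK (num_real vs)) expr2 ler_wpM2l//.
exact: le_trans d.
Qed.

(** Curvature is used only where [|u|] and [|v|] are at most [M], so that [u + v] stays in the range
    of [Hk]; elsewhere convexity suffices. Score and truncated square are then moved from [u], [v]
    to [us], [vs]. *)
Lemma loss_increment_ge i (u us v vs : R) :
  G i us * vs - `|G i us| * `|v - vs| - Lu * (`|u - us| * `|v|)
   + kappa / 2 * (1 / 2 * (vs ^+ 2 * (`|vs| <= M / 2)%R%:R * (`|us| <= M / 2)%R%:R)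
    - (v - vs) ^+ 2 - 1 / 2 * (`|vs| * `|u - us|))
  <= phi i (u + v) - phi i u.
Proof.
have h1 : G i u * v + kappa / 2 * (v ^+ 2 * (`|v| <= M)%R%:R * (`|u| <= M)%R%:R)
    <= phi i (u + v) - phi i u.
  (* [tangent_lower] with curvature 0 is convexity; the bound on the range only has to contain both
     points. *)
  have h0 : G i u * v <= phi i (u + v) - phi i u.
    have := @tangent_lower _ _ _ _ (dphi i) (dG i) 0 (`|u| + `|u + v|) u v.
    rewrite mul0r mul0r addr0; apply => //; rewrite ?lerDl ?lerDr//.
  have [uM|uM] := leP `|u| M; last by rewrite !mulr0 addr0.
  have [vM|vM] := leP `|v| M; last by rewrite !(mulr0, mul0r) addr0.
  rewrite !mulr1; apply: (tangent_lower (M := 2 * M) (dphi i) (dG i)).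
  - exact: Hk.
  - have M1 : M <= 2 * M by have := M0; lra. exact: le_trans uM M1.
  - by have := ler_normD u v; lra.
apply: le_trans h1; apply: lerD; last first.
  by rewrite ler_wpM2l ?truncated_quadratic_ge// divr_ge0// ltW.
have -> : G i u * v = G i us * vs + G i us * (v - vs) + (G i u - G i us) * v by ring.
have a1 : - (`|G i us| * `|v - vs|) <= G i us * (v - vs).
  by rewrite -normrM lerNl -normrN ler_norm.
have a2 : - (Lu * (`|u - us| * `|v|)) <= (G i u - G i us) * v.
  rewrite lerNl (le_trans (ler_norm _))// normrN normrM mulrA ler_wpM2r//.
lra.
Qed.

(* [zs k i] and [zh k i] stand for the predictions of observation i by the
   pseudo-true value and by the fold estimator of model k. *)
Variables (zs zh : 'I_K -> 'I_n -> R) (ws w : 'I_K -> R).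
Let D k := w k - ws k.
Let a := \sum_k `|D k|.
Let us i := \sum_k ws k * zs k i.
Let vs i := \sum_k D k * zs k i.

(** Every error term is a product of two empirical L2 norms, one of which carries the factor [a] by
    [avg_comb_le]; this makes the bound proportional to the weight error. [Q - e * a] stands for a
    population form less the error of Maurey's approximation. *)
Lemma basic_inequality (tau Rz Zg nu Q e : R) :
  0 <= tau -> 0 <= Rz -> 0 <= Zg -> \sum_k `|ws k| <= 1 ->
  (forall k, avg (fun i => (zh k i - zs k i) ^+ 2) <= tau ^+ 2) ->
  (forall k, avg (fun i => zs k i ^+ 2) <= Rz ^+ 2) ->
  avg (fun i => G i (us i) ^+ 2) <= Zg ^+ 2 ->
  - (nu * a) <= avg (fun i => G i (us i) * vs i) ->
  Q - e * a <= avg (fun i => vs i ^+ 2 * (`|vs i| <= M / 2)%R%:R * (`|us i| <= M / 2)%R%:R) ->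
  avg (fun i => phi i (\sum_k w k * zh k i)) <=
    avg (fun i => phi i (\sum_k ws k * zh k i)) ->
  kappa / 4 * (Q - e * a) <=
    a * (nu + Zg * tau + Lu * (tau * (2 * (Rz + tau)))
         + kappa / 2 * (a * tau ^+ 2 + 1 / 2 * (Rz * tau))).
Proof.
move=> tau0 Rz0 Zg0 ws1 hzh hzs hG hnu hQ hmin.
pose u i := \sum_k ws k * zh k i; pose v i := \sum_k D k * zh k i.
have a0 : 0 <= a by exact: sumr_ge0.
have uE i : u i - us i = \sum_k ws k * (zh k i - zs k i).
  by rewrite -sumrB; apply: eq_bigr => k _; rewrite mulrBr.
have vE i : v i - vs i = \sum_k D k * (zh k i - zs k i).
  by rewrite -sumrB; apply: eq_bigr => k _; rewrite mulrBr.
have he : avg (fun i => (u i - us i) ^+ 2) <= tau ^+ 2.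
  rewrite (eq_avg (g := fun i => (\sum_k ws k * (zh k i - zs k i)) ^+ 2)); last first.
    by move=> i; rewrite uE.
  apply: (le_trans (avg_comb_le ws hzh)).
  rewrite exprMn -[leRHS]mul1r ler_wpM2r ?sqr_ge0//.
  by rewrite -[leRHS](expr1n _ 2%N) lerXn2r ?nnegrE// sumr_ge0.
have hf : avg (fun i => (v i - vs i) ^+ 2) <= (a * tau) ^+ 2.
  rewrite (eq_avg (g := fun i => (\sum_k D k * (zh k i - zs k i)) ^+ 2)); last first.
    by move=> i; rewrite vE.
  exact: avg_comb_le.
have hvs : avg (fun i => vs i ^+ 2) <= (a * Rz) ^+ 2 by exact: avg_comb_le.
(* From zh^2 <= 2 zs^2 + 2 (zh - zs)^2 and 2 Rz^2 + 2 tau^2 <= (2 (Rz + tau))^2. *)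
have hv : avg (fun i => v i ^+ 2) <= (a * (2 * (Rz + tau))) ^+ 2.
  apply: avg_comb_le => k.
  apply: (@le_trans _ _ (2 * avg (fun i => zs k i ^+ 2)
      + 2 * avg (fun i => (zh k i - zs k i) ^+ 2))).
    rewrite -!avgZ -avgD; apply: ler_avg => i.
    rewrite -subr_ge0.
    have -> : 2 * zs k i ^+ 2 + 2 * (zh k i - zs k i) ^+ 2 - zh k i ^+ 2 =
      (2 * zs k i - zh k i) ^+ 2 by ring.
    exact: sqr_ge0.
  have := hzs k; have := hzh k => h1 h2.
  apply: (@le_trans _ _ (2 * Rz ^+ 2 + 2 * tau ^+ 2)); first lra.
  have : 0 <= Rz * tau by rewrite mulr_ge0.
  by have := sqr_ge0 Rz; have := sqr_ge0 tau; rewrite !expr2; lra.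
have inc : avg (fun i => G i (us i) * vs i - `|G i (us i)| * `|v i - vs i|
     - Lu * (`|u i - us i| * `|v i|)
   + kappa / 2 * (1 / 2 * (vs i ^+ 2 * (`|vs i| <= M / 2)%R%:R * (`|us i| <= M / 2)%R%:R)
    - (v i - vs i) ^+ 2 - 1 / 2 * (`|vs i| * `|u i - us i|))) <= 0.
  apply: (@le_trans _ _ (avg (fun i => phi i (u i + v i) + (-1) * phi i (u i)))).
    by apply: ler_avg => i; rewrite mulN1r; exact: loss_increment_ge.
  rewrite avgD avgZ mulN1r subr_le0.
  rewrite (eq_avg (g := fun i => phi i (\sum_k w k * zh k i)))//.
  move=> i; congr (phi i _); rewrite -big_split /=; apply: eq_bigr => k _.
  by rewrite /D; ring.
move: inc; rewrite (eq_avg (g := fun i => G i (us i) * vs i +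
   (-1) * (`|G i (us i)| * `|v i - vs i|) + (- Lu) * (`|u i - us i| * `|v i|)
   + kappa / 4 * (vs i ^+ 2 * (`|vs i| <= M / 2)%R%:R * (`|us i| <= M / 2)%R%:R)
   + (- (kappa / 2)) * (v i - vs i) ^+ 2 + (- (kappa / 4)) * (`|vs i| * `|u i - us i|)));
  last by move=> i; field.
rewrite !avgD !avgZ.
have b1 := avg_mul_le Zg0 (mulr_ge0 a0 tau0) hG hf.
have Rt0 : 0 <= 2 * (Rz + tau) by lra.
have b2 := avg_mul_le tau0 (mulr_ge0 a0 Rt0) he hv.
have b3 := avg_mul_le (mulr_ge0 a0 Rz0) tau0 hvs he.
have k1 : kappa / 4 * (Q - e * a) <= kappa / 4 * avg (fun i =>
   vs i ^+ 2 * (`|vs i| <= M / 2)%R%:R * (`|us i| <= M / 2)%R%:R).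
  by rewrite ler_wpM2l// divr_ge0// ltW.
have k2 : Lu * avg (fun i => `|u i - us i| * `|v i|) <= Lu * (tau * (a * (2 * (Rz + tau)))).
  by rewrite ler_wpM2l// ltW.
have k3 : kappa / 2 * avg (fun i => (v i - vs i) ^+ 2) <= kappa / 2 * (a * tau) ^+ 2.
  by rewrite ler_wpM2l// divr_ge0// ltW.
have k4 : kappa / 4 * avg (fun i => `|vs i| * `|u i - us i|) <= kappa / 4 * (a * Rz * tau).
  by rewrite ler_wpM2l// divr_ge0// ltW.
move: b1 k1 k2 k3 k4 hnu.
have -> : a * (nu + Zg * tau + Lu * (tau * (2 * (Rz + tau))) +
    kappa / 2 * (a * tau ^+ 2 + 1 / 2 * (Rz * tau))) =
  nu * a + Zg * (a * tau) + Lu * (tau * (a * (2 * (Rz + tau))))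
   + kappa / 2 * (a * tau) ^+ 2 + kappa / 4 * (a * Rz * tau) by field.
lra.
Qed.

End BasicInequality.

(** * The smallest eigenvalue and the Rayleigh quotient *)

Lemma continuous_sum (R : realType) (T : topologicalType) (I : Type) (s : seq I)
    (f : I -> T -> R) :
  (forall i, continuous (f i)) -> continuous (fun x => \sum_(i <- s) f i x).
Proof.
move=> cf; elim: s => [|i s IH] x.
  by under eq_fun do rewrite big_nil; exact: cvg_cst.
under eq_fun do rewrite big_cons.
by apply: cvgD; [exact: cf|exact: IH].
Qed.

Section Rayleigh.
Variables (R : realType) (p : nat) (M : 'M[R]_p).
Hypothesis symM : M^T = M.

Let bf (u v : 'rV[R]_p) : R := (u *m M *m v^T) 0 0.
Let ip (u v : 'rV[R]_p) : R := (u *m v^T) 0 0.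

Let bfC u v : bf u v = bf v u.
Proof.
rewrite /bf; have -> : u *m M *m v^T = (v *m M *m u^T)^T.
  by rewrite !trmx_mul trmxK symM mulmxA.
by rewrite mxE.
Qed.

Let ipC u v : ip u v = ip v u.
Proof.
rewrite /ip; have -> : u *m v^T = (v *m u^T)^T by rewrite trmx_mul trmxK.
by rewrite mxE.
Qed.

Let bfDZ u v (t : R) :
  bf (u + t *: v) (u + t *: v) = bf u u + 2 * t * bf u v + t ^+ 2 * bf v v.
Proof.
have -> : 2 * t * bf u v = t * bf u v + t * bf v u by rewrite (bfC v); ring.
rewrite /bf linearD linearZ /= !(mulmxDl, mulmxDr) -!(scalemxAl, scalemxAr) !mxE.
by rewrite /GRing.scale /=; ring.
Qed.

Let ipDZ u v (t : R) :
  ip (u + t *: v) (u + t *: v) = ip u u + 2 * t * ip u v + t ^+ 2 * ip v v.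
Proof.
have -> : 2 * t * ip u v = t * ip u v + t * ip v u by rewrite (ipC v); ring.
rewrite /ip linearD linearZ /= !(mulmxDl, mulmxDr) -!(scalemxAl, scalemxAr) !mxE.
by rewrite /GRing.scale /=; ring.
Qed.

Let ipE u : ip u u = \sum_j u 0 j ^+ 2.
Proof. by rewrite /ip mxE; apply: eq_bigr => j _; rewrite mxE expr2. Qed.

Let ip_ge0 u : 0 <= ip u u.
Proof. by rewrite ipE sumr_ge0// => j _; exact: sqr_ge0. Qed.

Let ip_eq0 u : ip u u = 0 -> u = 0.
Proof.
rewrite ipE => /eqP; rewrite psumr_eq0; last by move=> j _; exact: sqr_ge0.
move=> /allP h; apply/rowP => j; rewrite mxE.
by have := h j (mem_index_enum j); rewrite sqrf_eq0 => /eqP.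
Qed.

Let bf_continuous : continuous (fun v : 'rV[R]_p => bf v v).
Proof.
rewrite (_ : (fun v => bf v v) =
    fun v : 'rV[R]_p => \sum_j (\sum_l v 0 l * M l j) * v 0 j); last first.
  apply/funext => v; rewrite /bf mxE; apply: eq_bigr => j _; rewrite !mxE.
  by congr (_ * _); apply: eq_bigr => l _.
have cM j : continuous (fun v : 'rV[R]_p => \sum_l v 0 l * M l j).
  apply: continuous_sum => l v.
  by apply: continuousM; [exact: coord_continuous|exact: cst_continuous].
apply: continuous_sum => j v.
by apply: continuousM; [exact: cM|exact: coord_continuous].
Qed.

Let ip_continuous : continuous (fun v : 'rV[R]_p => ip v v).
Proof.
rewrite (_ : (fun v => ip v v) = fun v : 'rV[R]_p => \sum_j v 0 j * v 0 j); last first.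
  by apply/funext => v; rewrite ipE; apply: eq_bigr => j _; rewrite expr2.
by apply: continuous_sum => j v; apply: continuousM; exact: coord_continuous.
Qed.

Let sphere : set 'rV[R]_p := [set v | ip v v = 1].

Let sphere_compact : compact sphere.
Proof.
apply: bounded_closed_compact.
  exists 1; split; first exact: num_real.
  move=> x x1 v; rewrite /sphere /= => v1.
  rewrite (_ : `|v| = mx_norm v)// mx_normrE; apply/bigmax_leP; split; first by rewrite (le_trans _ (ltW x1)).
  move=> [i j] _ /=; rewrite (ord1 i); apply: le_trans (ltW x1).
  have h : v 0 j ^+ 2 <= 1.
    rewrite -[leRHS]v1 ipE (bigD1 j)//= lerDl sumr_ge0// => l _; exact: sqr_ge0.
  by rewrite -(@ler_sqr _ `|v 0 j| 1) ?nnegrE// expr1n real_normK ?num_real.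
rewrite (_ : sphere = (fun v => ip v v) @^-1` [set 1]) //.
by apply: (continuous_closedP _).1 ip_continuous _ _; exact: closed_eq.
Qed.

(** The minimum [mu] of the form on the unit sphere is attained by compactness, and the vanishing of
    its first variation makes the minimiser an eigenvector, whence [lambda_min M <= mu]. *)
Lemma rayleigh (v : 'rV[R]_p) :
  lambda_min M * \sum_j v 0 j ^+ 2 <= (v *m M *m v^T) 0 0.
Proof.
rewrite -ipE -/(bf v v).
have [->|v0] := eqVneq v 0.
  by rewrite /ip /bf !mul0mx !mxE mulr0.
have ip0 : 0 < ip v v.
  rewrite lt_neqAle ip_ge0 andbT eq_sym; apply/eqP => /ip_eq0 e.
  by rewrite e eqxx in v0.
have normalize (x : 'rV[R]_p) : 0 < ip x x -> let c := (Num.sqrt (ip x x))^-1 in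
    ip (c *: x) (c *: x) = 1 /\ bf (c *: x) (c *: x) = bf x x / ip x x.
  move=> x0 c; have := ipDZ 0 x c; have := bfDZ 0 x c.
  rewrite !add0r.
  have -> : bf 0 x = 0 by rewrite /bf !mul0mx mxE.
  have -> : ip 0 x = 0 by rewrite /ip !mul0mx mxE.
  have -> : bf 0 0 = 0 by rewrite /bf !mul0mx mxE.
  have -> : ip 0 0 = 0 by rewrite /ip !mul0mx mxE.
  rewrite mulr0 !add0r => -> ->.
  have -> : c ^+ 2 = (ip x x)^-1 by rewrite exprVn sqr_sqrtr// ltW.
  by rewrite mulVf ?gt_eqF// mulrC.
have s0 : sphere !=set0.
  by exists ((Num.sqrt (ip v v))^-1 *: v); have [] := normalize v ip0.
have [v1] := @EVT_min_rV R p (fun v => bf v v) sphere s0 sphere_compact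
  (continuous_subspaceT bf_continuous).
rewrite inE /sphere /= => v11 minv1.
set mu := bf v1 v1 in minv1.
have mu_le x : mu * ip x x <= bf x x.
  have := ip_ge0 x; rewrite le_eqVlt => /predU1P[/esym/ip_eq0 ->|x0].
    by rewrite /ip /bf !mul0mx !mxE mulr0.
  have [e1 e2] := normalize x x0.
  have := minv1 ((Num.sqrt (ip x x))^-1 *: x); rewrite inE /sphere /= e1 e2.
  by rewrite ler_pdivlMr//; apply.
(* A polynomial 2 t b + t^2 c that is nonnegative for all t has b = 0; the test point involves
   [c + 1] because [c] may vanish. *)
have first_order x : bf v1 x - mu * ip v1 x = 0.
  set b := bf v1 x - mu * ip v1 x; set c := bf x x - mu * ip x x.
  have h (t : R) : 0 <= 2 * t * b + t ^+ 2 * c.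
    have := mu_le (v1 + t *: x); rewrite bfDZ ipDZ v11 -/mu /b /c; lra.
  have c0 : 0 <= c by rewrite subr_ge0 mu_le.
  have := h (- b / (c + 1)).
  have -> : 2 * (- b / (c + 1)) * b + (- b / (c + 1)) ^+ 2 * c =
    - (b / (c + 1)) ^+ 2 * (c + 2) by field; rewrite gt_eqF//; lra.
  rewrite mulNr oppr_ge0 pmulr_lle0; last lra.
  move=> hb; have : (b / (c + 1)) ^+ 2 = 0 by apply/eqP; rewrite eq_le hb sqr_ge0.
  move/eqP; rewrite sqrf_eq0 mulf_eq0 invr_eq0 => /orP[/eqP //|].
  by rewrite gt_eqF//; lra.
have eig : v1 *m M = mu *: v1.
  apply/rowP => j; have := first_order (delta_mx 0 j).
  rewrite /bf /ip trmx_delta -!colE => /eqP; rewrite subr_eq0 => /eqP.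
  by rewrite !mxE.
have v1n0 : v1 != 0.
  by apply/eqP => v10; move: v11; rewrite v10 /ip mul0mx mxE => /eqP; rewrite eq_sym oner_eq0.
apply: le_trans (mu_le v); rewrite ler_wpM2r//.
apply: ge_inf; last by apply/eigenvalueP; exists v1.
(* [mu] bounds all eigenvalues from below; without a lower bound the infimum would be a default
   value. *)
exists mu => a /eigenvalueP[x xM x0].
have ipx : 0 < ip x x.
  rewrite lt_neqAle ip_ge0 andbT eq_sym; apply/eqP => /ip_eq0 e.
  by rewrite e eqxx in x0.
have e : bf x x = a * ip x x by rewrite /bf xM -scalemxAl mxE.
by have := mu_le x; rewrite e ler_pM2r.
Qed.

End Rayleigh.

(** * Moments and tails of sub-gaussian variables *)

Lemma measurable_natr_le (R : realType) (d : measure_display) (T : measurableType d)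
    (f : T -> R) (c : R) : measurable_fun setT f ->
  measurable_fun setT (fun w => (f w <= c)%R%:R : R).
Proof.
move=> mf; rewrite (_ : (fun w => _) = \1_[set w | f w <= c]).
  apply: measurable_indic; rewrite -[X in measurable X]setTI.
  exact: measurable_fun_le.
apply/funext => w; rewrite indicE; congr (nat_of_bool _)%:R.
by apply/idP/idP; rewrite inE.
Qed.

Section Moments.
Context (R : realType) (d : measure_display) (Omega : measurableType d).
Variable P : probability Omega R.
Implicit Types f g V u : Omega -> R.

Notation Ex f := (\int[P]_w (f w))%R.

(** An exponential moment at one explicit scale, which avoids the infimum in [psi2_norm]. *)
Definition subgaussian V (t : R) : Prop :=
  (\int[P]_w (expR (V w ^+ 2 / t ^+ 2))%:E <= 2%:E)%E.

Lemma le_integrable_ge0 f g : measurable_fun setT f -> measurable_fun setT g ->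
  (forall w, `|f w| <= g w) -> (\int[P]_w (g w)%:E < +oo)%E ->
  P.-integrable setT (EFin \o f).
Proof.
move=> mf mg fg gfin; apply/integrableP; split; first exact/measurable_EFinP.
apply: le_lt_trans gfin; apply: ge0_le_integral => //.
- by apply/measurable_EFinP; exact: measurableT_comp.
- exact/measurable_EFinP.
- by move=> w _ /=; rewrite lee_fin fg.
Qed.

Lemma Ex_cst (c : R) : Ex (fun=> c) = c.
Proof.
by rewrite Rintegral_cst//= probability_setT mulr1.
Qed.

Lemma integrable_cst (c : R) : P.-integrable setT (EFin \o (fun=> c)).
Proof.
apply: (@le_integrable_ge0 _ (fun=> `|c|)) => //.
by rewrite integral_cst//= probability_setT mule1 ltry.
Qed.

Lemma integrable_addr f g : P.-integrable setT (EFin \o f) ->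
  P.-integrable setT (EFin \o g) -> P.-integrable setT (EFin \o (fun w => f w + g w)).
Proof.
move=> fi gi; rewrite (_ : EFin \o _ = (EFin \o f) \+ (EFin \o g))%E.
  exact: integrableD.
by apply/funext.
Qed.

Lemma integrable_mulr c f : P.-integrable setT (EFin \o f) ->
  P.-integrable setT (EFin \o (fun w => c * f w)).
Proof.
move=> fi; rewrite (_ : EFin \o _ = (fun w => c%:E * (EFin \o f) w)%E).
  exact: integrableZl.
by apply/funext => w /=; rewrite EFinM.
Qed.

Lemma measurable_of_integrable f :
  P.-integrable setT (EFin \o f) -> measurable_fun setT f.
Proof. by move=> /measurable_int /measurable_EFinP. Qed.

Lemma integrable_ltpinfty f : P.-integrable setT (EFin \o f) ->
  (\int[P]_w (f w)%:E < +oo)%E.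
Proof. by move=> fi; rewrite ltey_eq (integrable_fin_num _ fi). Qed.

(** The pattern of the exponential moment bounds below: a majorant with mean at most 1 + c, and 1 +
    c <= e^c. *)
Lemma integral_exp_le (h f : Omega -> R) (c : R) : measurable_fun setT h ->
  P.-integrable setT (EFin \o f) -> (forall w, expR (h w) <= f w) ->
  Ex f <= 1 + c -> (\int[P]_w (expR (h w))%:E <= (expR c)%:E)%E.
Proof.
move=> mh fi hf fc.
apply: (@le_trans _ _ (\int[P]_w (f w)%:E)%E).
  apply: ge0_le_integral => //.
  - by apply/measurable_EFinP; exact: measurableT_comp.
  - by apply/measurable_EFinP; exact: measurable_of_integrable.
  - by move=> w _; rewrite lee_fin.
rewrite -[leLHS]fineK; last exact: integrable_fin_num.
by rewrite lee_fin (le_trans fc)// expR_ge1Dx.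
Qed.

Lemma subgaussian_lty V t : subgaussian V t ->
  (\int[P]_w (expR (V w ^+ 2 / t ^+ 2))%:E < +oo)%E.
Proof. by move=> /le_lt_trans; apply; rewrite ltry. Qed.

Lemma measurable_exp_sqr V t : measurable_fun setT V ->
  measurable_fun setT (fun w => expR (V w ^+ 2 / t ^+ 2)).
Proof.
move=> mV; apply: measurableT_comp => //; apply: measurable_funM => //.
exact: measurable_funX.
Qed.

Lemma integrable_exp_sqr V t : measurable_fun setT V -> subgaussian V t ->
  P.-integrable setT (EFin \o (fun w => expR (V w ^+ 2 / t ^+ 2))).
Proof.
move=> mV sV; apply: le_integrable_ge0 (subgaussian_lty sV).
- exact: measurable_exp_sqr.
- exact: measurable_exp_sqr.
- by move=> w; rewrite ger0_norm ?expR_ge0.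
Qed.

Lemma Ex_exp_sqr_le V t : measurable_fun setT V -> subgaussian V t ->
  Ex (fun w => expR (V w ^+ 2 / t ^+ 2)) <= 2.
Proof.
move=> mV sV; rewrite -lee_fin fineK//.
exact: integrable_fin_num (integrable_exp_sqr mV sV).
Qed.

Lemma sqr_le_exp_sqr (v t : R) : 0 < t -> v ^+ 2 <= t ^+ 2 * expR (v ^+ 2 / t ^+ 2).
Proof.
move=> t0; have t20 : 0 < t ^+ 2 by rewrite exprn_gt0.
by rewrite mulrC -ler_pdivrMr// (le_trans _ (expR_ge1Dx _))// lerDr.
Qed.

Lemma quartic_le_exp_sqr (v t : R) : 0 < t ->
  v ^+ 4 <= 4 * t ^+ 4 * expR (v ^+ 2 / t ^+ 2).
Proof.
move=> t0; have t40 : 0 < t ^+ 4 by rewrite exprn_gt0.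
have h : 0 <= v ^+ 2 / t ^+ 2 by rewrite divr_ge0// sqr_ge0.
rewrite (mulrC 4) -mulrA mulrC -ler_pdivrMr// (le_trans _ (sqr_le_expR h))//.
by rewrite expr_div_n -!exprM.
Qed.

Lemma subgaussian_integrable_sqr V t : 0 < t -> measurable_fun setT V ->
  subgaussian V t -> P.-integrable setT (EFin \o (fun w => V w ^+ 2)).
Proof.
move=> t0 mV sV; apply: (@le_integrable_ge0 _
    (fun w => t ^+ 2 * expR (V w ^+ 2 / t ^+ 2))).
- exact: measurable_funX.
- by apply: measurable_funM => //; exact: measurable_exp_sqr.
- by move=> w; rewrite ger0_norm ?sqr_ge0// sqr_le_exp_sqr.
- exact: (integrable_ltpinfty (integrable_mulr _ (integrable_exp_sqr mV sV))).
Qed.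

Lemma subgaussian_integrable V t : 0 < t -> measurable_fun setT V ->
  subgaussian V t -> P.-integrable setT (EFin \o V).
Proof.
move=> t0 mV sV; apply: (@le_integrable_ge0 _ (fun w => 1 + V w ^+ 2)) => //.
- by apply: measurable_funD => //; exact: measurable_funX.
- move=> w; rewrite -(real_normK (num_real (V w))).
  have := sqr_ge0 (`|V w| - 1); have := normr_ge0 (V w).
  by rewrite !expr2; lra.
- exact: (integrable_ltpinfty (integrable_addr (integrable_cst 1)
    (subgaussian_integrable_sqr t0 mV sV))).
Qed.

Lemma subgaussian_quartic V t : 0 < t -> measurable_fun setT V ->
  subgaussian V t -> P.-integrable setT (EFin \o (fun w => V w ^+ 4)) /\
    Ex (fun w => V w ^+ 4) <= 8 * t ^+ 4.
Proof.
move=> t0 mV sV.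
have i4 := integrable_mulr (4 * t ^+ 4) (integrable_exp_sqr mV sV).
have iV : P.-integrable setT (EFin \o (fun w => V w ^+ 4)).
  apply: (@le_integrable_ge0 _ (fun w => 4 * t ^+ 4 * expR (V w ^+ 2 / t ^+ 2))).
  - exact: measurable_funX.
  - by apply: measurable_funM => //; exact: measurable_exp_sqr.
  - by move=> w; rewrite ger0_norm ?quartic_le_exp_sqr// -[4%N]/(2 * 2)%N exprM sqr_ge0.
  - exact: (integrable_ltpinfty i4).
split=> //; apply: (@le_trans _ _ (Ex (fun w => 4 * t ^+ 4 * expR (V w ^+ 2 / t ^+ 2)))).
  by apply: le_Rintegral => // w _; exact: quartic_le_exp_sqr.
rewrite RintegralZl//; last exact: integrable_exp_sqr.
rewrite (_ : 8 * t ^+ 4 = 4 * t ^+ 4 * 2); last by ring.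
by rewrite ler_wpM2l ?Ex_exp_sqr_le// mulr_ge0// exprn_ge0// ltW.
Qed.

(** For y >= 0 one has e^{-y} <= 1 - y + y^2, so fourth moments of [V] and [u] suffice. [V] will be
    the prediction by a normalised vector and [rho] the original length, so that the truncation acts
    on the unnormalised prediction. *)
Lemma truncated_mgf V u (t s kappa M rho lam : R) : 0 < t -> 0 < s -> 0 < M -> 0 <= lam ->
  measurable_fun setT V -> measurable_fun setT u -> subgaussian V t -> subgaussian u s ->
  kappa <= Ex (fun w => V w ^+ 2) ->
  (\int[P]_w (expR (- lam * (V w ^+ 2 * (`|rho * V w| <= M)%R%:R
      * (`|u w| <= M)%R%:R)))%:E
   <= (expR (- (lam * kappa) + lam * ((8 * rho ^+ 2 + 4) * t ^+ 4 + 4 * s ^+ 4) / M ^+ 2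
        + 8 * lam ^+ 2 * t ^+ 4))%:E)%E.
Proof.
move=> t0 s0 M0 lam0 mV mu sV su hk.
have [iV4 EV4] := subgaussian_quartic t0 mV sV.
have [iu4 Eu4] := subgaussian_quartic s0 mu su.
have iV2 := subgaussian_integrable_sqr t0 mV sV.
have M20 : 0 < M ^+ 2 by rewrite exprn_gt0.
(* [ca] and [cb] collect the coefficients of V^4 and u^4: the truncation loss of [xilow], and lam^2
   from the second-order term. *)
pose ca := lam * (rho ^+ 2 + 1 / 2) / M ^+ 2 + lam ^+ 2.
pose cb := lam * (1 / 2) / M ^+ 2.
have ca0 : 0 <= ca.
  rewrite addr_ge0 ?sqr_ge0// divr_ge0 ?(ltW M20)// mulr_ge0//.
  by rewrite addr_ge0 ?sqr_ge0.
have cb0 : 0 <= cb by rewrite divr_ge0 ?(ltW M20)// mulr_ge0.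
apply: (@integral_exp_le _ (fun w => 1 + (- lam) * V w ^+ 2 + ca * V w ^+ 4 + cb * u w ^+ 4)).
- apply: measurable_funM => //; apply: measurable_funM; last first.
    by apply: measurable_natr_le; exact: measurableT_comp.
  apply: measurable_funM; first exact: measurable_funX.
  apply: measurable_natr_le; apply: measurableT_comp => //.
  exact: measurable_funM.
- do 3 (apply: integrable_addr; last by apply: integrable_mulr).
  exact: integrable_cst.
- move=> w; set b1 := (`|rho * V w| <= M)%R; set b2 := (`|u w| <= M)%R.
  set xi := V w ^+ 2 * b1%:R * b2%:R.
  have xi0 : 0 <= xi by apply: mulr_ge0; rewrite ?ler0n//; apply: mulr_ge0; rewrite ?ler0n ?sqr_ge0.
  have xiV : xi <= V w ^+ 2.
    rewrite /xi -mulrA -[leRHS]mulr1 ler_wpM2l ?sqr_ge0//.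
    by rewrite -natrM mulnb lern1 leq_b1.
  have V40 : 0 <= V w ^+ 2 * V w ^+ 2 by apply: mulr_ge0; exact: sqr_ge0.
  have u40 : 0 <= u w ^+ 2 * u w ^+ 2 by apply: mulr_ge0; exact: sqr_ge0.
  (* A failing indicator costs at most V^2 times (rho V)^2 / M^2 or u^2 / M^2, and
     V^2 u^2 is split by AM-GM. *)
  have xilow : V w ^+ 2 - (rho ^+ 2 + 1 / 2) * (V w ^+ 2 * V w ^+ 2) / M ^+ 2
      - 1 / 2 * (u w ^+ 2 * u w ^+ 2) / M ^+ 2 <= xi.
    rewrite -(ler_pM2r M20) !mulrBl !divfK ?gt_eqF//.
    have r0 : 0 <= rho ^+ 2 * (V w ^+ 2 * V w ^+ 2) by apply: mulr_ge0; exact: sqr_ge0.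
    have xi20 : 0 <= xi * M ^+ 2 by rewrite mulr_ge0// sqr_ge0.
    have amgm : V w ^+ 2 * u w ^+ 2 <=
        1 / 2 * (V w ^+ 2 * V w ^+ 2) + 1 / 2 * (u w ^+ 2 * u w ^+ 2).
      by have := sqr_ge0 (V w ^+ 2 - u w ^+ 2); rewrite !expr2; lra.
    have [b1T|b1F] := boolP b1; last first.
      have h : M ^+ 2 <= rho ^+ 2 * V w ^+ 2.
        rewrite -exprMn -(real_normK (num_real (rho * V w))).
        by rewrite lerXn2r ?nnegrE ?normr_ge0 ?(ltW M0)// ltW// ltNge.
      have := ler_wpM2l (sqr_ge0 (V w)) h; lra.
    have [b2T|b2F] := boolP b2; last first.
      have h : M ^+ 2 <= u w ^+ 2.
        rewrite -(real_normK (num_real (u w))).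
        by rewrite lerXn2r ?nnegrE ?normr_ge0 ?(ltW M0)// ltW// ltNge.
      have := ler_wpM2l (sqr_ge0 (V w)) h; lra.
    rewrite /xi b1T b2T !mulr1; lra.
  rewrite mulNr.
  apply: (le_trans (expRN_le (mulr_ge0 lam0 xi0))).
  have h1 : (lam * xi) ^+ 2 <= lam ^+ 2 * (V w ^+ 2 * V w ^+ 2).
    by rewrite exprMn ler_wpM2l ?sqr_ge0// expr2; apply: ler_pM.
  have h2 := ler_wpM2l lam0 xilow.
  have -> : V w ^+ 4 = V w ^+ 2 * V w ^+ 2 by rewrite -exprD.
  have -> : u w ^+ 4 = u w ^+ 2 * u w ^+ 2 by rewrite -exprD.
  move: h1 h2; rewrite /ca /cb; move: (M ^+ 2)^-1 => iM; clearbody xi.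
  move: (V w ^+ 2 * V w ^+ 2) (u w ^+ 2 * u w ^+ 2) ((lam * xi) ^+ 2) => A B C.
  lra.
have i0 := integrable_cst 1.
have i1 := integrable_addr i0 (integrable_mulr (- lam) iV2).
have i2 := integrable_addr i1 (integrable_mulr ca iV4).
rewrite !RintegralD//; try by apply: integrable_mulr.
rewrite !RintegralZl// Ex_cst.
have h1 := ler_wpM2l lam0 hk.
have h2 := ler_wpM2l ca0 EV4.
have h3 := ler_wpM2l cb0 Eu4.
rewrite -!addrA lerD2l.
apply: (@le_trans _ _ (- lam * Ex (fun w => V w ^+ 2) + (ca * (8 * t ^+ 4) + cb * (8 * s ^+ 4)))).
  by rewrite lerD2l lerD.
rewrite mulNr; apply: (@le_trans _ _ (- (lam * kappa) + (ca * (8 * t ^+ 4) + cb * (8 * s ^+ 4)))).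
  by rewrite lerD2r lerN2.
rewrite lerD2l le_eqVlt; apply/orP; left; apply/eqP; rewrite /ca /cb; field.
by rewrite gt_eqF.
Qed.

(** 32 is the constant of [expR_bernstein] times the bound 2 on the exponential moment. *)
Lemma bernstein_mgf (xi : Omega -> R) (lam : R) : measurable_fun setT xi ->
  (\int[P]_w (expR `|xi w|)%:E <= 2%:E)%E -> `|lam| <= 1 / 2 ->
  (\int[P]_w (expR (lam * xi w))%:E <= (expR (lam * Ex xi + 32 * lam ^+ 2))%:E)%E.
Proof.
move=> mxi hxi lam2.
have mexp : measurable_fun setT (fun w => expR `|xi w|).
  by apply: measurableT_comp => //; exact: measurableT_comp.
have hxi' : (\int[P]_w (expR `|xi w|)%:E < +oo)%E by rewrite (le_lt_trans hxi)// ltry.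
have iexp : P.-integrable setT (EFin \o (fun w => expR `|xi w|)).
  by apply: le_integrable_ge0 hxi' => // w; rewrite ger0_norm ?expR_ge0.
have ixi : P.-integrable setT (EFin \o xi).
  apply: le_integrable_ge0 hxi' => // w.
  by rewrite (le_trans _ (expR_ge1Dx _))// lerDr.
have Eexp : Ex (fun w => expR `|xi w|) <= 2.
  by rewrite -lee_fin fineK//; exact: integrable_fin_num iexp.
apply: (@integral_exp_le _ (fun w => 1 + lam * xi w + 16 * lam ^+ 2 * expR `|xi w|)).
- exact: measurable_funM.
- do 2 (apply: integrable_addr; last by apply: integrable_mulr).
  exact: integrable_cst.
- by move=> w; exact: expR_bernstein.
have i0 := integrable_cst 1; have i1 := integrable_addr i0 (integrable_mulr lam ixi).
rewrite !RintegralD//; try by apply: integrable_mulr.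
rewrite !RintegralZl// Ex_cst -!addrA !lerD2l.
rewrite (_ : 32 * lam ^+ 2 = 16 * lam ^+ 2 * 2); last by ring.
by rewrite ler_wpM2l// mulr_ge0// sqr_ge0.
Qed.

Lemma exp_mean3_le (a b c : R) :
  expR ((a + b + c) / 3) <= (expR a + expR b + expR c) / 3.
Proof.
set m := (a + b + c) / 3.
have tan x : expR m * (1 + (x - m)) <= expR x.
  rewrite -[x in leRHS](subrK m) [leRHS]expRD mulrC ler_wpM2r ?expR_ge0//.
  exact: expR_ge1Dx.
have := tan a; have := tan b; have := tan c.
have : expR m * (1 + (a - m)) + expR m * (1 + (b - m)) + expR m * (1 + (c - m)) = 3 * expR m.
  by rewrite /m; field.
lra.
Qed.

(** One has |zeta V| <= V^2 + g^2 + Lu^2 u^2. As [tau] is at least 3 times each squared scale, the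
    exponent is at most a mean of three exponents, and convexity of exp bounds the integral by a
    mean of three exponential moments, each at most 2. *)
Lemma product_subexponential V g u (zeta : Omega -> R) (tv tg tu Lu tau : R) :
  0 < tv -> 0 < tg -> 0 < tu -> 0 < tau -> 0 < Lu ->
  measurable_fun setT V -> measurable_fun setT g -> measurable_fun setT u ->
  measurable_fun setT zeta ->
  subgaussian V tv -> subgaussian g tg -> subgaussian u tu ->
  (forall w, `|zeta w| <= `|g w| + Lu * `|u w|) ->
  3 * tv ^+ 2 <= tau -> 3 * tg ^+ 2 <= tau -> 3 * (Lu ^+ 2 * tu ^+ 2) <= tau ->
  (\int[P]_w (expR `|zeta w * V w / tau|)%:E <= 2%:E)%E.
Proof.
move=> tv0 tg0 tu0 tau0 Lu0 mV mg mu mz sV sg su hz tvt tgt tut.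
have iV := integrable_exp_sqr mV sV; have ig := integrable_exp_sqr mg sg.
have iu := integrable_exp_sqr mu su.
pose F w := 1 / 3 * expR (V w ^+ 2 / tv ^+ 2) + 1 / 3 * expR (g w ^+ 2 / tg ^+ 2)
  + 1 / 3 * expR (u w ^+ 2 / tu ^+ 2).
have iF : P.-integrable setT (EFin \o F).
  do 2 (apply: integrable_addr; last by apply: integrable_mulr).
  by apply: integrable_mulr.
apply: (@le_trans _ _ (\int[P]_w (F w)%:E)%E).
  apply: ge0_le_integral => //.
  - apply/measurable_EFinP; apply: measurableT_comp => //; apply: measurableT_comp => //.
    by apply: measurable_funM => //; exact: measurable_funM.
  - by apply/measurable_EFinP; exact: measurable_of_integrable.
  - move=> w _; rewrite lee_fin.
    have -> : F w = (expR (V w ^+ 2 / tv ^+ 2) + expR (g w ^+ 2 / tg ^+ 2)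
      + expR (u w ^+ 2 / tu ^+ 2)) / 3 by rewrite /F; field.
    apply: le_trans (exp_mean3_le _ _ _); rewrite ler_expR.
    rewrite normrM normfV (gtr0_norm tau0) ler_pdivrMr//.
    have red (x t T : R) : 0 < t -> 3 * T <= tau -> 0 <= x -> x <= T * t ->
      x <= t / 3 * tau.
      by move=> t0 Tt x0 xT; have := ler_wpM2l (ltW t0) Tt; lra.
    have bnd (x t : R) : 0 < t -> 3 * t ^+ 2 <= tau -> x ^+ 2 <= x ^+ 2 / t ^+ 2 / 3 * tau.
      move=> t0 Tt; have h : 0 <= x ^+ 2 / t ^+ 2 by rewrite divr_ge0 ?sqr_ge0.
      have := ler_wpM2l h Tt; rewrite mulrCA divfK ?gt_eqF ?exprn_gt0//; lra.
    have b1 := bnd (V w) tv tv0 tvt; have b2 := bnd (g w) tg tg0 tgt.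
    have b3 := bnd (Lu * u w) (Lu * tu) (mulr_gt0 Lu0 tu0).
    rewrite !exprMn in b3; have {}b3 := b3 tut.
    have e3 : Lu ^+ 2 * u w ^+ 2 / (Lu ^+ 2 * tu ^+ 2) = u w ^+ 2 / tu ^+ 2.
      by field; rewrite !gt_eqF.
    rewrite e3 in b3.
    apply: (@le_trans _ _ (V w ^+ 2 + g w ^+ 2 + Lu ^+ 2 * u w ^+ 2)); last first.
      by rewrite !mulrDl; lra.
    rewrite normrM; apply: (le_trans (ler_wpM2r (normr_ge0 _) (hz w))).
    rewrite -(real_normK (num_real (V w))) -(real_normK (num_real (g w))).
    rewrite -(real_normK (num_real (u w))).
    have := sqr_ge0 (`|g w| + Lu * `|u w| - `|V w|).
    have := sqr_ge0 (`|g w| - Lu * `|u w|).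
    have := sqr_ge0 (`|V w|); rewrite !expr2; lra.
rewrite -[leLHS]fineK; last exact: integrable_fin_num iF.
have i1 := integrable_addr (integrable_mulr (1 / 3) iV) (integrable_mulr (1 / 3) ig).
rewrite lee_fin -/(Rintegral P setT F) /F !RintegralD//; try by apply: integrable_mulr.
rewrite !RintegralZl//.
rewrite (_ : 2 = 1 / 3 * 2 + 1 / 3 * 2 + 1 / 3 * 2); last by field.
have c3 : 0 <= 1 / 3 :> R by rewrite divr_ge0.
apply: lerD; [apply: lerD|]; apply: (ler_wpM2l c3).
- exact: Ex_exp_sqr_le mV sV.
- exact: Ex_exp_sqr_le mg sg.
- exact: Ex_exp_sqr_le mu su.
Qed.

End Moments.

(** * Tail bounds for sample averages *)

Section Tails.
Context (R : realType) (d dT : measure_display) (Omega : measurableType d).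
Context (T : measurableType dT) (P : probability Omega R).
Variables (n : nat) (Z : 'I_n -> Omega -> T) (i1 : 'I_n).
Hypothesis iidZ : iid P Z.

Notation Ex f := (\int[P]_w (f w))%R.

Let n0 : 0 < n%:R :> R.
Proof. by rewrite ltr0n; case: (n) i1 => // -[]. Qed.

Lemma measurable_avg (f : T -> R) : measurable_fun setT f ->
  measurable_fun setT (fun w => avg (fun i => f (Z i w))).
Proof.
move=> mf; apply: measurable_funM => //; apply: measurable_sum => i.
by apply: measurableT_comp => //; case: iidZ => + _ _; apply.
Qed.

(** The exponential moment is at most 2 <= e, so the exponent at the threshold 4n is n - 4n. *)
Lemma tail_sqr (V : T -> R) (t : R) : 0 < t -> measurable_fun setT V ->
  subgaussian P (V \o Z i1) t ->
  (P [set w | (4 * t ^+ 2 <= avg (fun i => V (Z i w) ^+ 2))%R]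
     <= (expR (- (3 * n%:R)))%:E)%E.
Proof.
move=> t0 mV sV; have t20 : 0 < t ^+ 2 by rewrite exprn_gt0.
have mh : measurable_fun setT (fun z => V z ^+ 2 / t ^+ 2).
  by apply: measurable_funM => //; exact: measurable_funX.
have hc : (\int[P]_w (expR (V (Z i1 w) ^+ 2 / t ^+ 2))%:E <= (expR 1)%:E)%E.
  by apply: (le_trans sV); rewrite lee_fin; have := expR_ge1Dx (1 : R); lra.
have := chernoff (4 * n%:R) iidZ mh hc.
rewrite mulr1 (_ : n%:R - 4 * n%:R = - (3 * n%:R)); last by ring.
congr (P _ <= _)%E; apply/funext => w /=; congr is_true.
by rewrite /avg -mulr_suml ler_pdivlMr// ler_pdivlMl// [in RHS]mulrCA mulrA.
Qed.

(** The untruncated mean is at least [kappa], truncation takes at most [kappa / 2] and the threshold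
    is [kappa / 4], which leaves a margin [kappa / 4]. *)
Lemma tail_lower (V u : T -> R) (t s kappa M rho : R) :
  0 < t -> 0 < s -> 0 < M -> 0 < kappa ->
  measurable_fun setT V -> measurable_fun setT u ->
  subgaussian P (V \o Z i1) t -> subgaussian P (u \o Z i1) s ->
  kappa <= Ex (fun w => V (Z i1 w) ^+ 2) ->
  ((8 * rho ^+ 2 + 4) * t ^+ 4 + 4 * s ^+ 4) / M ^+ 2 <= kappa / 2 ->
  (P [set w | (avg (fun i => V (Z i w) ^+ 2 * (`|rho * V (Z i w)| <= M)%R%:R
      * (`|u (Z i w)| <= M)%R%:R) <= kappa / 4)%R]
     <= (expR (- (kappa ^+ 2 / (512 * t ^+ 4) * n%:R)))%:E)%E.
Proof.
move=> t0 s0 M0 k0 mV mu sV su hk hM.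
have t40 : 0 < t ^+ 4 by rewrite exprn_gt0.
have mZ i : measurable_fun setT (Z i) by case: iidZ => + _ _; apply.
(* This makes the second-order term 8 lam^2 t^4 equal to lam kappa / 8, half of the margin; the
   other half is the exponent per observation. *)
pose lam := kappa / (64 * t ^+ 4).
have lam0 : 0 < lam by rewrite divr_gt0// mulr_gt0.
pose xi z := V z ^+ 2 * (`|rho * V z| <= M)%R%:R * (`|u z| <= M)%R%:R.
have mxi : measurable_fun setT xi.
  apply: measurable_funM; last by apply: measurable_natr_le; exact: measurableT_comp.
  apply: measurable_funM; first exact: measurable_funX.
  by apply: measurable_natr_le; apply: measurableT_comp => //; exact: measurable_funM.
have mh : measurable_fun setT (fun z => - lam * xi z) by exact: measurable_funM.
have hc := truncated_mgf rho t0 s0 M0 (ltW lam0)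
  (measurableT_comp mV (mZ i1)) (measurableT_comp mu (mZ i1)) sV su hk.
have {hc} hc : (\int[P]_w (expR (- lam * xi (Z i1 w)))%:E <=
    (expR (- (lam * kappa) + lam * (kappa / 2) + 8 * lam ^+ 2 * t ^+ 4))%:E)%E.
  apply: (le_trans hc); rewrite lee_fin ler_expR !lerD2r lerD2l -mulrA.
  by rewrite ler_wpM2l// ltW.
have := chernoff (- lam * (n%:R * (kappa / 4))) iidZ mh hc.
rewrite (_ : n%:R * _ - _ = - (kappa ^+ 2 / (512 * t ^+ 4) * n%:R)); last first.
  by rewrite /lam; field; rewrite gt_eqF.
congr (P _ <= _)%E; apply/funext => w /=; congr is_true.
by rewrite /avg -mulr_sumr ler_nM2l ?oppr_lt0// ler_pdivrMl.
Qed.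

(** The exponential parameter is [- rho]: 34 is 32, from [bernstein_mgf], plus the 2 of the
    resulting exponent. When n rho^2 = log(pK) the bound is (pK)^{-2}. *)
Lemma tail_bernstein (xi : T -> R) (rho : R) : 0 < rho <= 1 / 2 ->
  measurable_fun setT xi ->
  (\int[P]_w (expR `|xi (Z i1 w)|)%:E <= 2%:E)%E ->
  (P [set w | (avg (fun i => xi (Z i w)) <= Ex (fun w => xi (Z i1 w)) - 34 * rho)%R]
     <= (expR (- (2 * (n%:R * rho ^+ 2))))%:E)%E.
Proof.
move=> /andP[r0 r2] mxi hxi.
have mZ i : measurable_fun setT (Z i) by case: iidZ => + _ _; apply.
have rN : `|- rho| <= 1 / 2 by rewrite normrN gtr0_norm.
have hc := bernstein_mgf (measurableT_comp mxi (mZ i1)) hxi rN.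
have mh : measurable_fun setT (fun z => - rho * xi z) by exact: measurable_funM.
set m := \int[P]_w xi (Z i1 w).
have := chernoff (- rho * (n%:R * (m - 34 * rho))) iidZ mh hc.
rewrite (_ : n%:R * _ - _ = - (2 * (n%:R * rho ^+ 2))); last first.
  by rewrite -/m; ring.
congr (P _ <= _)%E; apply/funext => w /=; congr is_true.
by rewrite /avg -mulr_sumr ler_nM2l ?oppr_lt0// ler_pdivrMl.
Qed.

End Tails.

Section UnionBound.
Context (R : realType) (d : measure_display) (Omega : measurableType d).
Variable P : probability Omega R.

Lemma union_bound (I : finType) (B : I -> set Omega) (e : R) :
  (forall i, measurable (B i)) -> (forall i, (P (B i) <= e%:E)%E) ->
  measurable [set w | exists i, B i w] /\
    (P [set w | exists i, B i w] <= (#|I|%:R * e)%:E)%E.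
Proof.
move=> mB PB.
have H (s : seq I) : measurable (\big[setU/set0]_(i <- s) B i) /\
    (P (\big[setU/set0]_(i <- s) B i) <= ((size s)%:R * e)%:E)%E.
  elim: s => [|i s [IHm IHP]]; first by rewrite big_nil measure0 mul0r.
  rewrite big_cons; split; first exact: measurableU.
  apply: (le_trans (measureU2 _ _ _)) => //.
  by rewrite /= -natr1 mulrDl mul1r addrC EFinD leeD.
have -> : [set w | exists i, B i w] = \big[setU/set0]_(i <- enum I) B i.
  rewrite -bigcup_seq; apply/seteqP; split => w.
    by move=> [i Bi]; exists i => //=; rewrite mem_enum.
  by move=> [i _ Bi]; exists i.
by have := H (enum I); rewrite -cardE.
Qed.

End UnionBound.

(** * Norms, moments of the covariates, and the loss *)

Section Norms.
Variable R : realType.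

Lemma lnorm2_sqr p (v : 'cV[R]_p) : lnorm 2 v ^+ 2 = \sum_j v j 0 ^+ 2.
Proof.
rewrite /lnorm powR12_sqrt ?sumr_ge0//.
rewrite sqr_sqrtr; last by apply: sumr_ge0 => j _; exact: powR_ge0.
by apply: eq_bigr => j _; rewrite powR_mulrn// real_normK ?num_real.
Qed.

Lemma lnorm1E p (v : 'cV[R]_p) : lnorm 1 v = \sum_j `|v j 0|.
Proof.
rewrite /lnorm invr1 powRr1; last by apply: sumr_ge0 => j _; exact: powR_ge0.
by apply: eq_bigr => j _; rewrite powRr1.
Qed.

Lemma lnorm_ge0 a p (v : 'cV[R]_p) : 0 <= lnorm a v.
Proof. exact: powR_ge0. Qed.

Lemma lnorm2_eq0 p (v : 'cV[R]_p) : lnorm 2 v = 0 -> v = 0.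
Proof.
move=> v0; have := lnorm2_sqr v; rewrite v0 expr0n /= => /esym/eqP.
rewrite psumr_eq0; last by move=> j _; exact: sqr_ge0.
move=> /allP h; apply/colP => j; rewrite mxE.
by have := h j (mem_index_enum j); rewrite sqrf_eq0 => /eqP.
Qed.

Lemma lnorm2Z p (c : R) (v : 'cV[R]_p) : lnorm 2 (c *: v) = `|c| * lnorm 2 v.
Proof.
have e : lnorm 2 (c *: v) ^+ 2 = `|c| ^+ 2 * lnorm 2 v ^+ 2.
  transitivity (`|c| ^+ 2 * \sum_j v j 0 ^+ 2).
    rewrite lnorm2_sqr (real_normK (num_real c)) mulr_sumr.
    by apply: eq_bigr => j _; rewrite mxE exprMn.
  by congr (_ * _); exact/esym/lnorm2_sqr.
apply/eqP; rewrite -(@eqrXn2 _ 2) ?mulr_ge0 ?lnorm_ge0// e.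
by apply/eqP/esym; exact: exprMn.
Qed.

Lemma dotvC p (u v : 'cV[R]_p) : dotv u v = dotv v u.
Proof. by apply: eq_bigr => j _; rewrite mulrC. Qed.

Lemma dotvZl p (c : R) (u v : 'cV[R]_p) : dotv (c *: u) v = c * dotv u v.
Proof. by rewrite mulr_sumr; apply: eq_bigr => j _; rewrite mxE mulrA. Qed.

Lemma dotvDl p (u1 u2 v : 'cV[R]_p) : dotv (u1 + u2) v = dotv u1 v + dotv u2 v.
Proof. by rewrite -big_split; apply: eq_bigr => j _; rewrite mxE mulrDl. Qed.

Lemma dotv0l p (v : 'cV[R]_p) : dotv 0 v = 0.
Proof. by rewrite /dotv big1// => j _; rewrite mxE mul0r. Qed.

Lemma dotv_suml p (T : Type) (s : seq T) (u : T -> 'cV[R]_p) v :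
  dotv (\sum_(t <- s) u t) v = \sum_(t <- s) dotv (u t) v.
Proof.
elim: s => [|t s IH]; first by rewrite !big_nil dotv0l.
by rewrite !big_cons dotvDl IH.
Qed.

Lemma mulmx_cols p K (b : 'I_K -> 'cV[R]_p) (w : 'cV[R]_K) :
  mxcols b *m w = \sum_k w k 0 *: b k.
Proof.
apply/colP => j; rewrite !mxE summxE; apply: eq_bigr => k _.
by rewrite !mxE mulrC.
Qed.

Lemma dotv_cols p K (b : 'I_K -> 'cV[R]_p) (w : 'cV[R]_K) (x : 'cV[R]_p) :
  dotv (mxcols b *m w) x = \sum_k w k 0 * dotv (b k) x.
Proof. by rewrite mulmx_cols dotv_suml; apply: eq_bigr => k _; rewrite dotvZl. Qed.

Lemma lnorm2_comb_le p (T : finType) (c : T -> R) (u : T -> 'cV[R]_p) (r : R) :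
  0 <= r -> (forall t, lnorm 2 (u t) <= r) ->
  lnorm 2 (\sum_t c t *: u t) <= (\sum_t `|c t|) * r.
Proof.
move=> r0 ur; have s0 : 0 <= \sum_t `|c t| by exact: sumr_ge0.
rewrite -(@ler_pXn2r _ 2) ?nnegrE ?mulr_ge0 ?lnorm_ge0//.
rewrite lnorm2_sqr exprMn.
apply: (@le_trans _ _ (\sum_j (\sum_t `|c t|) * \sum_t `|c t| * u t j 0 ^+ 2)).
  apply: ler_sum => j _; rewrite summxE.
  under eq_bigr do rewrite mxE.
  exact: sqr_comb_le.
rewrite -mulr_sumr expr2 -mulrA ler_wpM2l// exchange_big mulr_suml ler_sum// => t _.
rewrite -mulr_sumr ler_wpM2l// -lnorm2_sqr.
by rewrite lerXn2r ?nnegrE ?lnorm_ge0.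
Qed.

End Norms.

(** * Sub-gaussian scales and second moments of the covariates *)

Section Model.
Context (R : realType) (d : measure_display) (Omega : measurableType d).
Variable P : probability Omega R.
Notation Ex f := (\int[P]_w (f w))%R.

(** The strict inequality [K < t] avoids the question whether the infimum is attained; this is the
    origin of the scales [2 * K] below. *)
Lemma psi2_norm_subgaussian (u : Omega -> R) (K t : R) : measurable_fun setT u ->
  (psi2_norm P u <= K%:E)%E -> K < t -> 0 <= K -> subgaussian P u t.
Proof.
move=> mu uK Kt K0.
have /ereal_inf_lt[_ [s [s0]] Es <-] : (psi2_norm P u < t%:E)%E.
  by rewrite (le_lt_trans uK)// lte_fin.
rewrite lte_fin => st; rewrite /subgaussian; move: Es; rewrite unlock; apply: le_trans.
apply: ge0_le_integral => //.
- by apply/measurable_EFinP; exact: measurable_exp_sqr.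
- by apply/measurable_EFinP; exact: measurable_exp_sqr.
- move=> w _; rewrite lee_fin ler_expR ler_wpM2l ?sqr_ge0//.
  have t0 : 0 < t by exact: lt_trans st.
  by rewrite lef_pV2 ?posrE ?exprn_gt0// lerXn2r ?nnegrE ?ltW.
Qed.

Lemma measurable_dotv p (X : Omega -> 'cV[R]_p) (v : 'cV[R]_p) :
  random_vector X -> measurable_fun setT (fun w => dotv v (X w)).
Proof.
move=> mX; apply: measurable_sum => j.
by apply: measurable_funM => //; exact: mX.
Qed.

Lemma psi2_vnorm_subgaussian p (X : Omega -> 'cV[R]_p) (K r : R) (v : 'cV[R]_p) :
  random_vector X -> psi2_vnorm P X = K%:E -> 0 < K -> 0 < r -> lnorm 2 v <= r ->
  subgaussian P (fun w => dotv v (X w)) (2 * K * r).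
Proof.
move=> mX XK K0 r0 vr.
have [v0|v0] := eqVneq (lnorm 2 v) 0.
  rewrite /subgaussian (lnorm2_eq0 v0); under eq_integral do rewrite dotv0l expr0n /= mul0r expR0.
  by rewrite integral_cst//= probability_setT mule1 lee_fin ler1n.
have vp : 0 < lnorm 2 v by rewrite lt_neqAle eq_sym v0 lnorm_ge0.
have K2 : K < 2 * K by rewrite mulr2n mulrDl mul1r ltrDl.
pose e := (lnorm 2 v)^-1 *: v.
have e1 : lnorm 2 e = 1 by rewrite lnorm2Z gtr0_norm ?invr_gt0// mulVf.
have se : subgaussian P (fun w => dotv (X w) e) (2 * K).
  apply: (@psi2_norm_subgaussian _ K); [|rewrite -XK|exact: K2|exact: ltW K0].
    by under eq_fun do rewrite dotvC; exact: measurable_dotv.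
  by apply: ereal_sup_ubound; exists e.
apply: le_trans se; apply: ge0_le_integral => //.
- by apply/measurable_EFinP; apply: measurable_exp_sqr; exact: measurable_dotv.
- apply/measurable_EFinP; apply: measurable_exp_sqr.
  by under eq_fun do rewrite dotvC; exact: measurable_dotv.
move=> w _; rewrite lee_fin ler_expR (dotvC _ e) dotvZl !exprMn.
rewrite ler_pdivrMr ?mulr_gt0 ?exprn_gt0//.
set D := dotv v (X w) ^+ 2; have D0 : 0 <= D by exact: sqr_ge0.
have -> : (lnorm 2 v)^-1 ^+ 2 * D / (2 ^+ 2 * K ^+ 2) * (2 ^+ 2 * K ^+ 2 * r ^+ 2) =
  D * (r ^+ 2 / lnorm 2 v ^+ 2) by field; rewrite v0 gt_eqF.
rewrite -[leLHS]mulr1 ler_wpM2l// ler_pdivlMr ?exprn_gt0// mul1r.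
by rewrite lerXn2r ?nnegrE ?(ltW vp) ?(ltW r0).
Qed.

Lemma integrable_sumr (T : Type) (s : seq T) (f : T -> Omega -> R) :
  (forall t, P.-integrable setT (EFin \o f t)) ->
  P.-integrable setT (EFin \o (fun w => \sum_(t <- s) f t w)) /\
  Ex (fun w => \sum_(t <- s) f t w) = \sum_(t <- s) Ex (f t).
Proof.
move=> fi; elim: s => [|t s [IHi IHe]].
  rewrite (_ : (fun w => _) = fun=> 0); last by apply/funext => w; rewrite big_nil.
  by rewrite big_nil Ex_cst; split => //; exact: integrable_cst.
rewrite (_ : (fun w => _) = fun w => f t w + \sum_(t <- s) f t w); last first.
  by apply/funext => w; rewrite big_cons.
split; first exact: integrable_addr.
by rewrite big_cons RintegralD// IHe.
Qed.

Lemma covariance_matrix_sym p (X : Omega -> 'cV[R]_p) :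
  (covariance_matrix P X)^T = covariance_matrix P X.
Proof.
apply/matrixP => i j; rewrite !mxE; congr fine.
by rewrite !covariance.unlock; congr ('E_P[_])%E; apply/funext => w /=; rewrite mulrC.
Qed.

(** The second moment is the covariance form plus the squared mean, and [rayleigh] bounds the
    covariance form. *)
Lemma second_moment_ge p (X : Omega -> 'cV[R]_p) (v : 'cV[R]_p) (kappa : R) :
  random_vector X ->
  (forall j, P.-integrable setT (EFin \o (fun w => X w j 0))) ->
  (forall j l, P.-integrable setT (EFin \o (fun w => X w j 0 * X w l 0))) ->
  kappa <= lambda_min (covariance_matrix P X) ->
  kappa * \sum_j v j 0 ^+ 2 <= Ex (fun w => dotv v (X w) ^+ 2).
Proof.
move=> mX iX iXX hk.
have S0 : 0 <= \sum_j v j 0 ^+ 2 by apply: sumr_ge0 => j _; exact: sqr_ge0.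
apply: (le_trans (ler_wpM2r S0 hk)).
have := rayleigh (covariance_matrix_sym X) v^T.
rewrite trmxK; under eq_bigr do rewrite mxE.
move=> /le_trans; apply.
pose m j := Ex (fun w => X w j 0).
pose c := \sum_j v j 0 * m j.
have ic j l : P.-integrable setT
    (EFin \o (fun w => v j 0 * v l 0 * ((X w j 0 - m j) * (X w l 0 - m l)))).
  apply: integrable_mulr.
  rewrite (_ : (fun w => _) = fun w => X w j 0 * X w l 0 + (- m l) * X w j 0
     + (- m j) * X w l 0 + m j * m l); last by apply/funext => w; ring.
  apply: integrable_addr; last exact: integrable_cst.
  by do 2 (apply: integrable_addr; last exact: integrable_mulr).
have covE j l : covariance_matrix P X j l = Ex (fun w => (X w j 0 - m j) * (X w l 0 - m l)).
  by rewrite mxE covariance.unlock unlock.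
have iV : P.-integrable setT (EFin \o (fun w => dotv v (X w))).
  by apply: (integrable_sumr _ _).1 => j; exact: integrable_mulr.
have EV : Ex (fun w => dotv v (X w)) = c.
  rewrite (integrable_sumr _ _).2; last by move=> j; exact: integrable_mulr.
  by apply: eq_bigr => j _; rewrite RintegralZl.
have dotv_sqr w : dotv v (X w) ^+ 2 = \sum_j \sum_l v j 0 * v l 0 * (X w j 0 * X w l 0).
  rewrite expr2 /dotv big_distrlr /=; apply: eq_bigr => j _; apply: eq_bigr => l _; ring.
have iV2 : P.-integrable setT (EFin \o (fun w => dotv v (X w) ^+ 2)).
  under [X in _.-integrable _ (_ \o X)]eq_fun do rewrite dotv_sqr.
  apply: (integrable_sumr _ _).1 => j; apply: (integrable_sumr _ _).1 => l.
  exact: integrable_mulr.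
have -> : (v^T *m covariance_matrix P X *m v) 0 0 = Ex (fun w => (dotv v (X w) - c) ^+ 2).
  transitivity (Ex (fun w => \sum_j \sum_l
      v j 0 * v l 0 * ((X w j 0 - m j) * (X w l 0 - m l)))); last first.
    apply: eq_Rintegral => w _; rewrite /c /dotv -sumrB expr2 big_distrlr /=.
    by apply: eq_bigr => j _; apply: eq_bigr => l _; ring.
  rewrite (integrable_sumr _ _).2; last first.
    by move=> j; apply: (integrable_sumr _ _).1.
  transitivity (\sum_j \sum_l v j 0 * v l 0 * covariance_matrix P X j l).
    rewrite mxE exchange_big /=; apply: eq_bigr => l _.
    by rewrite mxE mulr_suml; apply: eq_bigr => j _; rewrite [v^T _ _]mxE; ring.
  apply: eq_bigr => j _; rewrite (integrable_sumr _ _).2//.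
  apply: eq_bigr => l _; rewrite covE RintegralZl//.
  rewrite (_ : (fun w => _) = fun w => X w j 0 * X w l 0 + (- m l) * X w j 0
     + (- m j) * X w l 0 + m j * m l); last by apply/funext => w; ring.
  apply: integrable_addr; last exact: integrable_cst.
  by do 2 (apply: integrable_addr; last exact: integrable_mulr).
have -> : Ex (fun w => (dotv v (X w) - c) ^+ 2) = Ex (fun w => dotv v (X w) ^+ 2) - c ^+ 2.
  transitivity (Ex (fun w => dotv v (X w) ^+ 2 + (- (2 * c)) * dotv v (X w) + c ^+ 2)).
    by apply: eq_Rintegral => w _; ring.
  rewrite !RintegralD//; last 3 first.
  - exact: integrable_mulr.
  - by apply: integrable_addr => //; exact: integrable_mulr.
  - exact: integrable_cst.
  by rewrite RintegralZl// EV Ex_cst; ring.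
by rewrite lerBlDr lerDl sqr_ge0.
Qed.

End Model.

(** * The loss: curvature, measurability and first-order condition *)

Section Loss.
Context (R : realType) (dY : measure_display) (calY : measurableType dY).
Variables (L : calY -> R -> R) (Lu : R).
Hypothesis smoothL : smooth_loss L Lu.
Hypothesis measL : forall mu, measurable_fun setT (fun y => L y mu).

Let G y := derive1 (L y).
Let H y := derive1 (G y).

Lemma loss_is_derive y (x : R) : is_derive x (1 : R) (L y) (G y x).
Proof.
case: smoothL => /(_ y x)[dL _] _ _.
exact: (DeriveDef dL (esym (derive1E _ _))).
Qed.

Lemma dloss_is_derive y (x : R) : is_derive x (1 : R) (G y) (H y x).
Proof.
case: smoothL => /(_ y x)[_ dG] _ _.
exact: (DeriveDef dG (esym (derive1E _ _))).
Qed.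

Lemma dloss_lipschitz y a b : `|G y a - G y b| <= Lu * `|a - b|.
Proof. by case: smoothL => _ _; apply. Qed.

Let curv mu := inf [set derive1n 2 (L y) mu | y in setT].

Let curv_gt0 mu : 0 < curv mu.
Proof. by case: smoothL => _ [+ _] _; apply. Qed.

Let curv_le y mu : curv mu <= H y mu.
Proof.
(* If the set had no infimum, [inf] would take its default value 0, against positivity. *)
have [[_ lb]|ni] := pselect (has_inf [set derive1n 2 (L y) mu | y in setT]).
  by apply: ge_inf => //; exists y.
by have := curv_gt0 mu; rewrite /curv inf_out// ltxx.
Qed.

Lemma d2loss_ge0 y mu : 0 <= H y mu.
Proof. exact: le_trans (ltW (curv_gt0 mu)) (curv_le y mu). Qed.

Lemma d2loss_lower (M : R) : 0 < M ->
  exists2 kappa, 0 < kappa & forall y mu, `|mu| <= M -> kappa <= H y mu.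
Proof.
move=> M0; have cc : continuous curv by case: smoothL => _ [].
have MM : - M <= M by lra.
have [c _ hc] := EVT_min MM (continuous_subspaceT cc).
exists (curv c) => // y mu muM; apply: le_trans (curv_le y mu); apply: hc.
by rewrite in_itv /= -ler_norml.
Qed.

Lemma dloss_nondecreasing y : {homo G y : a b / a <= b}.
Proof. exact: (deriv_nondecreasing (dloss_is_derive y) (d2loss_ge0 y)). Qed.

(** The derivative is the limit of measurable difference quotients, which lie between [G y mu] and
    [G y mu + Lu / (n + 1)]. *)
Lemma measurable_dloss_at (mu : R) : measurable_fun setT (fun y => G y mu).
Proof.
pose h n y : R := n.+1%:R * (L y (mu + n.+1%:R^-1) - L y mu).
have mh n : measurable_fun setT (h n).
  by apply: measurable_funM => //; apply: measurable_funB; exact: measL.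
apply: (measurable_fun_cvg mh) => y _.
have up n : h n y <= G y mu + Lu * n.+1%:R^-1.
  have n0 : 0 < n.+1%:R :> R by rewrite ltr0n.
  have := @tangent_upper _ _ _ (loss_is_derive y) Lu mu n.+1%:R^-1 (dloss_lipschitz y).
  rewrite -(ler_pM2l n0) => /le_trans; apply.
  by rewrite le_eqVlt; apply/orP; left; apply/eqP; field; rewrite gt_eqF.
have low n : G y mu <= h n y.
  have n0 : 0 < n.+1%:R :> R by rewrite ltr0n.
  have := @tangent_lower _ _ _ _ (loss_is_derive y) (dloss_is_derive y)
    0 (`|mu| + `|mu + n.+1%:R^-1|) mu n.+1%:R^-1.
  rewrite !mul0r addr0 => /(_ (fun x _ => d2loss_ge0 y x)).
  rewrite lerDl lerDr !normr_ge0 => /(_ isT isT).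
  by rewrite -(ler_pM2l n0) mulrCA divff ?gt_eqF// mulr1.
apply: (@squeeze_cvgr nat \oo _ R (fun=> G y mu) (fun n => G y mu + Lu * harmonic n)).
- by apply: nearW => n; rewrite low up.
- exact: cvg_cst.
- rewrite -[X in _ --> X]addr0; apply: cvgD; first exact: cvg_cst.
  by rewrite -[X in _ --> X](mulr0 Lu); apply: cvgMr; exact: cvg_harmonic.
Qed.

(** [G] is measurable in [y] for each fixed [mu]; as it is nondecreasing and continuous in [mu], the
    rational values of [mu] describe the superlevel sets of the composition. *)
Lemma measurable_dloss d (T : measurableType d) (Y : T -> calY) (u : T -> R) :
  measurable_fun setT Y -> measurable_fun setT u ->
  measurable_fun setT (fun z => G (Y z) (u z)).
Proof.
move=> mY mu; apply: (measurability _ (RGenOInfty.measurableE R)) => //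
  _ [_ [c ->] <-]; rewrite setTI.
have -> : (fun z => G (Y z) (u z)) @^-1` `]c, +oo[ =
    \bigcup_(q : rat) ([set z | c < G (Y z) (ratr q)] `&` [set z | ratr q < u z]).
  apply/seteqP; split => z /=; rewrite in_itv /= andbT; last first.
    move=> [q _ [/= cq qu]]; apply: (lt_le_trans cq).
    exact: dloss_nondecreasing (ltW qu).
  (* Any rational in (u z - e, u z) works, as G is Lipschitz in its second argument. *)
  move=> cG.
  pose e := (G (Y z) (u z) - c) / (Lu + 1).
  have Lu0 : 0 <= Lu.
    by have := le_trans (normr_ge0 _) (dloss_lipschitz (Y z) 1 0); rewrite subr0 normr1 mulr1.
  have e0 : 0 < e by rewrite divr_gt0 ?subr_gt0//; lra.
  have : u z - e < u z by lra.
  move=> /rat_in_itvoo[q]; rewrite in_itv /= => /andP[q1 q2].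
  exists q => //; split => //=.
  have := dloss_lipschitz (Y z) (u z) (ratr q).
  rewrite (ger0_norm (x := u z - _)); last by lra.
  move=> /(le_trans (ler_norm _)) h.
  have : Lu * (u z - ratr q) < (Lu + 1) * e.
    apply: (@le_lt_trans _ _ ((Lu + 1) * (u z - ratr q))).
      by rewrite ler_wpM2r; lra.
    by rewrite ltr_pM2l; lra.
  have -> : (Lu + 1) * e = G (Y z) (u z) - c by rewrite /e; field; lra.
  lra.
apply: bigcupT_measurable_rat => q; apply: measurableI.
  rewrite -preimage_itvoy -[X in measurable X]setTI.
  exact: (measurableT_comp (measurable_dloss_at _) mY).
rewrite -preimage_itvoy -[X in measurable X]setTI.
exact: mu.
Qed.

Context (d : measure_display) (Omega : measurableType d) (P : probability Omega R).
Notation Ex f := (\int[P]_w (f w))%R.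

(** The quadratic upper bound on the loss replaces differentiation under the expectation: it gives 0
    <= g + Lu b t for all t in (0, 1], with b the second moment of [v]. *)
Lemma first_order_condition (Y : Omega -> calY) (u v : Omega -> R) :
  (forall t, 0 <= t <= 1 -> finite_eloss L P Y (fun w => u w + t * v w)) ->
  (forall t, 0 <= t <= 1 -> (eloss L P Y u <= eloss L P Y (fun w => (u w + t * v w)%R))%E) ->
  P.-integrable setT (EFin \o (fun w => G (Y w) (u w) * v w)) ->
  P.-integrable setT (EFin \o (fun w => v w ^+ 2)) ->
  0 <= Ex (fun w => G (Y w) (u w) * v w).
Proof.
move=> fin umin iGv iv.
set g := Ex _; set b := Ex (fun w => v w ^+ 2).
have b0 : 0 <= b by apply: Rintegral_ge0 => w _; exact: sqr_ge0.
have Lu0 : 0 <= Lu.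
  by have := le_trans (normr_ge0 _) (dloss_lipschitz (Y point) 1 0); rewrite subr0 normr1 mulr1.
have iu : P.-integrable setT (EFin \o (fun w => L (Y w) (u w))).
  have := fin 0; rewrite lexx ler01 => /(_ isT).
  by rewrite /finite_eloss; under eq_fun do rewrite mul0r addr0.
have key t : 0 < t <= 1 -> 0 <= g + Lu * b * t.
  move=> /andP[t0 t1]; have t01 : 0 <= t <= 1 by rewrite ltW.
  have it : P.-integrable setT (EFin \o (fun w => L (Y w) (u w + t * v w))) by exact: fin.
  have := umin t t01; rewrite /eloss unlock -[leLHS]fineK; last exact: integrable_fin_num iu.
  rewrite -[leRHS]fineK; last exact: integrable_fin_num it.
  rewrite lee_fin => h1.
  have h2 : Ex (fun w => L (Y w) (u w + t * v w)) <=
      Ex (fun w => L (Y w) (u w) + t * (G (Y w) (u w) * v w) + Lu * t ^+ 2 * v w ^+ 2).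
    apply: le_Rintegral => //.
      by do 2 (apply: integrable_addr; last exact: integrable_mulr).
    move=> w _; have := @tangent_upper _ _ _ (loss_is_derive (Y w)) Lu (u w) (t * v w)
      (dloss_lipschitz (Y w)).
    rewrite exprMn; lra.
  have := le_trans h1 h2; rewrite -/(Rintegral P setT (fun w => L (Y w) (u w))).
  rewrite !RintegralD//; try exact: integrable_mulr; last first.
    by apply: integrable_addr => //; exact: integrable_mulr.
  rewrite !RintegralZl// -/g -/b => h.
  have : 0 <= t * (g + Lu * b * t) by rewrite expr2 in h; lra.
  by rewrite pmulr_rge0.
have [//|g0] := leP 0 g.
have c0 : 0 <= Lu * b by rewrite mulr_ge0.
have den : 0 < 2 * (Lu * b + 1) + - g by lra.
(* For g < 0 this value of t lies in (0, 1] and is so small that Lu b t < - g. *)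
have := key (- g / (2 * (Lu * b + 1) + - g)).
have -> : 0 < - g / (2 * (Lu * b + 1) - g) <= 1.
  by rewrite divr_gt0 ?oppr_gt0//= ler_pdivrMr// mul1r; lra.
move=> /(_ isT).
have -> : g + Lu * b * (- g / (2 * (Lu * b + 1) - g)) =
   g * (Lu * b + 2 - g) / (2 * (Lu * b + 1) - g) by field; rewrite gt_eqF.
rewrite ler_pdivlMr// mul0r nmulr_rge0//; lra.
Qed.

End Loss.

Lemma ler_of_sqr (R : realType) (x y : R) :
  0 <= x -> 0 <= y -> x ^+ 2 <= y ^+ 2 -> x <= y.
Proof. by move=> x0 y0; rewrite ler_sqr. Qed.

(** * Cone geometry and rates *)

Section Cone.
Variables (R : realType) (p K : nat) (bs : 'I_K -> 'cV[R]_p).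
Variables (w ws : 'cV[R]_K) (S : {set 'I_K}).
Hypotheses (ww : simplex w) (wws : simplex ws).
Let D := w - ws.

Lemma lnorm1_restr (T : {set 'I_K}) (v : 'cV[R]_K) :
  lnorm 1 (vrestr T v) = \sum_(k in T) `|v k 0|.
Proof.
rewrite lnorm1E [RHS]big_mkcond; apply: eq_bigr => k _.
by rewrite mxE; case: ifP; rewrite ?normr0.
Qed.

Lemma lnorm1_split (v : 'cV[R]_K) : lnorm 1 v = lnorm 1 (vrestr S v) + lnorm 1 (vrestr (~: S) v).
Proof.
rewrite !lnorm1_restr lnorm1E (bigID (mem S)) /=; congr (_ + _).
by apply: eq_bigl => k; rewrite inE.
Qed.

(** The entries of [D] sum to 0, so |D| <= w + ws off [S] gives ||D_{S^c}||_1 <= 2 ||ws_{S^c}||_1 -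
    sum_S D. *)
Lemma cone_simplex : cone S ws D.
Proof.
split; first by exists w.
rewrite !lnorm1_restr.
have nn (v : 'cV[R]_K) : simplex v -> forall k, `|v k 0| = v k 0 :> R.
  by move=> [v01 _] k; rewrite ger0_norm//; have /andP[] := v01 k.
have sumC (v : 'cV[R]_K) : \sum_k v k 0 = 1 ->
    \sum_(k in ~: S) v k 0 = 1 - \sum_(k in S) v k 0.
  rewrite (bigID (mem S)) /= => <-; rewrite [RHS]addrC addKr.
  by apply: eq_bigl => k; rewrite inE.
have h1 : \sum_(k in ~: S) `|D k 0| <= \sum_(k in ~: S) (w k 0 + ws k 0).
  apply: ler_sum => k _; rewrite !mxE (le_trans (ler_normB _ _))//.
  by rewrite (nn _ ww) (nn _ wws).
have h2 : - \sum_(k in S) D k 0 <= \sum_(k in S) `|D k 0|.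
  by rewrite -sumrN ler_sum// => k _; rewrite -normrN ler_norm.
have e1 : \sum_(k in ~: S) `|ws k 0| = \sum_(k in ~: S) ws k 0.
  by apply: eq_bigr => k _; exact: nn.
have e2 : \sum_(k in S) D k 0 = \sum_(k in S) w k 0 - \sum_(k in S) ws k 0.
  by rewrite -sumrB; apply: eq_bigr => k _; rewrite !mxE.
move: h1; rewrite big_split /= e1 (sumC _ ww.2) (sumC _ wws.2).
move: h2; rewrite e2.
move: (\sum_(k in ~: S) `|D k 0|) (\sum_(k in S) `|D k 0|) (\sum_(k in S) w k 0)
  (\sum_(k in S) ws k 0) => x1 x2 x3 x4; lra.
Qed.

Lemma lnorm1_cone_le : lnorm 1 D <=
  2 * lnorm 1 (vrestr S D) + 2 * lnorm 1 (vrestr (~: S) ws).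
Proof.
have [_] := cone_simplex; rewrite (lnorm1_split D).
move: (lnorm 1 (vrestr S D)) (lnorm 1 (vrestr (~: S) D)) (lnorm 1 (vrestr (~: S) ws)).
move=> s sc b; lra.
Qed.

Lemma phi2_ge0 : (0 <= phi2 bs S ws)%E.
Proof.
apply: le_ereal_inf_tmp => _ [v _ <-].
by rewrite lee_fin divr_ge0 ?sqr_ge0// mulr_ge0 ?sqr_ge0.
Qed.

(** With a = ||D||_1 and b = ||ws_{S^c}||_1, the bounds a <= 2 ||D_S||_1 + 2 b and 4 b < a give a <=
    4 ||D_S||_1, whose square is the factor 16. In particular D_S is nonzero, so [D] competes in the
    infimum, which is therefore finite. *)
Lemma phi2_simplex_le : 4 * lnorm 1 (vrestr (~: S) ws) < lnorm 1 D ->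
  exists2 r, phi2 bs S ws = r%:E &
    0 <= r /\ r * lnorm 1 D ^+ 2 <= 16 * #|S|%:R * lnorm 2 (mxcols bs *m D) ^+ 2.
Proof.
move=> ab; have h := lnorm1_cone_le.
have b0 := lnorm_ge0 1 (vrestr (~: S) ws).
have [aS S0] : lnorm 1 D <= 4 * lnorm 1 (vrestr S D) /\ 0 < lnorm 1 (vrestr S D).
  move: ab h b0.
  move: (lnorm 1 D) (lnorm 1 (vrestr S D)) (lnorm 1 (vrestr (~: S) ws)) => a s b.
  by move=> *; split; lra.
have nz : vrestr S D != 0.
  apply/eqP => e; move: S0; rewrite e lnorm1E big1 ?ltxx// => j _.
  by rewrite mxE normr0.
set q := #|S|%:R * lnorm 2 (mxcols bs *m D) ^+ 2.
have le1 : (phi2 bs S ws <= (q / lnorm 1 (vrestr S D) ^+ 2)%:E)%E.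
  rewrite /phi2; apply: ereal_inf_lbound; exists D; last by rewrite /q.
  by split; [exact: cone_simplex|exact: nz].
have := phi2_ge0; case E : (phi2 bs S ws) le1 => [r| |] //=; rewrite !lee_fin => le1 r0.
exists r => //; split => //.
have q0 : 0 <= q by rewrite mulr_ge0 ?sqr_ge0.
move: le1; rewrite ler_pdivlMr ?exprn_gt0// => le1.
have a2 : lnorm 1 D ^+ 2 <= 16 * lnorm 1 (vrestr S D) ^+ 2.
  rewrite (_ : 16 * _ = (4 * lnorm 1 (vrestr S D)) ^+ 2); last by ring.
  by rewrite lerXn2r ?nnegrE ?lnorm_ge0 ?mulr_ge0 ?(ltW S0).
rewrite -mulrA -/q; apply: (le_trans (ler_wpM2l r0 a2)).
by rewrite mulrCA ler_wpM2l.
Qed.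

End Cone.

(** Split both factors into powers q/2 and 1 - q/2: x^{q/2} y^{1-q/2} is at most 1 + Kb, and the
    rest is the rate. Used with [x] equal to rho, [y] the largest l2 norm and [h] the largest lq
    norm. *)
Lemma mul_le_powR (R : realType) (x y h q Kb : R) : 0 < q <= 1 ->
  0 < x -> x <= 1 -> 0 < y -> y <= Kb -> y <= h ->
  x * y <= (1 + Kb) * (h `^ (q / 2) * x `^ (1 - q / 2)).
Proof.
move=> /andP[q0 q1] x0 x1 y0 yK yh.
have e z : 0 < z -> z = z `^ (q / 2) * z `^ (1 - q / 2).
  move=> z0; rewrite -powRD; last by apply/implyP => _; rewrite gt_eqF.
  by rewrite addrC subrK powRr1// ltW.
have h1 : x `^ (q / 2) <= 1.
  rewrite -[leRHS](_ : 1 `^ (q / 2) = 1); last by rewrite powR1.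
  by rewrite ge0_ler_powR ?nnegrE ?(ltW x0)//; lra.
have h2 : y `^ (1 - q / 2) <= 1 + Kb.
  apply: (@le_trans _ _ ((1 + Kb) `^ (1 - q / 2))).
    by rewrite ge0_ler_powR ?nnegrE ?(ltW y0)//; lra.
  by apply: ler1_powR; lra.
have h3 : y `^ (q / 2) <= h `^ (q / 2).
  by rewrite ge0_ler_powR ?nnegrE ?(ltW y0)//; lra.
have -> : x * y = (x `^ (q / 2) * y `^ (1 - q / 2)) * (y `^ (q / 2) * x `^ (1 - q / 2)).
  by rewrite {1}(e _ x0) {1}(e _ y0); ring.
apply: ler_pM; [by rewrite mulr_ge0 ?powR_ge0|by rewrite mulr_ge0 ?powR_ge0| |].
  by rewrite -[leRHS]mul1r; apply: ler_pM; rewrite ?powR_ge0.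
by rewrite ler_wpM2r ?powR_ge0.
Qed.

(** Cancelling y^{2/(2-q)} leaves the power 2 - 2/(2-q) of [y], an exponent in [0, 1]; it is bounded
    through 1 + Kb because a base at least 1 makes powers increase with the exponent. This is how
    the first term of [ratePsi] bounds rho. *)
Lemma le_of_powR_mul (R : realType) (x y h q Kb c : R) : 0 < q <= 1 ->
  0 < y -> y <= Kb -> y <= h -> 0 <= x -> 0 < c ->
  h `^ (2 / (2 - q)) * x <= c * y ^+ 2 -> x <= c * (1 + Kb) ^+ 2.
Proof.
move=> /andP[q0 q1] y0 yK yh x0 c0 H.
have q2 : 0 < 2 - q by lra.
have a0 : 0 <= 2 / (2 - q) by rewrite divr_ge0// ltW.
have a2 : 2 / (2 - q) <= 2 by rewrite ler_pdivrMr//; lra.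
have {}H : y `^ (2 / (2 - q)) * x <= c * y ^+ 2.
  apply: le_trans H; rewrite ler_wpM2r// ge0_ler_powR ?nnegrE ?(ltW y0)//.
  exact: le_trans (ltW y0) yh.
have hsq : y ^+ 2 = y `^ (2 / (2 - q)) * y `^ (2 - 2 / (2 - q)).
  rewrite -powRD; last by apply/implyP => _; rewrite gt_eqF.
  by rewrite addrC subrK powR_mulrn// ltW.
move: H; rewrite hsq mulrCA ler_pM2l ?powR_gt0// => /le_trans; apply.
rewrite ler_wpM2l ?(ltW c0)//.
apply: (@le_trans _ _ ((1 + Kb) `^ (2 - 2 / (2 - q)))).
  by rewrite ge0_ler_powR ?nnegrE ?(ltW y0)//; lra.
rewrite -powR_mulrn; last lra.
by apply: ler_powR; lra.
Qed.

Section Rates.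
Variables (R : realType) (p K n : nat) (A : 'I_K -> {set 'I_p}).
Variables (bs : 'I_K -> 'cV[R]_p) (q C0 Kb : R).
Hypotheses (q01 : 0 <= q <= 1) (n0 : (0 < n)%N) (pK : (0 < p * K)%N) (C00 : 0 < C0).
Hypothesis bsK : forall k, lnorm 2 (bs k) <= Kb.

Let rho : R := Num.sqrt (ln (p * K)%:R / n%:R).
Let T := rateT bs n q.
Let h2 := h_u bs 2.

Lemma lnorm2_le_h_u k : lnorm 2 (bs k) <= h2.
Proof. by rewrite /h2 /h_u; apply: le_bigmax. Qed.

Lemma h_u_ge0 a : 0 <= h_u bs a.
Proof. exact: bigmax_ge_id. Qed.

Lemma h_u2_le : 0 <= Kb -> h2 <= Kb.
Proof. by move=> Kb0; apply/bigmax_leP. Qed.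

Let arg_ge0 : 0 <= ln (p * K)%:R / n%:R :> R.
Proof. by rewrite divr_ge0// ln_ge0// ler1n. Qed.

Lemma rho_ge0 : 0 <= rho. Proof. exact: sqrtr_ge0. Qed.

Lemma rho_sqr : n%:R * rho ^+ 2 = ln (p * K)%:R.
Proof. by rewrite sqr_sqrtr// mulrC divfK// pnatr_eq0 -lt0n. Qed.

Let powrho a : rho `^ a = (ln (p * K)%:R / n%:R) `^ (a / 2).
Proof. by rewrite /rho -powR12_sqrt// -powRrM (mulrC a). Qed.

(** 3 is 2 from delta plus 1 from log p_u <= log(pK). *)
Lemma base_rate_le : base_rate A n (2 * rho) <= 3 * rho.
Proof.
rewrite /base_rate (_ : 3 * rho = 2 * rho + rho); last by ring.
rewrite lerD2l ler_wsqrtr// ler_wpM2r ?invr_ge0//.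
have [->|pu0] := posnP (p_u A); first by rewrite ln0// ln_ge0// ler1n.
rewrite ler_ln ?posrE ?ltr0n// ler_nat.
apply: (@leq_trans p); last by rewrite leq_pmulr//; move: pK; rewrite muln_gt0 => /andP[].
by apply/bigmax_leqP => k _; rewrite -[X in (_ <= X)%N](card_ord p) max_card.
Qed.

Let base_rate_ge0 : 0 <= base_rate A n (2 * rho).
Proof. by rewrite addr_ge0 ?sqrtr_ge0// mulr_ge0 ?rho_ge0. Qed.

Lemma rateT_ge0 : 0 <= T.
Proof.
rewrite /T /rateT; case: ifP => _; first by rewrite mulr_ge0 ?sqrtr_ge0.
by rewrite mulr_ge0 ?powR_ge0.
Qed.

Lemma rateT_pos : q != 0 -> T = h_u bs q `^ (q / 2) * rho `^ (1 - q / 2).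
Proof.
move=> qn0; rewrite /T /rateT (negPf qn0) powrho.
by have -> : (1 - q / 2) / 2 = 1 / 2 - q / 4 by field.
Qed.

Let base_pow_le a : 0 <= a <= 1 -> base_rate A n (2 * rho) `^ a <= 3 * rho `^ a.
Proof.
move=> /andP[a0 a1].
apply: (@le_trans _ _ ((3 * rho) `^ a)).
  by rewrite ge0_ler_powR ?nnegrE ?base_rate_le ?mulr_ge0 ?rho_ge0.
rewrite powRM ?rho_ge0// ler_wpM2r ?powR_ge0//.
by apply: ler1_powR => //; lra.
Qed.

Lemma rateT2_le : rateT2 A bs n q C0 (2 * rho) <= 3 * C0 * T.
Proof.
have /andP[q0 q1] := q01.
rewrite /rateT2; have [qe|qn0] := eqVneq q 0.
  rewrite /T /rateT qe eqxx -/rho -!mulrA (mulrCA 3) ler_wpM2l ?(ltW C00)//.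
  rewrite (mulrCA 3) ler_wpM2l ?sqrtr_ge0//; exact: base_rate_le.
rewrite rateT_pos// -!mulrA (mulrCA 3) ler_wpM2l ?(ltW C00)//.
rewrite (mulrCA 3) ler_wpM2l ?powR_ge0//; apply: base_pow_le; lra.
Qed.

(** The l1 rate enters only as T1^2 / N with 1 / N of order rho^2; by this bound the contribution is
    of order T^4. *)
Lemma rho_rateT1_le : rho * rateT1 A bs n q C0 (2 * rho) <= 3 * C0 * T ^+ 2.
Proof.
have /andP[q0 q1] := q01.
rewrite /rateT1; have [qe|qn0] := eqVneq q 0.
  rewrite /T /rateT qe eqxx -/rho exprMn sqr_sqrtr//.
  rewrite (_ : 3 * C0 * (_ * rho ^+ 2) = rho * (C0 * (s_u bs)%:R * (3 * rho))); last by ring.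
  by rewrite ler_wpM2l ?rho_ge0// ler_wpM2l ?base_rate_le// mulr_ge0// ltW.
rewrite rateT_pos// exprMn -!powR_mulrn ?powR_ge0// -!powRrM.
have -> : q / 2 * 2%:R = q by field.
have -> : rho `^ ((1 - q / 2) * 2%:R) = rho * rho `^ (1 - q).
  transitivity (rho `^ 1 * rho `^ (1 - q)); last by rewrite powRr1 ?rho_ge0.
  rewrite -powRD; last by apply/implyP => /eqP; lra.
  by have -> : (1 - q / 2) * 2%:R = 1 + (1 - q) by field.
rewrite (_ : 3 * C0 * _ = rho * (C0 * h_u bs q `^ q * (3 * rho `^ (1 - q)))); last by ring.
rewrite ler_wpM2l ?rho_ge0// ler_wpM2l//; last by apply: base_pow_le; lra.
by rewrite mulr_ge0 ?powR_ge0// ltW.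
Qed.

(** Each |v_j| is at most N = ||v||_q, so |v_j|^2 <= |v_j|^q N^{2-q}, and the |v_j|^q sum to N^q. *)
Lemma lnorm2_le_lnorm m (v : 'cV[R]_m) : 0 < q -> lnorm 2 v <= lnorm q v.
Proof.
move=> q0; have /andP[_ q1] := q01.
set N := lnorm q v; have N0 : 0 <= N by exact: lnorm_ge0.
pose s := \sum_j `|v j 0| `^ q.
have s0 : 0 <= s by apply: sumr_ge0 => j _; exact: powR_ge0.
have Nq : N `^ q = s by rewrite /N /lnorm -/s -powRrM mulVf ?gt_eqF// powRr1.
have vN j : `|v j 0| <= N.
  rewrite -(powRr1 (normr_ge0 (v j 0))) -(mulfV (lt0r_neq0 q0)) powRrM.
  rewrite /N /lnorm -/s ge0_ler_powR ?nnegrE ?powR_ge0 ?invr_ge0 ?(ltW q0)//.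
  by rewrite /s (bigD1 j)//= lerDl sumr_ge0// => l _; exact: powR_ge0.
clearbody N; have n20 : 0 <= lnorm 2 v by exact: lnorm_ge0.
apply: (ler_of_sqr n20 N0).
rewrite lnorm2_sqr.
have split_sq x : 0 <= x -> x ^+ 2 = x `^ q * x `^ (2 - q).
  move=> x0; rewrite -powRD; last by apply/implyP => /eqP; lra.
  by rewrite addrC subrK powR_mulrn.
rewrite (split_sq N)// Nq mulr_suml; apply: ler_sum => j _.
rewrite -(real_normK (num_real _)) split_sq// ler_wpM2l ?powR_ge0//.
by rewrite ge0_ler_powR ?nnegrE//; lra.
Qed.

Lemma h_u2_le_h_u : 0 < q -> h2 <= h_u bs q.
Proof.
move=> q0; apply/bigmax_leP; split; first exact: h_u_ge0.
move=> k _; apply: (le_trans (lnorm2_le_lnorm (bs k) q0)).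
by rewrite /h_u; apply: le_bigmax.
Qed.

Lemma s_u_ge1 : 0 < h2 -> (0 < s_u bs)%N.
Proof.
move=> h20; rewrite lt0n; apply/negP => /eqP s0.
suff : h2 <= 0 by rewrite leNgt h20.
apply/bigmax_leP; split => // k _.
have : (l0norm (bs k) <= s_u bs)%N by rewrite /s_u; apply: leq_bigmax.
rewrite s0 leqn0 cards_eq0 => /eqP/setP e.
suff -> : bs k = 0.
  by rewrite -[leRHS](expr0n R 2) /lnorm big1 ?powR0 ?invr_eq0// => j _; rewrite mxE normr0 powR0.
apply/colP => j; have := e j; rewrite !inE mxE => /negbT; rewrite negbK => /eqP //.
Qed.

(** Score fluctuations and Maurey's error come in units of rho times the largest l2 norm; this
    converts them into the rate. For q = 0 it uses that some sparsity is at least 1 unless all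
    candidates vanish. *)
Lemma rho_h_u2_le : rho <= 1 -> 0 <= Kb -> rho * h2 <= (1 + Kb) * T.
Proof.
move=> r1 Kb0; have /andP[q0 q1] := q01; have h2K := h_u2_le Kb0.
have := h_u_ge0 2; rewrite -/h2 le_eqVlt => /predU1P[<-|h20].
  by rewrite mulr0 mulr_ge0 ?rateT_ge0// addr_ge0.
have r0 := rho_ge0.
have [qe|qn0] := eqVneq q 0.
  have s1 : 1 <= Num.sqrt (s_u bs)%:R :> R.
    by rewrite -[leLHS]sqrtr1 ler_wsqrtr// ler1n s_u_ge1.
  have -> : T = Num.sqrt (s_u bs)%:R * rho by rewrite /T /rateT qe eqxx.
  rewrite mulrC; apply: ler_pM => //; first exact: ltW.
    lra.
  by rewrite -[leLHS]mul1r ler_wpM2r.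
have qp : 0 < q by rewrite lt_neqAle eq_sym qn0.
move: r0; rewrite le_eqVlt => /predU1P[<-|r0].
  by rewrite mul0r mulr_ge0 ?rateT_ge0// addr_ge0.
have qq : 0 < q <= 1 by rewrite qp q1.
rewrite (rateT_pos qn0); exact: (mul_le_powR qq r0 r1 h20 h2K (h_u2_le_h_u qp)).
Qed.

Lemma ratePsi_ge0 : 0 <= ratePsi bs n q.
Proof.
rewrite /ratePsi; case: ifP => _; first exact: rateT_ge0.
by rewrite le_max rateT_ge0 orbT.
Qed.

(** The hypothesis on [ratePsi] will come from the restriction on |S|. *)
Lemma rho_le_of_ratePsi c : 0 <= Kb -> 0 < h2 -> 0 < c ->
  ratePsi bs n q <= c * h2 ^+ 2 -> rho <= c * (1 + Kb) ^+ 2.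
Proof.
move=> Kb0 h20 c0; have /andP[q0 q1] := q01; have h2K := h_u2_le Kb0; have r0 := rho_ge0.
rewrite /ratePsi; have [qe|qn0] := eqVneq q 0.
  have s1 : 1 <= Num.sqrt (s_u bs)%:R :> R.
    by rewrite -[leLHS]sqrtr1 ler_wsqrtr// ler1n s_u_ge1.
  rewrite /rateT qe eqxx -/rho => hT.
  apply: (@le_trans _ _ (Num.sqrt (s_u bs)%:R * rho)).
    by rewrite -[leLHS]mul1r ler_wpM2r.
  apply: (le_trans hT); rewrite ler_wpM2l ?(ltW c0)//.
  by rewrite lerXn2r ?nnegrE ?(ltW h20)//; lra.
have qp : 0 < q by rewrite lt_neqAle eq_sym qn0.
rewrite -/rho ge_max => /andP[h _].
have qq : 0 < q <= 1 by rewrite qp q1.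
exact: (le_of_powR_mul qq h20 h2K (h_u2_le_h_u qp) r0 c0 h).
Qed.

End Rates.

(** * Uniform bounds for quadratic forms *)

Section Grid.
Variables (R : realType) (p m N : nat) (a : 'I_m -> 'cV[R]_p) (Hd : R).
Hypotheses (N0 : (0 < N)%N) (aH : forall k, lnorm 2 (a k) <= Hd).

(** The finite set of Maurey's averages: a combination with l1 norm r is a mean of r times such
    points. *)
Definition grid_point (s : {ffun 'I_N -> 'I_m * bool}) : 'cV[R]_p :=
  \sum_j (N%:R^-1 * (-1) ^+ (s j).2) *: a (s j).1.

Lemma dotv_grid_point s (x : 'cV[R]_p) :
  dotv (grid_point s) x = signed_avg (fun k => dotv (a k) x) s.
Proof.
rewrite /grid_point dotv_suml /signed_avg mulr_sumr.
by apply: eq_bigr => j _; rewrite dotvZl mulrA.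
Qed.

Lemma grid_point_coord s j : grid_point s j 0 = signed_avg (fun k => a k j 0) s.
Proof.
rewrite /grid_point summxE /signed_avg mulr_sumr.
by apply: eq_bigr => l _; rewrite mxE mulrA.
Qed.

Lemma lnorm2_grid_point s : 0 <= Hd -> lnorm 2 (grid_point s) <= Hd.
Proof.
move=> Hd0; apply: (le_trans (lnorm2_comb_le _ Hd0 (fun j => aH (s j).1))).
rewrite -[leRHS]mul1r ler_wpM2r// (eq_bigr (fun=> N%:R^-1)); last first.
  by move=> j _; rewrite normrM normr_sign mulr1 ger0_norm ?invr_ge0.
by rewrite sumr_const card_ord -[leLHS]mulr_natl mulfV// pnatr_eq0 -lt0n.
Qed.

Variables (n : nat) (x : 'I_n -> 'cV[R]_p) (th : 'I_m -> R).
Let r := \sum_k `|th k|.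
Let comb := \sum_k th k *: a k.

Let comb_coord j : comb j 0 = \sum_k th k * a k j 0.
Proof. by rewrite summxE; apply: eq_bigr => k _; rewrite mxE. Qed.

Let dotv_comb i : dotv comb (x i) = \sum_k th k * dotv (a k) (x i).
Proof. by rewrite dotv_suml; apply: eq_bigr => k _; rewrite dotvZl. Qed.

Let comb0 : r <= 0 -> comb = 0.
Proof.
move=> r0; rewrite /comb big1// => k _.
suff -> : th k = 0 by rewrite scale0r.
apply/eqP; rewrite -normr_le0; apply: le_trans r0.
by rewrite /r (bigD1 k)//= lerDl sumr_ge0.
Qed.

(** Jensen's inequality acts on the predictions, the variance bound on the coordinates: the mean
    squared length of r times the averages exceeds the squared length of [comb] by at most r^2 Hd^2
    / N. *)
Lemma grid_upper (B : R) :
  (forall s, avg (fun i => dotv (grid_point s) (x i) ^+ 2)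
     <= B ^+ 2 * lnorm 2 (grid_point s) ^+ 2) ->
  avg (fun i => dotv comb (x i) ^+ 2)
    <= B ^+ 2 * (lnorm 2 comb ^+ 2 + r ^+ 2 * Hd ^+ 2 / N%:R).
Proof.
move=> hB; have [r0|r0] := leP r 0.
  rewrite comb0//; under [avg _]eq_avg do rewrite dotv0l expr0n.
  rewrite /avg big1 ?mulr0// mulr_ge0 ?sqr_ge0// addr_ge0 ?sqr_ge0//.
  by rewrite divr_ge0// mulr_ge0 ?sqr_ge0.
have [pi [pi0 pi1 piP]] := maurey_signed N0 r0.
have abspi : \sum_s `|pi s| = 1.
  by rewrite -pi1; apply: eq_bigr => s _; rewrite ger0_norm.
apply: (@le_trans _ _ (\sum_s pi s * (r ^+ 2 * (B ^+ 2 * lnorm 2 (grid_point s) ^+ 2)))).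
  apply: (@le_trans _ _ (avg (fun i => \sum_s pi s * (r ^+ 2 * dotv (grid_point s) (x i) ^+ 2)))).
    apply: ler_avg => i; rewrite dotv_comb.
    have [<- _] := piP (fun k => dotv (a k) (x i)).
    apply: (le_trans (sqr_comb_le _ _)); rewrite abspi mul1r; apply: ler_sum => s _.
    by rewrite (ger0_norm (pi0 s)) exprMn -dotv_grid_point.
  rewrite avg_sum; apply: ler_sum => s _; rewrite !avgZ.
  by rewrite ler_wpM2l// ler_wpM2l ?sqr_ge0.
rewrite (eq_bigr (fun s => B ^+ 2 * (\sum_j pi s * (r * signed_avg (fun k => a k j 0) s) ^+ 2)));
  last first.
  move=> s _; rewrite -mulr_sumr lnorm2_sqr.
  have -> : \sum_j (r * signed_avg (fun k => a k j 0) s) ^+ 2 =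
      r ^+ 2 * \sum_j grid_point s j 0 ^+ 2.
    by rewrite mulr_sumr; apply: eq_bigr => j _; rewrite exprMn grid_point_coord.
  by ring.
rewrite -mulr_sumr ler_wpM2l ?sqr_ge0// exchange_big /=.
apply: (@le_trans _ _ (\sum_j (comb j 0 ^+ 2 + r * (N%:R^-1 * \sum_k `|th k| * a k j 0 ^+ 2)))).
  apply: ler_sum => j _; have [e1 e2] := piP (fun k => a k j 0).
  rewrite -lerBlDl; apply: le_trans e2; rewrite comb_coord.
  set c := \sum_k th k * a k j 0 in e1 *; clearbody c.
  rewrite le_eqVlt; apply/orP; left; apply/eqP.
  transitivity (\sum_s pi s * (r * signed_avg (fun k => a k j 0) s) ^+ 2
    - 2 * c * (\sum_s pi s * (r * signed_avg (fun k => a k j 0) s)) + c ^+ 2 * \sum_s pi s).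
    by rewrite e1 pi1; ring.
  rewrite !mulr_sumr -sumrB -big_split /=; apply: eq_bigr => s _.
  by rewrite -/r; ring.
rewrite big_split /= -lnorm2_sqr lerD2l -!mulr_sumr.
rewrite (_ : r ^+ 2 * Hd ^+ 2 / N%:R = r * (N%:R^-1 * (r * Hd ^+ 2))); last by ring.
rewrite ler_wpM2l ?(ltW r0)// ler_wpM2l ?invr_ge0// exchange_big /= mulr_suml.
apply: ler_sum => k _; rewrite -mulr_sumr ler_wpM2l// -lnorm2_sqr.
by rewrite lerXn2r ?nnegrE ?lnorm_ge0// (le_trans _ (aH k))// lnorm_ge0.
Qed.

(** The roles are exchanged: Jensen's inequality acts on the lengths, the variance bound on the
    predictions. A truncated square is not convex; [truncated_sqr_ge] instead compares each average
    with the combination, at the price of a factor 1/2 and of their squared distance, which the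
    variance bound controls. By [r <= 2] the level M / 4 for an average becomes M / 2 after
    scaling. *)
Lemma grid_lower (M B c : R) (chi : 'I_n -> R) : r <= 2 -> 0 < M -> 0 <= c ->
  (forall i, 0 <= chi i <= 1) ->
  (forall k, avg (fun i => dotv (a k) (x i) ^+ 2) <= B ^+ 2) ->
  (forall s, c * lnorm 2 (grid_point s) ^+ 2 <=
     avg (fun i => dotv (grid_point s) (x i) ^+ 2
        * (`|dotv (grid_point s) (x i)| <= M / 4)%R%:R * chi i)) ->
  c / 2 * lnorm 2 comb ^+ 2 - r ^+ 2 * B ^+ 2 / N%:R <=
    avg (fun i => dotv comb (x i) ^+ 2 * (`|dotv comb (x i)| <= M)%R%:R * chi i).
Proof.
move=> r2 M0 c0 chi01 hB hc; have [r0|r0] := leP r 0.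
  have -> : r = 0 by apply/eqP; rewrite eq_le r0 sumr_ge0.
  rewrite comb0//; have -> : lnorm 2 (0 : 'cV[R]_p) ^+ 2 = 0.
    by rewrite lnorm2_sqr big1// => j _; rewrite mxE expr0n.
  rewrite mulr0 expr0n /= !mul0r subr0; apply: avg_ge0 => i.
  by rewrite dotv0l expr0n /= !mul0r.
have [pi [pi0 pi1 piP]] := maurey_signed N0 r0.
have abspi : \sum_s `|pi s| = 1.
  by rewrite -pi1; apply: eq_bigr => s _; rewrite ger0_norm.
pose V s i := dotv (grid_point s) (x i).
pose tr s i := V s i ^+ 2 * (`|V s i| <= M / 4)%R%:R * chi i.
pose v i := dotv comb (x i).
have jens : lnorm 2 comb ^+ 2 <= \sum_s pi s * (r ^+ 2 * lnorm 2 (grid_point s) ^+ 2).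
  have sqr_le (z : 'cV[R]_p) : lnorm 2 z ^+ 2 <= \sum_j z j 0 ^+ 2 by rewrite lnorm2_sqr.
  have sqr_ge (z : 'cV[R]_p) : \sum_j z j 0 ^+ 2 <= lnorm 2 z ^+ 2 by rewrite lnorm2_sqr.
  apply: (le_trans (sqr_le comb)).
  apply: (@le_trans _ _ (\sum_s \sum_j pi s * (r ^+ 2 * grid_point s j 0 ^+ 2))); last first.
    apply: ler_sum => s _; rewrite -2!mulr_sumr; apply: ler_wpM2l; first exact: pi0.
    apply: ler_wpM2l; first exact: sqr_ge0.
    exact: sqr_ge.
  rewrite exchange_big /=; apply: ler_sum => j _; rewrite comb_coord.
  have [<- _] := piP (fun k => a k j 0).
  apply: (le_trans (sqr_comb_le _ _)); rewrite abspi mul1r; apply: ler_sum => s _.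
  by rewrite (ger0_norm (pi0 s)) exprMn -grid_point_coord.
apply: (@le_trans _ _ (avg (fun i => (\sum_s pi s * (1 / 2 * (r ^+ 2 * tr s i)))
   + (-1) * \sum_s pi s * (r * V s i - v i) ^+ 2))).
  rewrite avgD avgZ !avg_sum mulN1r; apply: lerB.
    rewrite -mulrA mulrC -mulrA; apply: (@le_trans _ _ (\sum_s pi s * (1 / 2 * (r ^+ 2 * (c * lnorm 2 (grid_point s) ^+ 2))))).
      apply: (@le_trans _ _ (c / 2 * \sum_s pi s * (r ^+ 2 * lnorm 2 (grid_point s) ^+ 2))).
        by rewrite (_ : 2^-1 * _ = c / 2 * lnorm 2 comb ^+ 2); [rewrite ler_wpM2l// divr_ge0|ring].
      rewrite mulr_sumr; apply: ler_sum => s _.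
      by rewrite le_eqVlt; apply/orP; left; apply/eqP; field.
    apply: ler_sum => s _; rewrite !avgZ ler_wpM2l// ler_wpM2l ?divr_ge0//.
    by rewrite ler_wpM2l ?sqr_ge0//; exact: hc.
  rewrite -avg_sum.
  apply: (@le_trans _ _ (avg (fun i => r * (N%:R^-1 * \sum_k `|th k| * dotv (a k) (x i) ^+ 2)))).
    apply: ler_avg => i; have [_ +] := piP (fun k => dotv (a k) (x i)).
    by rewrite /v dotv_comb; under eq_bigr do rewrite -dotv_grid_point.
  rewrite !avgZ avg_sum.
  rewrite (_ : r ^+ 2 * B ^+ 2 / N%:R = r * (N%:R^-1 * (r * B ^+ 2))); last by ring.
  rewrite ler_wpM2l ?(ltW r0)// ler_wpM2l ?invr_ge0// mulr_suml.
  by apply: ler_sum => k _; rewrite avgZ ler_wpM2l.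
apply: ler_avg => i; rewrite mulN1r -sumrB.
have -> : v i ^+ 2 * (`|v i| <= M)%R%:R * chi i =
    \sum_s pi s * (v i ^+ 2 * (`|v i| <= M)%R%:R * chi i) by rewrite -mulr_suml pi1 mul1r.
apply: ler_sum => s _; rewrite -mulrBr ler_wpM2l//.
have /andP[chi0 chi1] := chi01 i.
have h := @truncated_sqr_ge R M M0 (v i) (r * V s i).
have tV : r ^+ 2 * tr s i <= (r * V s i) ^+ 2 * (`|r * V s i| <= M / 2)%R%:R * chi i.
  rewrite /tr -[V s i ^+ 2 * _ * _]mulrA.
  rewrite (_ : (r * V s i) ^+ 2 * _ * _ = r ^+ 2 * (V s i ^+ 2 * ((`|r * V s i| <= M / 2)%R%:R * chi i)));
    last by rewrite exprMn !mulrA.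
  apply: ler_wpM2l; first exact: sqr_ge0.
  apply: ler_wpM2l; first exact: sqr_ge0.
  apply: ler_wpM2r => //.
  rewrite ler_nat; case: (leP `|V s i| (M / 4)) => // VM.
  suff -> : `|r * V s i| <= M / 2 by [].
  rewrite normrM (gtr0_norm r0); apply: (@le_trans _ _ (2 * (M / 4))); last lra.
  by apply: ler_pM => //; exact: ltW.
have sq : 0 <= (v i - r * V s i) ^+ 2 by exact: sqr_ge0.
have h2 : (1 / 2 * (r * V s i) ^+ 2 * (`|r * V s i| <= M / 2)%R%:R - (v i - r * V s i) ^+ 2) * chi i
   <= v i ^+ 2 * (`|v i| <= M)%R%:R * chi i.
  by rewrite ler_wpM2r//; apply: h.
apply: le_trans h2; rewrite mulrBl; apply: lerB.
  rewrite (_ : 1 / 2 * (r * V s i) ^+ 2 * _ * _ =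
    1 / 2 * ((r * V s i) ^+ 2 * (`|r * V s i| <= M / 2)%R%:R * chi i)); last by rewrite !mulrA.
  by apply: ler_wpM2l; [rewrite divr_ge0|exact: tV].
have -> : (r * V s i - v i) ^+ 2 = (v i - r * V s i) ^+ 2 by ring.
by rewrite -[leRHS]mulr1; apply: ler_wpM2l.
Qed.

End Grid.

(** * Probabilities of the exceptional events *)

Section Events.
Context (R : realType) (d dT : measure_display) (Omega : measurableType d).
Context (T : measurableType dT) (P : probability Omega R).
Variables (n p : nat) (Z : 'I_n -> Omega -> T) (i1 : 'I_n) (xv : T -> 'cV[R]_p).
Variables (Kx : R).
Hypothesis iidZ : iid P Z.
Hypothesis mxv : random_vector xv.
Hypothesis Kx0 : 0 < Kx.
Hypothesis psiX : psi2_vnorm P (xv \o Z i1) = Kx%:E.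

Notation Ex f := (\int[P]_w (f w))%R.

Let mZ i : measurable_fun setT (Z i).
Proof. by case: iidZ => + _ _; apply. Qed.

Let mxZ : random_vector (xv \o Z i1).
Proof. by move=> j; apply: (measurableT_comp (mxv j)); exact: mZ. Qed.

Lemma subgaussian_dotv v r : 0 < r -> lnorm 2 v <= r ->
  subgaussian P ((fun z => dotv v (xv z)) \o Z i1) (2 * Kx * r).
Proof. exact: (psi2_vnorm_subgaussian mxZ psiX Kx0). Qed.

Lemma measurable_avg_lt (f : T -> R) (c : R) : measurable_fun setT f ->
  measurable [set w | avg (fun i => f (Z i w)) < c].
Proof.
move=> mf; rewrite (_ : [set w | _] = ~` [set w | c <= avg (fun i => f (Z i w))]).
  apply: measurableC; rewrite -[X in measurable X]setTI.
  by apply: measurable_fun_le => //; exact: (measurable_avg iidZ mf).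
apply/seteqP; split => w /=; first by rewrite ltNge => /negP.
by move/negP; rewrite -ltNge.
Qed.

Lemma measurable_avg_gt (f : T -> R) (c : R) : measurable_fun setT f ->
  measurable [set w | c < avg (fun i => f (Z i w))].
Proof.
move=> mf; rewrite (_ : [set w | _] = ~` [set w | avg (fun i => f (Z i w)) <= c]).
  apply: measurableC; rewrite -[X in measurable X]setTI.
  by apply: measurable_fun_le => //; exact: (measurable_avg iidZ mf).
apply/seteqP; split => w /=; first by rewrite ltNge => /negP.
by move/negP; rewrite -ltNge.
Qed.

Lemma measurable_avg_ge (f : T -> R) (c : R) : measurable_fun setT f ->
  measurable [set w | c <= avg (fun i => f (Z i w))].
Proof.
move=> mf; rewrite -[X in measurable X]setTI.
by apply: measurable_fun_le => //; exact: (measurable_avg iidZ mf).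
Qed.

Lemma measurable_avg_le (f : T -> R) (c : R) : measurable_fun setT f ->
  measurable [set w | avg (fun i => f (Z i w)) <= c].
Proof.
move=> mf; rewrite -[X in measurable X]setTI.
by apply: measurable_fun_le => //; exact: (measurable_avg iidZ mf).
Qed.

Lemma card_grid m N : #|{: {ffun 'I_N -> 'I_m * bool}}| = ((m * 2) ^ N)%N.
Proof. by rewrite card_ffun card_prod !card_ord card_bool. Qed.

(** At the scale 2 Kx ||v|| the threshold of [tail_sqr] is 4 (2 Kx ||v||)^2 = (4 Kx)^2 ||v||^2.
    Scales must be positive, but for a zero average the event is empty. *)
Lemma event_upper m N (a : 'I_m -> 'cV[R]_p) :
  let bad := [set w | exists s : {ffun 'I_N -> 'I_m * bool},
    (4 * Kx) ^+ 2 * lnorm 2 (grid_point a s) ^+ 2 <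
      avg (fun i => dotv (grid_point a s) (xv (Z i w)) ^+ 2)] in
  measurable bad /\ (P bad <= (((m * 2) ^ N)%:R * expR (- (3 * n%:R)))%:E)%E.
Proof.
rewrite /= -card_grid; apply: union_bound => s; set v := grid_point a s.
  apply: (measurable_avg_gt (f := fun z => dotv v (xv z) ^+ 2)).
  by apply: measurable_funX; exact: measurable_dotv.
have [v0|v0] := eqVneq (lnorm 2 v) 0.
  rewrite (_ : (fun w => _) = set0); first by rewrite measure0 lee_fin expR_ge0.
  rewrite -subset0 => w /=; rewrite (lnorm2_eq0 v0).
  rewrite (eq_avg (g := fun=> 0)); last by move=> i; rewrite dotv0l expr0n.
  by rewrite /avg big1// mulr0 ltNge mulr_ge0 ?sqr_ge0.
have vp : 0 < lnorm 2 v by rewrite lt_neqAle eq_sym v0 lnorm_ge0.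
have tp : 0 < 2 * Kx * lnorm 2 v by rewrite !mulr_gt0.
have mv : measurable_fun setT (fun z => dotv v (xv z)) by exact: measurable_dotv.
apply: le_trans (tail_sqr iidZ tp mv (subgaussian_dotv vp (lexx _))).
apply: le_measure; rewrite ?inE.
- apply: (measurable_avg_gt (f := fun z => dotv v (xv z) ^+ 2)).
  by apply: measurable_funX.
- apply: (measurable_avg_ge (f := fun z => dotv v (xv z) ^+ 2)).
  by apply: measurable_funX.
- move=> w /= /ltW; apply: le_trans.
  rewrite le_eqVlt; apply/orP; left; apply/eqP.
  by move: (lnorm 2 v) => u; ring.
Qed.

(** [tail_lower] is applied to the normalised average, with its length as [rho]: the threshold is
    relative to the length, the truncation level absolute. All lengths are at most [Kb], so one
    level [Mg] serves all averages. *)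
Lemma event_lower m N (a : 'I_m -> 'cV[R]_p) (u : T -> R) (Kb kl su Mg : R) :
  (0 < N)%N -> 0 < Kb -> 0 < kl -> 0 < su -> 0 < Mg ->
  (forall k, lnorm 2 (a k) <= Kb) ->
  measurable_fun setT u -> subgaussian P (u \o Z i1) su ->
  (forall v : 'cV[R]_p, kl * \sum_j v j 0 ^+ 2 <= Ex (fun w => dotv v (xv (Z i1 w)) ^+ 2)) ->
  ((8 * Kb ^+ 2 + 4) * (2 * Kx) ^+ 4 + 4 * su ^+ 4) / Mg ^+ 2 <= kl / 2 ->
  let bad := [set w | exists s : {ffun 'I_N -> 'I_m * bool},
    avg (fun i => dotv (grid_point a s) (xv (Z i w)) ^+ 2
       * (`|dotv (grid_point a s) (xv (Z i w))| <= Mg)%R%:R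
       * (`|u (Z i w)| <= Mg)%R%:R)
    < kl / 4 * lnorm 2 (grid_point a s) ^+ 2] in
  measurable bad /\
  (P bad <= (((m * 2) ^ N)%:R * expR (- (kl ^+ 2 / (512 * (2 * Kx) ^+ 4) * n%:R)))%:E)%E.
Proof.
move=> N0 Kb0 kl0 su0 Mg0 aK mu su_ hmom hMg.
have mv (e : 'cV[R]_p) : measurable_fun setT (fun z => dotv e (xv z)) by exact: measurable_dotv.
have mtr (e : 'cV[R]_p) (rho : R) : measurable_fun setT (fun z => dotv e (xv z) ^+ 2
       * (`|rho * dotv e (xv z)| <= Mg)%R%:R * (`|u z| <= Mg)%R%:R).
  apply: measurable_funM; [apply: measurable_funM; [exact: measurable_funX|]|];
  apply: measurable_natr_le; apply: measurableT_comp => //; exact: measurable_funM.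
have mtr1 (e : 'cV[R]_p) : measurable_fun setT (fun z => dotv e (xv z) ^+ 2
       * (`|dotv e (xv z)| <= Mg)%R%:R * (`|u z| <= Mg)%R%:R).
  by have := mtr e 1; under eq_fun do rewrite mul1r.
rewrite /= -card_grid; apply: union_bound => s; set v := grid_point a s.
  exact: (measurable_avg_lt (kl / 4 * lnorm 2 v ^+ 2) (mtr1 v)).
have [v0|v0] := eqVneq (lnorm 2 v) 0.
  rewrite (_ : (fun w => _) = set0); first by rewrite measure0 lee_fin expR_ge0.
  rewrite -subset0 => w /=; rewrite v0 expr0n mulr0 ltNge => /negP; apply.
  apply: avg_ge0 => i; apply: mulr_ge0; last exact: ler0n.
  by apply: mulr_ge0; [exact: sqr_ge0|exact: ler0n].
have vp : 0 < lnorm 2 v by rewrite lt_neqAle eq_sym v0 lnorm_ge0.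
pose e := (lnorm 2 v)^-1 *: v.
have e1 : lnorm 2 e = 1 by rewrite lnorm2Z gtr0_norm ?invr_gt0// mulVf.
have tp : 0 < 2 * Kx by rewrite mulr_gt0.
have se : subgaussian P ((fun z => dotv e (xv z)) \o Z i1) (2 * Kx).
  by rewrite -(mulr1 (2 * Kx)); apply: subgaussian_dotv => //; rewrite e1.
have he : kl <= Ex (fun w => dotv e (xv (Z i1 w)) ^+ 2).
  by apply: le_trans (hmom e); rewrite -lnorm2_sqr e1 expr1n mulr1.
have vK : lnorm 2 v <= Kb by apply: lnorm2_grid_point => //; exact: ltW.
have hM : ((8 * lnorm 2 v ^+ 2 + 4) * (2 * Kx) ^+ 4 + 4 * su ^+ 4) / Mg ^+ 2 <= kl / 2.
  apply: le_trans hMg; rewrite ler_wpM2r ?invr_ge0 ?sqr_ge0// lerD2r.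
  rewrite ler_wpM2r ?exprn_ge0 ?(ltW tp)// lerD2r ler_wpM2l//.
  by rewrite lerXn2r ?nnegrE ?(ltW vp) ?(ltW Kb0).
apply: le_trans (tail_lower iidZ tp su0 Mg0 kl0 (mv e) mu se su_ he hM).
apply: le_measure; rewrite ?inE.
- exact: (measurable_avg_lt (kl / 4 * lnorm 2 v ^+ 2) (mtr1 v)).
- exact: (measurable_avg_le (kl / 4) (mtr e (lnorm 2 v))).
- have ve i w : dotv v (xv (Z i w)) = lnorm 2 v * dotv e (xv (Z i w)).
    by rewrite /e dotvZl mulrA divff// mul1r.
  move=> w /=.
  rewrite (eq_avg (g := fun i => lnorm 2 v ^+ 2 * (dotv e (xv (Z i w)) ^+ 2 *
     (`|lnorm 2 v * dotv e (xv (Z i w))| <= Mg)%R%:R * (`|u (Z i w)| <= Mg)%R%:R))).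
    by rewrite avgZ mulrC ltr_pM2r ?exprn_gt0// => /ltW.
  by move=> i; rewrite !ve exprMn !mulrA.
Qed.

(** Both signs of each [b k] occur, so one-sided tails yield a two-sided bound. After normalisation
    the deviation is proportional to the length of [b k]: it is rho times the length, not rho alone,
    that the rate bounds. *)
Lemma event_bernstein m (b : 'I_m -> 'cV[R]_p) (zeta g u : T -> R)
    (tg tu Lu tau rho : R) :
  0 < tg -> 0 < tu -> 0 < Lu -> 0 < tau -> 0 < rho <= 1 / 2 ->
  measurable_fun setT zeta -> measurable_fun setT g -> measurable_fun setT u ->
  subgaussian P (g \o Z i1) tg -> subgaussian P (u \o Z i1) tu ->
  (forall z, `|zeta z| <= `|g z| + Lu * `|u z|) ->
  3 * (2 * Kx) ^+ 2 <= tau -> 3 * tg ^+ 2 <= tau -> 3 * (Lu ^+ 2 * tu ^+ 2) <= tau ->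
  let f (ks : 'I_m * bool) z := zeta z * dotv ((-1) ^+ ks.2 *: b ks.1) (xv z) in
  let bad := [set w | exists ks, avg (fun i => f ks (Z i w)) <
    Ex (fun w => f ks (Z i1 w)) - 34 * rho * tau * lnorm 2 (b ks.1)] in
  measurable bad /\ (P bad <= ((m * 2)%:R * expR (- (2 * (n%:R * rho ^+ 2))))%:E)%E.
Proof.
move=> tg0 tu0 Lu0 tau0 rho12 mz mg mu sg su hz ht1 ht2 ht3 f.
have card_ks : #|{: 'I_m * bool}| = (m * 2)%N by rewrite card_prod card_ord card_bool.
rewrite /= -card_ks.
have mf ks : measurable_fun setT (f ks).
  by apply: measurable_funM => //; exact: measurable_dotv.
apply: union_bound => ks; first exact: measurable_avg_lt.
pose v := (-1) ^+ ks.2 *: b ks.1.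
have vn : lnorm 2 v = lnorm 2 (b ks.1) by rewrite lnorm2Z normr_sign mul1r.
rewrite -vn; clear vn.
have [v0|v0] := eqVneq (lnorm 2 v) 0.
  rewrite (_ : (fun w => _) = set0); first by rewrite measure0 lee_fin expR_ge0.
  rewrite -subset0 => w /=; rewrite v0 mulr0 subr0.
  have f0 z : f ks z = 0 by rewrite /f -/v (lnorm2_eq0 v0) dotv0l mulr0.
  rewrite (eq_avg (g := fun=> 0)); last by move=> i; rewrite f0.
  rewrite (@eq_Rintegral _ _ _ P setT (fun=> 0)); last by move=> z _; rewrite f0.
  by rewrite (Ex_cst P) /avg big1// mulr0 ltxx.
have vp : 0 < lnorm 2 v by rewrite lt_neqAle eq_sym v0 lnorm_ge0.
pose e := (lnorm 2 v)^-1 *: v.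
have e1 : lnorm 2 e = 1 by rewrite lnorm2Z gtr0_norm ?invr_gt0// mulVf.
have tp : 0 < 2 * Kx by rewrite mulr_gt0.
have se : subgaussian P ((fun z => dotv e (xv z)) \o Z i1) (2 * Kx).
  by rewrite -(mulr1 (2 * Kx)); apply: subgaussian_dotv => //; rewrite e1.
pose xi z := zeta z * dotv e (xv z) / tau.
have me : measurable_fun setT (fun z => dotv e (xv z)) by exact: measurable_dotv.
have mxi : measurable_fun setT xi.
  by apply: measurable_funM => //; exact: measurable_funM.
have hxi : (\int[P]_w (expR `|xi (Z i1 w)|)%:E <= 2%:E)%E.
  apply: (product_subexponential (V := (fun z => dotv e (xv z)) \o Z i1)
    (g := g \o Z i1) (u := u \o Z i1) (zeta := zeta \o Z i1) tp tg0 tu0 tau0 Lu0) => //.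
  - by apply: measurableT_comp.
  - by apply: measurableT_comp.
  - by apply: measurableT_comp.
  - by apply: measurableT_comp.
  - by move=> w; exact: hz.
have fxi z : f ks z = tau * lnorm 2 v * xi z.
  have de : dotv e (xv z) = (lnorm 2 v)^-1 * dotv v (xv z) by exact: dotvZl.
  rewrite /xi de /f -/v; have tn : tau != 0 by rewrite gt_eqF.
  by move: v0 tn; move: (lnorm 2 v) (dotv v _) => l dd l0 tn; field; rewrite l0 tn.
apply: le_trans (tail_bernstein iidZ rho12 mxi hxi).
have c0 : 0 < tau * lnorm 2 v by rewrite mulr_gt0.
have ixi : P.-integrable setT (EFin \o (fun w => xi (Z i1 w))).
  apply: le_integrable_ge0 (le_lt_trans hxi (ltry _)).
  - exact: measurableT_comp.
  - apply: measurableT_comp => //; apply: measurableT_comp => //; exact: measurableT_comp.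
  - by move=> w; rewrite (le_trans _ (expR_ge1Dx _))// lerDr.
apply: le_measure; rewrite ?inE.
- exact: measurable_avg_lt.
- exact: measurable_avg_le.
- move=> w /=; rewrite (eq_avg (g := fun i => tau * lnorm 2 v * xi (Z i w))); last first.
    by move=> i; rewrite fxi.
  rewrite (@eq_Rintegral _ _ _ P setT (fun w => tau * lnorm 2 v * xi (Z i1 w))); last first.
    by move=> z _; rewrite fxi.
  rewrite avgZ RintegralZl// => h; apply: ltW; rewrite -(ltr_pM2l c0) mulrBr.
  by move: h; rewrite (_ : 34 * rho * tau * _ = tau * lnorm 2 v * (34 * rho))//;
    move: (lnorm 2 v) => l; ring.
Qed.

End Events.

Lemma simplex_sum_norm (R : realType) K (v : 'cV[R]_K) : simplex v -> \sum_k `|v k 0| = 1.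
Proof.
move=> [v01 <-]; apply: eq_bigr => k _.
by rewrite ger0_norm//; have /andP[] := v01 k.
Qed.

Lemma lnorm1_simplex_sub (R : realType) K (v w : 'cV[R]_K) :
  simplex v -> simplex w -> lnorm 1 (v - w) <= 2.
Proof.
move=> sv sw; rewrite lnorm1E; apply: (@le_trans _ _ (\sum_k (`|v k 0| + `|w k 0|))).
  by apply: ler_sum => k _; rewrite !mxE; exact: ler_normB.
by rewrite big_split /= !simplex_sum_norm.
Qed.

(** * The prediction error of the weights *)

Section Prediction.
Variables (R : realType) (p : nat).

Definition unit_vector (j : 'I_p) : 'cV[R]_p := delta_mx j 0.

Lemma lnorm2_unit_vector j : lnorm 2 (unit_vector j) <= 1.
Proof.
apply: ler_of_sqr => //; first exact: lnorm_ge0.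
rewrite lnorm2_sqr expr1n (bigD1 j)//= !mxE !eqxx expr1n big1 ?addr0// => l lj.
by rewrite !mxE (negPf lj) expr0n.
Qed.

Lemma unit_vector_comb (v : 'cV[R]_p) : \sum_j v j 0 *: unit_vector j = v.
Proof.
apply/colP => j; rewrite summxE (bigD1 j)//= !mxE !eqxx mulr1 big1 ?addr0// => l lj.
by rewrite !mxE eq_sym (negPf lj) mulr0.
Qed.

(** Each observation lies in exactly one fold, so the criterion is one sum over the sample in which
    observation [i] is predicted by the estimators attached to its own fold. *)
Lemma fold_index n n1 J (I : 'I_J -> {set 'I_n}) : equal_folds n1 I ->
  exists fo : 'I_n -> 'I_J, forall F : 'I_J -> 'I_n -> R,
    \sum_m \sum_(i in I m) F m i = \sum_i F (fo i) i.
Proof.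
move=> [_ _ disj cov].
have /choice[fo foP] : forall i, exists m, i \in I m.
  move=> i; have : i \in (\bigcup_(m < J) I m)%SET by rewrite cov inE.
  by move=> /finset.bigcupP[m _ im]; exists m.
exists fo => F.
rewrite (exchange_big_dep xpredT)//=; apply: eq_bigr => i _.
rewrite (big_pred1 (fo i))// => m /=; apply/idP/eqP => [im|->]; last exact: foP.
apply/eqP; apply: contraT => mf.
have := disj _ _ mf => /setP/(_ i); rewrite !inE im foP //.
Qed.

Variables (n J K N n1 : nat) (x : 'I_n -> 'cV[R]_p).
Variables (phi G H : 'I_n -> R -> R) (Lu kappa M : R).
Hypothesis dphi : forall i (x : R), is_derive x (1 : R) (phi i) (G i x).
Hypothesis dG : forall i (x : R), is_derive x (1 : R) (G i) (H i x).
Hypothesis H0 : forall i x, 0 <= H i x.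
Hypothesis Hk : forall i x, `|x| <= 2 * M -> kappa <= H i x.
Hypothesis lipG : forall i a b, `|G i a - G i b| <= Lu * `|a - b|.
Hypotheses (M0 : 0 < M) (kappa0 : 0 < kappa) (Lu0 : 0 < Lu).

(** A deterministic statement whose hypotheses on averages describe the good event; [m k] stands for
    the expected score in the direction [bs k], and [tau] for the empirical error of the fold
    predictions. *)
Lemma prediction_bound (I : 'I_J -> {set 'I_n}) (bs : 'I_K -> 'cV[R]_p)
    (bcv : 'I_J -> 'I_K -> 'cV[R]_p) (w ws : 'cV[R]_K) (m : 'I_K -> R)
    (B T1 T2 tau h2 Zg nu kl a : R) :
  (0 < N)%N -> 0 <= B -> 0 <= T1 -> 0 <= T2 -> 0 <= tau -> 0 <= Zg -> 0 < kl ->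
  equal_folds n1 I -> simplex w -> simplex ws ->
  (forall k, lnorm 2 (bs k) <= h2) ->
  (forall s : {ffun 'I_N -> 'I_p * bool},
    avg (fun i => dotv (grid_point unit_vector s) (x i) ^+ 2)
     <= B ^+ 2 * lnorm 2 (grid_point unit_vector s) ^+ 2) ->
  (forall s : {ffun 'I_N -> 'I_K * bool},
    avg (fun i => dotv (grid_point bs s) (x i) ^+ 2)
     <= B ^+ 2 * lnorm 2 (grid_point bs s) ^+ 2) ->
  (forall s : {ffun 'I_N -> 'I_K * bool}, kl / 4 * lnorm 2 (grid_point bs s) ^+ 2 <=
     avg (fun i => dotv (grid_point bs s) (x i) ^+ 2
        * (`|dotv (grid_point bs s) (x i)| <= M / 8)%R%:R
        * (`|dotv (mxcols bs *m ws) (x i)| <= M / 8)%R%:R)) ->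
  (forall k, `|avg (fun i => G i (dotv (mxcols bs *m ws) (x i)) * dotv (bs k) (x i)) - m k|
      <= nu) ->
  0 <= \sum_k (w - ws) k 0 * m k ->
  avg (fun i => G i (dotv (mxcols bs *m ws) (x i)) ^+ 2) <= Zg ^+ 2 ->
  (forall l k, lnorm 2 (bcv l k - bs k) <= T2 /\ lnorm 1 (bcv l k - bs k) <= T1) ->
  J%:R * (B ^+ 2 * (T2 ^+ 2 + T1 ^+ 2 / N%:R)) <= tau ^+ 2 ->
  \sum_(l < J) \sum_(i in I l) phi i (dotv (mxcols (bcv l) *m w) (x i)) <=
  \sum_(l < J) \sum_(i in I l) phi i (dotv (mxcols (bcv l) *m ws) (x i)) ->
  a = lnorm 1 (w - ws) ->
  kappa / 4 * (kl / 8 * lnorm 2 (mxcols bs *m (w - ws)) ^+ 2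
      - a ^+ 2 * (2 * B * h2) ^+ 2 / N%:R) <=
    a * (nu + Zg * tau + Lu * (tau * (2 * (2 * B * h2 + tau)))
         + kappa / 2 * (a * tau ^+ 2 + 1 / 2 * (2 * B * h2 * tau))).
Proof.
move=> N0 B0 T10 T20 tau0 Zg0 kl0 folds ww wws bsh hup hupK hlow hbern hm hZg hcv htau hCV aD.
have NR0 : 0 < N%:R :> R by rewrite ltr0n.
have aE : a = \sum_k `|w k 0 - ws k 0|.
  by rewrite aD lnorm1E; apply: eq_bigr => k _; rewrite !mxE.
have a2 : a <= 2 by rewrite aD; exact: lnorm1_simplex_sub.
have [fo foP] := fold_index folds.
have h20 (k : 'I_K) : 0 <= h2 by exact: le_trans (lnorm_ge0 2 (bs k)) (bsh k).
have {}h20 : 0 <= h2.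
  case: (posnP K) => K0; last exact: (h20 (Ordinal K0)).
  have := ww.2; rewrite big1; first by move=> /eqP; rewrite eq_sym oner_eq0.
  by move=> [k kK]; exfalso; move: kK; rewrite K0.
(* [grid_upper] for the single coefficient 1 at [k]; then 1 / N <= 1 and 2 B^2 <= (2 B)^2. *)
have hzs k : avg (fun i => dotv (bs k) (x i) ^+ 2) <= (2 * B * h2) ^+ 2.
  have := grid_upper N0 bsh (fun l => (l == k)%:R) hupK.
  have -> : \sum_l (l == k)%:R *: bs l = bs k.
    rewrite (bigD1 k)//= eqxx scale1r big1 ?addr0// => l /negPf ->.
    by rewrite scale0r.
  have -> : \sum_l `|((l == k)%:R : R)| = 1.
    rewrite (bigD1 k)//= eqxx normr1 big1 ?addr0// => l /negPf ->.
    by rewrite normr0.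
  move=> /le_trans; apply; rewrite expr1n mul1r.
  have e1 : lnorm 2 (bs k) ^+ 2 <= h2 ^+ 2.
    by have := bsh k; have := lnorm_ge0 2 (bs k) => u v; rewrite lerXn2r ?nnegrE.
  have e2 : h2 ^+ 2 / N%:R <= h2 ^+ 2.
    rewrite ler_pdivrMr// -[leLHS]mulr1; apply: ler_wpM2l; first exact: sqr_ge0.
    by rewrite ler1n.
  apply: (@le_trans _ _ (B ^+ 2 * (h2 ^+ 2 + h2 ^+ 2))).
    by apply: ler_wpM2l; [exact: sqr_ge0|exact: lerD].
  have : 0 <= B ^+ 2 * h2 ^+ 2 by apply: mulr_ge0; exact: sqr_ge0.
  by rewrite !exprMn; move: (B ^+ 2) (h2 ^+ 2) => u v; lra.
(* The estimator attached to the fold of [i] is dominated by the sum over all folds, each estimator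
   being evaluated on the whole sample; hence the factor [J]. *)
have hzh k : avg (fun i => (dotv (bcv (fo i) k) (x i) - dotv (bs k) (x i)) ^+ 2) <= tau ^+ 2.
  apply: le_trans htau.
  apply: (@le_trans _ _ (avg (fun i => \sum_(l < J) dotv (bcv l k - bs k) (x i) ^+ 2))).
    apply: ler_avg => i; rewrite (bigD1 (fo i))//= -[leLHS]addr0; apply: lerD.
      by rewrite dotvDl -(scaleN1r (bs k)) dotvZl mulN1r.
    by apply: sumr_ge0 => l _; exact: sqr_ge0.
  rewrite avg_sum -[in leRHS](card_ord J) -sumr_const mulr_suml.
  apply: ler_sum => l _; rewrite mul1r; have [c2 c1] := hcv l k.
  have := grid_upper N0 lnorm2_unit_vector (fun j => (bcv l k - bs k) j 0) hup.
  rewrite unit_vector_comb -lnorm1E expr1n mulr1 => /le_trans; apply.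
  apply: ler_wpM2l; first exact: sqr_ge0.
  apply: lerD; first by rewrite lerXn2r ?nnegrE// lnorm_ge0.
  apply: ler_wpM2r; first by rewrite invr_ge0.
  by rewrite lerXn2r ?nnegrE// lnorm_ge0.
pose zs k i := dotv (bs k) (x i).
pose zh k i := dotv (bcv (fo i) k) (x i).
pose us i := \sum_k ws k 0 * zs k i.
pose vs i := \sum_k (w k 0 - ws k 0) * zs k i.
have usE i : dotv (mxcols bs *m ws) (x i) = us i by rewrite dotv_cols.
have vsE i : dotv (\sum_k (w k 0 - ws k 0) *: bs k) (x i) = vs i.
  by rewrite dotv_suml; apply: eq_bigr => k _; rewrite dotvZl.
have combE : \sum_k (w k 0 - ws k 0) *: bs k = mxcols bs *m (w - ws).
  by rewrite mulmx_cols; apply: eq_bigr => k _; rewrite !mxE.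
(* The score is linear in the direction, so the random direction reduces to the [K] fixed ones: the
   expected part is nonnegative by [hm], and the rest is at most [nu] per unit of l1 norm. *)
have hnu : - (nu * \sum_k `|w k 0 - ws k 0|) <= avg (fun i => G i (us i) * vs i).
  have -> : avg (fun i => G i (us i) * vs i) =
      \sum_k (w k 0 - ws k 0) * avg (fun i => G i (us i) * zs k i).
    under [RHS]eq_bigr do rewrite -avgZ.
    rewrite -avg_sum; apply: eq_avg => i; rewrite mulr_sumr.
    by apply: eq_bigr => k _; rewrite mulrCA.
  apply: (@le_trans _ _ (\sum_k ((w k 0 - ws k 0) * avg (fun i => G i (us i) * zs k i)
      - (w - ws) k 0 * m k))); last first.
    by rewrite sumrB lerBlDr lerDl.
  rewrite mulr_sumr -sumrN; apply: ler_sum => k _; rewrite !mxE -mulrBr.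
  have hk := hbern k.
  have {}hk : `|avg (fun i => G i (us i) * zs k i) - m k| <= nu.
    by rewrite (eq_avg (g := fun i => G i (dotv (mxcols bs *m ws) (x i)) * dotv (bs k) (x i)))// => i;
      rewrite usE.
  rewrite lerNl; apply: (le_trans (ler_norm _)); rewrite normrN normrM mulrC.
  exact: ler_wpM2r.
have hQ : kl / 8 * lnorm 2 (mxcols bs *m (w - ws)) ^+ 2
    - a * (2 * B * h2) ^+ 2 / N%:R * (\sum_k `|w k 0 - ws k 0|) <=
  avg (fun i => vs i ^+ 2 * (`|vs i| <= M / 2)%R%:R * (`|us i| <= M / 2)%R%:R).
  have r2 : \sum_k `|w k 0 - ws k 0| <= 2 by rewrite -aE.
  have M20 : 0 < M / 2 by rewrite divr_gt0.
  have kl4 : 0 <= kl / 4 by rewrite divr_ge0// ltW.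
  have chi01 i : 0 <= ((`|us i| <= M / 8)%R%:R : R) <= 1 by rewrite ler0n lern1 leq_b1.
  have hlow' (s : {ffun 'I_N -> 'I_K * bool}) : kl / 4 * lnorm 2 (grid_point bs s) ^+ 2 <=
     avg (fun i => dotv (grid_point bs s) (x i) ^+ 2
        * (`|dotv (grid_point bs s) (x i)| <= M / 2 / 4)%R%:R * (`|us i| <= M / 8)%R%:R).
    rewrite (_ : M / 2 / 4 = M / 8); last by field.
    apply: (le_trans (hlow s)); apply: ler_avg => i; by rewrite usE.
  (* [basic_inequality] asks for the level M / 2, for which the averages have to be truncated at M /
     2 / 4 = M / 8. *)
  have := @grid_lower R p K N bs N0 n x (fun k => w k 0 - ws k 0) (M / 2) (2 * B * h2)
    (kl / 4) (fun i => (`|us i| <= M / 8)%R%:R) r2 M20 kl4 chi01 hzs hlow'.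
  rewrite -aE combE => h; apply: (@le_trans _ _ _ _ _ _ (le_trans h _)).
    rewrite le_eqVlt; apply/orP; left; apply/eqP.
    by move: (lnorm 2 _ ^+ 2) ((2 * B * h2) ^+ 2) => u v; field; rewrite gt_eqF.
  apply: ler_avg => i; rewrite -combE vsE; apply: ler_wpM2l.
    by apply: mulr_ge0; [exact: sqr_ge0|exact: ler0n].
  rewrite ler_nat; case: (leP `|us i| (M / 8)) => // uM.
  suff -> : `|us i| <= M / 2 by [].
  by have := M0; lra.
have hmin : avg (fun i => phi i (\sum_k w k 0 * zh k i)) <=
    avg (fun i => phi i (\sum_k ws k 0 * zh k i)).
  apply: ler_wpM2l; first by rewrite invr_ge0.
  move: hCV; rewrite !foP.
  under eq_bigr do rewrite dotv_cols.
  by under [X in _ <= X -> _]eq_bigr do rewrite dotv_cols.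
have ws1 : \sum_k `|ws k 0| <= 1 by rewrite simplex_sum_norm.
have Rz0 : 0 <= 2 * B * h2 by rewrite !mulr_ge0.
have hZg' : avg (fun i => G i (us i) ^+ 2) <= Zg ^+ 2.
  by apply: le_trans hZg; apply: ler_avg => i; rewrite usE.
have := @basic_inequality R n K phi G H Lu kappa M dphi dG H0 Hk lipG M0 kappa0 Lu0
  zs zh (fun k => ws k 0) (fun k => w k 0) tau (2 * B * h2) Zg nu
  (kl / 8 * lnorm 2 (mxcols bs *m (w - ws)) ^+ 2) (a * (2 * B * h2) ^+ 2 / N%:R)
  tau0 Rz0 Zg0 ws1 hzh hzs hZg' hnu hQ hmin.
rewrite -aE; apply: le_trans.
rewrite le_eqVlt; apply/orP; left; apply/eqP.
by move: (lnorm 2 _ ^+ 2) ((2 * B * h2) ^+ 2) => u v; field; rewrite gt_eqF.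
Qed.

End Prediction.

(** * Measurability and numerical bounds *)

Lemma measurable_first_covariates (R : realType) p :
  random_vector (@first_covariates R p).
Proof.
move=> j _ B mB; rewrite setTI.
apply: sub_sigma_algebra; exists (nat_of_ord j, B) => //.
by apply/seteqP; split => u /=; rewrite mxE.
Qed.

Lemma measurable_lnorm (R : realType) d (T : measurableType d) p (a : R)
    (V : T -> 'cV[R]_p) :
  random_vector V -> measurable_fun setT (fun w => lnorm a (V w)).
Proof.
move=> mV; apply: (measurableT_comp (measurable_powR _)).
apply: measurable_sum => j; apply: (measurableT_comp (measurable_powR _)).
by apply: measurableT_comp => //; exact: mV.
Qed.

Lemma random_vector_subc (R : realType) d (T : measurableType d) p
    (V : T -> 'cV[R]_p) (v : 'cV[R]_p) :
  random_vector V -> random_vector (fun w => V w - v).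
Proof.
move=> mV j; rewrite (_ : (fun w => _) = fun w => V w j 0 - v j 0).
  by apply: measurable_funB => //; exact: mV.
by apply/funext => w; rewrite !mxE.
Qed.

(** As pK >= 2, one has 2m <= (pK)^2, hence (2m)^N <= exp(2 N log(pK)) = exp(2 n N rho^2). *)
Lemma grid_count_le (R : realType) (m N pK n : nat) (rho c : R) :
  (m <= pK)%N -> (2 <= pK)%N -> n%:R * rho ^+ 2 = ln pK%:R -> N%:R * rho ^+ 2 <= c ->
  ((m * 2) ^ N)%:R <= expR (2 * c * n%:R).
Proof.
move=> mK K2 hrho hN.
have h : (m * 2)%:R <= expR (2 * (n%:R * rho ^+ 2)).
  rewrite hrho expRM_natl lnK ?posrE ?ltr0n; last exact: leq_trans K2.
  by rewrite -natrX ler_nat expnS expn1 leq_mul.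
rewrite natrX; apply: (@le_trans _ _ (expR (2 * (n%:R * rho ^+ 2)) ^+ N)).
  by rewrite lerXn2r ?nnegrE ?expR_ge0.
rewrite -expRM_natr ler_expR (_ : _ * N%:R = 2 * n%:R * (N%:R * rho ^+ 2)); last by ring.
rewrite (_ : 2 * c * n%:R = 2 * n%:R * c); last by ring.
by rewrite ler_wpM2l// mulr_ge0.
Qed.

(** N is the integer part of c / rho^2. It is at least 1, so N + 1 <= 2N, which gives the last
    bound. *)
Lemma exists_grid_size (R : realType) (rho c : R) : 0 < rho -> rho ^+ 2 <= c ->
  exists N : nat, [/\ (0 < N)%N, N%:R * rho ^+ 2 <= c & N%:R^-1 <= 2 * rho ^+ 2 / c].
Proof.
move=> r0 rc; have r20 : 0 < rho ^+ 2 by rewrite exprn_gt0.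
have c0 : 0 < c by exact: lt_le_trans rc.
pose N := Num.truncn (c / rho ^+ 2).
have c1 : 1 <= c / rho ^+ 2 by rewrite ler_pdivlMr// mul1r.
have /andP[h1 h2] := truncn_itv (le_trans ler01 c1).
have N0 : (0 < N)%N.
  rewrite lt0n; apply/negP => /eqP N0; move: h2; rewrite -/N N0.
  by rewrite ltNge c1.
have NR0 : 0 < N%:R :> R by rewrite ltr0n.
exists N; split => //; first by rewrite -ler_pdivlMr.
rewrite -div1r ler_pdivrMr// mulrAC ler_pdivlMr// mul1r.
have : c < N.+1%:R * rho ^+ 2 by rewrite -ltr_pdivrMr.
move=> /ltW /le_trans; apply.
rewrite (_ : 2 * rho ^+ 2 * N%:R = (2 * N%:R) * rho ^+ 2); last by ring.
rewrite ler_wpM2r ?sqr_ge0// -natr1 mulrDl mul1r lerD2l.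
by rewrite ler1n.
Qed.

Lemma bounded_setU (R : realType) d (Omega : measurableType d)
    (P : probability Omega R) (A B : set Omega) (a b : R) :
  measurable A /\ (P A <= a%:E)%E -> measurable B /\ (P B <= b%:E)%E ->
  measurable (A `|` B) /\ (P (A `|` B) <= (a + b)%:E)%E.
Proof.
move=> [mA Aa] [mB Bb]; split; first exact: measurableU.
by apply: (le_trans (measureU2 _ _ _)) => //; rewrite EFinD leeD.
Qed.

Lemma simplex_segment (R : realType) K (ws w : 'cV[R]_K) (t : R) :
  simplex ws -> simplex w -> 0 <= t <= 1 -> simplex (ws + t *: (w - ws)).
Proof.
move=> [s01 s1] [w01 w1] /andP[t0 t1]; split.
  move=> k; rewrite !mxE; have /andP[a1 a2] := s01 k; have /andP[b1 b2] := w01 k.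
  have -> : ws k 0 + t * (w k 0 - ws k 0) = (1 - t) * ws k 0 + t * w k 0 by ring.
  have t1' : 0 <= 1 - t by lra.
  have h1 := mulr_ge0 t1' a1; have h2 := mulr_ge0 t0 b1.
  have h3 := ler_wpM2l t1' a2; have h4 := ler_wpM2l t0 b2.
  by apply/andP; split; lra.
transitivity (\sum_k (ws k 0 + t * (w k 0 - ws k 0))).
  by apply: eq_bigr => k _; rewrite !mxE.
by rewrite big_split /= -mulr_sumr sumrB s1 w1 subrr mulr0 addr0.
Qed.

(** After a union bound costing 2 c4 m, tails with exponents 3 m and c3 m still leave 2 c4 m. *)
Lemma exponent_bounds (R : realType) (c4 c3 m : R) :
  0 <= m -> c4 <= 1 / 4 -> 4 * c4 <= c3 ->
  [/\ - (3 * m) <= - (2 * c4 * m),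
      2 * c4 * m + - (3 * m) <= - (2 * c4 * m)
    & 2 * c4 * m + - (c3 * m) <= - (2 * c4 * m)].
Proof.
move=> m0 h1 h2; have g1 := ler_wpM2r m0 h1; have g2 := ler_wpM2r m0 h2.
by split; lra.
Qed.

Lemma small_bounds (R : realType) (r : R) : 0 < r -> r <= 1 / 4 ->
  [/\ 0 < 2 * r < 1, 0 < r <= 1 / 2 & r <= 1].
Proof. by move=> r0 r4; split; [apply/andP; split|rewrite r0|]; lra. Qed.

Lemma sqr_add_le (R : realDomainType) (g l u : R) :
  (g + l * u) ^+ 2 <= 2 * g ^+ 2 + 2 * l ^+ 2 * u ^+ 2.
Proof. by have := sqr_ge0 (g - l * u); rewrite !expr2; lra. Qed.

Lemma sqr_add_ge (R : realDomainType) (g l u : R) : 0 <= g -> 0 <= u -> 0 <= l ->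
  2 * (4 * g ^+ 2) + 2 * l ^+ 2 * (4 * u ^+ 2) <= (3 * (g + l * u)) ^+ 2.
Proof.
move=> g0 u0 l0; have := mulr_ge0 (mulr_ge0 l0 g0) u0; have := sqr_ge0 g.
by have := sqr_ge0 (l * u); rewrite !exprMn !expr2; lra.
Qed.

(** Every term is reduced to a multiple of a t: surplus factors [t] and [a] are bounded by 1 and 2,
    and r h is exchanged for t. Here [t] is the rate, [h] the largest l2 norm, [r] is rho, [Ni] is 1
    / N and [Q] is the squared length of B* D. *)
Lemma rate_bound (R : realFieldType) (kap kl B ci Kb Zg At Lu tb a t h r Ni Q : R) :
  0 <= kap -> 0 <= B -> 0 <= ci -> 0 <= Kb -> 0 <= Zg -> 0 <= At -> 0 <= Lu -> 0 <= tb ->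
  0 <= a <= 2 -> 0 <= t <= 1 -> 0 <= h <= Kb -> 0 <= r <= 1 -> r * h <= (1 + Kb) * t ->
  Ni <= 2 * r ^+ 2 * ci ->
  kap / 4 * (kl / 8 * Q - a ^+ 2 * (2 * B * h) ^+ 2 * Ni) <=
    a * (34 * r * tb * h + Zg * (At * t) + Lu * (At * t * (2 * (2 * B * h + At * t)))
       + kap / 2 * (a * (At * t) ^+ 2 + 1 / 2 * (2 * B * h * (At * t)))) ->
  kap * kl / 32 * Q <= a * t * (kap / 4 * (16 * B ^+ 2 * ci * ((1 + Kb) * Kb))
    + (34 * tb * (1 + Kb) + Zg * At + Lu * (At * (2 * (2 * B * Kb + At)))
       + kap / 2 * (2 * At ^+ 2 + 1 / 2 * (2 * B * Kb * At)))).
Proof.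
move=> k0 B0 c0 Kb0 Z0 A0 L0 tb0 /andP[a0 a2] /andP[t0 t1] /andP[h0 hK] /andP[r0 r1] rh hN.
have rh0 : 0 <= r * h by exact: mulr_ge0.
have At0 : 0 <= At * t by exact: mulr_ge0.
have AtA : At * t <= At by rewrite -[leRHS]mulr1 ler_wpM2l.
have BhK : B * h <= B * Kb by exact: ler_wpM2l.
(* Maurey's error is of order (a r h)^2; one factor r h becomes (1 + Kb) t, the other is at most
   Kb. *)
have e1 : a ^+ 2 * (2 * B * h) ^+ 2 * Ni <= a * (t * (16 * B ^+ 2 * ci * ((1 + Kb) * Kb))).
  have h1 : (r * h) * (r * h) <= (1 + Kb) * t * Kb.
    apply: ler_pM => //; apply: le_trans hK; rewrite -[leRHS]mul1r; exact: ler_wpM2r.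
  have c1 : 0 <= a ^+ 2 * (2 * B * h) ^+ 2 by rewrite mulr_ge0// sqr_ge0.
  apply: (le_trans (ler_wpM2l c1 hN)); rewrite expr2.
  rewrite (_ : a * a * _ * _ = a * (a * (8 * B ^+ 2 * ci * (r * h * (r * h))))); last by ring.
  have w0 : 0 <= 8 * B ^+ 2 * ci by rewrite !mulr_ge0// sqr_ge0.
  have := ler_wpM2l w0 h1; set u := _ * _ => h2; set v := _ * (_ * t * Kb) in h2.
  apply: ler_wpM2l => //.
  have u0 : 0 <= u by apply: mulr_ge0 => //; exact: mulr_ge0.
  apply: (le_trans (ler_pM a0 u0 a2 h2)).
  by rewrite le_eqVlt; apply/orP; left; apply/eqP; rewrite /v; ring.
have e2 : 34 * r * tb * h <= t * (34 * tb * (1 + Kb)).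
  have := ler_wpM2l (mulr_ge0 (ler0n R 34) tb0) rh; set u := (_ <= _).
  by rewrite {}/u; clear; lra.
have e3 : Lu * (At * t * (2 * (2 * B * h + At * t))) <= t * (Lu * (At * (2 * (2 * B * Kb + At)))).
  rewrite (_ : t * _ = Lu * (At * t * (2 * (2 * B * Kb + At)))); last by ring.
  apply: ler_wpM2l => //; apply: ler_wpM2l => //; move: BhK AtA; clear; lra.
have e4 : a * (At * t) ^+ 2 <= t * (2 * At ^+ 2).
  have -> : t * (2 * At ^+ 2) = 2 * (At * t * At) by ring.
  by apply: ler_pM => //; [exact: sqr_ge0|rewrite expr2 ler_wpM2l].
have e5 : 2 * B * h * (At * t) <= t * (2 * B * Kb * At).
  have := ler_wpM2r At0 BhK; clear; lra.
have kap0 := ler_wpM2l k0 e1.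
have e6 := ler_wpM2l k0 (lerD e4 e5).
have := ler_wpM2l k0 e4; have := ler_wpM2l k0 e5.
move: e1 e2 e3 => _ e2 e3 e5' e4' H.
have e7 := ler_wpM2l a0 (lerD (lerD (lerD e2 (lexx (Zg * (At * t)))) e3) (lerD e4' e5')).
have e8 := ler_wpM2l a0 e4'; have e9 := ler_wpM2l a0 e5'; have e10 := ler_wpM2l a0 e2.
have e11 := ler_wpM2l a0 e3.
move: H kap0 e8 e9 e10 e11; clear.
lra.
Qed.

Lemma distr_le_margin (R : realDomainType) (x m b c : R) :
  m - b <= x -> - m - b <= - x -> b <= c -> `|x - m| <= c.
Proof. by move=> h1 h2 bc; rewrite ler_norml; apply/andP; split; lra. Qed.

Lemma sqr_rate_le (R : realFieldType) (t1 t r C c : R) : 0 < c ->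
  (r * t1) ^+ 2 <= (3 * C * t ^+ 2) ^+ 2 -> t ^+ 2 * t ^+ 2 <= t ^+ 2 ->
  t1 ^+ 2 * (2 * r ^+ 2) / c <= 18 * C ^+ 2 / c * t ^+ 2.
Proof.
move=> c0 h h'; rewrite [leRHS]mulrAC ler_wpM2r ?invr_ge0 ?(ltW c0)//.
have C2 := ler_wpM2l (sqr_ge0 C) h'; move: h; rewrite !exprMn; lra.
Qed.

(** * The good event *)

Section GoodEvent.
Context (R : realType) (dY : measure_display) (calY : measurableType dY).
Variables (L : calY -> R -> R) (J : nat) (q Lu Kx Ky kl Kb C0 : R).
Hypotheses (q01 : 0 <= q <= 1) (J2 : (2 <= J)%N).
Hypotheses (Lu0 : 0 < Lu) (Kx0 : 0 < Kx) (Ky0 : 0 < Ky) (kl0 : 0 < kl).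
Hypotheses (Kb0 : 0 < Kb) (C00 : 0 < C0).
Hypothesis measL : forall mu, measurable_fun setT (fun y => L y mu).
Hypothesis smoothL : smooth_loss L Lu.

Variables (n n1 p K : nat) (i1 : 'I_n).
Context (dO : measure_display) (Omega : measurableType dO).
Variable P : probability Omega R.
Variables (x : 'I_n -> Omega -> covariates R) (Y : 'I_n -> Omega -> calY).
Variables (A : 'I_K -> {set 'I_p}) (I : 'I_J -> {set 'I_n}).
Variables (bcv : 'I_J -> 'I_K -> Omega -> 'cV[R]_p).
Variables (what : Omega -> 'cV[R]_K) (bs : 'I_K -> 'cV[R]_p) (ws : 'cV[R]_K).
Let X i omega := first_covariates p (x i omega).
Hypothesis iidYx : iid P (fun i omega => (Y i omega, x i omega)).
Hypothesis finL : forall b : 'cV[R]_p,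
  finite_eloss L P (Y i1) (fun omega => dotv b (X i1 omega)).
Hypothesis folds : equal_folds n1 I.
Hypothesis mbcv : forall m k, random_vector (bcv m k).
Hypothesis whatP : forall omega,
  argmin (@simplex R K)
    (CV L (Y ^~ omega) (X ^~ omega) I (fun m => mxcols (fun k => bcv m k omega)))
    (what omega).
Hypothesis psiX : psi2_vnorm P (X i1) = Kx%:E.
Hypothesis psiY : psi2_norm P (fun omega => derive1 (L (Y i1 omega)) 0) = Ky%:E.
Hypothesis lminX : kl <= lambda_min (covariance_matrix P (X i1)).
Hypothesis bsK : forall k, lnorm 2 (bs k) <= Kb.
Hypothesis cv_rate : forall k m (delta : R), 0 < delta < 1 ->
     ((1 - 4 * expR (- ((n - n1)%:R * delta ^+ 2)))%:E <=
      P [set omega |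
           (lnorm 2 (bcv m k omega - bs k) <= rateT2 A bs n q C0 delta)%R /\
           (lnorm 1 (bcv m k omega - bs k) <= rateT1 A bs n q C0 delta)%R])%E.
Hypothesis wsP : argmin (@simplex R K)
    (fun w => risk L P (Y i1) (X i1) (mxcols bs *m w)) ws.

Notation Ex f := (\int[P]_w (f w))%R.
Notation rho := (Num.sqrt (ln (p * K)%:R / n%:R) : R).

Let T := (calY * covariates R)%type.
Let Z i omega : T := (Y i omega, x i omega).
Let xv (z : T) := first_covariates p z.2.
Let G y := derive1 (L y).

Let mxv : random_vector xv.
Proof.
move=> j; apply: (measurableT_comp (@measurable_first_covariates R p j)).
exact: measurable_snd.
Qed.

Let mZ i : measurable_fun setT (Z i).
Proof. by case: iidYx => + _ _; apply. Qed.

Let mX : random_vector (X i1).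
Proof. by move=> j; exact: (measurableT_comp (mxv j) (mZ i1)). Qed.

Let ustar (z : T) := dotv (mxcols bs *m ws) (xv z).
Let zeta (z : T) := G z.1 (ustar z).

Let mustar : measurable_fun setT ustar.
Proof. exact: measurable_dotv. Qed.

Let mzeta : measurable_fun setT zeta.
Proof. by apply: (measurable_dloss smoothL measL) => //; exact: measurable_fst. Qed.

Let g0 (z : T) := G z.1 0.

Let mg0 : measurable_fun setT g0.
Proof. by apply: (measurable_dloss smoothL measL) => //; exact: measurable_fst. Qed.

Let zeta_le z : `|zeta z| <= `|g0 z| + Lu * `|ustar z|.
Proof.
rewrite /zeta -[X in `|X|](subrK (G z.1 0)) addrC.
apply: (le_trans (ler_normD _ _)); rewrite lerD2l.
by have := dloss_lipschitz smoothL z.1 (ustar z) 0; rewrite subr0.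
Qed.

Let sg0 : subgaussian P (g0 \o Z i1) (2 * Ky).
Proof.
apply: (@psi2_norm_subgaussian _ _ _ _ _ Ky).
- by apply: measurableT_comp => //; exact: mZ.
- by rewrite -psiY.
- by have := Ky0; lra.
- exact: ltW.
Qed.

Let wsS : simplex ws. Proof. by case: wsP. Qed.

Let bsw_le (w : 'cV[R]_K) : simplex w -> lnorm 2 (mxcols bs *m w) <= Kb.
Proof.
move=> [w01 w1]; rewrite mulmx_cols; apply: (le_trans (lnorm2_comb_le _ (ltW Kb0) bsK)).
rewrite (eq_bigr (fun k => w k 0)); first by rewrite w1 mul1r.
by move=> k _; rewrite ger0_norm//; have /andP[] := w01 k.
Qed.

Let su : subgaussian P (ustar \o Z i1) (2 * Kx * Kb).
Proof. exact: (subgaussian_dotv iidYx mxv Kx0 psiX Kb0 (bsw_le wsS)). Qed.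

Let sV (v : 'cV[R]_p) : exists2 t, 0 < t & subgaussian P (fun w => dotv v (X i1 w)) t.
Proof.
(* Adding 1 keeps the scale positive for [v = 0]. *)
have l0 : 0 < lnorm 2 v + 1 by rewrite ltr_wpDl ?lnorm_ge0.
have l1 : lnorm 2 v <= lnorm 2 v + 1 by rewrite lerDl.
exists (2 * Kx * (lnorm 2 v + 1)); first by rewrite !mulr_gt0.
exact: (psi2_vnorm_subgaussian mX psiX Kx0 l0 l1).
Qed.

Let mV (v : 'cV[R]_p) : measurable_fun setT (fun w => dotv v (X i1 w)).
Proof. exact: measurable_dotv. Qed.

Let dotv_unit j (v : 'cV[R]_p) : dotv (unit_vector R j) v = v j 0.
Proof.
rewrite /dotv (bigD1 j)//= mxE !eqxx mul1r big1 ?addr0// => l lj.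
by rewrite mxE (negPf lj) mul0r.
Qed.

Let iV2 (v : 'cV[R]_p) : P.-integrable setT (EFin \o (fun w => dotv v (X i1 w) ^+ 2)).
Proof. by have [t t0 s] := sV v; exact: subgaussian_integrable_sqr t0 (mV v) s. Qed.

Let moment (v : 'cV[R]_p) :
  kl * \sum_j v j 0 ^+ 2 <= Ex (fun w => dotv v (X i1 w) ^+ 2).
Proof.
have iXj j : P.-integrable setT (EFin \o (fun w => X i1 w j 0)).
  have [t t0 s] := sV (unit_vector R j).
  by have := subgaussian_integrable t0 (mV _) s; under eq_fun do rewrite dotv_unit.
have iXj2 j : P.-integrable setT (EFin \o (fun w => X i1 w j 0 ^+ 2)).
  by have := iV2 (unit_vector R j); under eq_fun do rewrite dotv_unit.
apply: second_moment_ge => // j l.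
apply: (@le_integrable_ge0 _ _ _ P _ (fun w => X i1 w j 0 ^+ 2 + X i1 w l 0 ^+ 2)).
- by apply: measurable_funM; exact: mX.
- by apply: measurable_funD; apply: measurable_funX; exact: mX.
- move=> w; rewrite normrM -(real_normK (num_real (X i1 w j 0))).
  rewrite -(real_normK (num_real (X i1 w l 0))).
  have := sqr_ge0 (`|X i1 w j 0| - `|X i1 w l 0|).
  have := sqr_ge0 (`|X i1 w j 0|); have := sqr_ge0 (`|X i1 w l 0|).
  by move: (`|X i1 w j 0|) (`|X i1 w l 0|) => u v'; rewrite !expr2; lra.
- by apply: (integrable_ltpinfty (integrable_addr (iXj2 j) (iXj2 l))).
Qed.

Let iZV (v : 'cV[R]_p) :
  P.-integrable setT (EFin \o (fun w => zeta (Z i1 w) * dotv v (X i1 w))).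
Proof.
have mg : measurable_fun setT (g0 \o Z i1) by apply: measurableT_comp => //; exact: mZ.
have mu : measurable_fun setT (ustar \o Z i1) by apply: measurableT_comp => //; exact: mZ.
have tg : 0 < 2 * Ky by rewrite mulr_gt0.
have tu : 0 < 2 * Kx * Kb by rewrite !mulr_gt0.
have ig := subgaussian_integrable_sqr tg mg sg0.
have iu := subgaussian_integrable_sqr tu mu su.
have i1' := integrable_addr (integrable_addr ig (integrable_mulr (Lu ^+ 2) iu)) (iV2 v).
apply: (le_integrable_ge0 _ _ _ (integrable_ltpinfty i1')).
- by apply: measurable_funM => //; apply: measurableT_comp => //; exact: mZ.
- exact: measurable_of_integrable i1'.
- move=> w; rewrite normrM; apply: (le_trans (ler_wpM2r (normr_ge0 _) (zeta_le (Z i1 w)))).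
  rewrite /= -(real_normK (num_real (g0 _))) -(real_normK (num_real (ustar _))).
  rewrite -(real_normK (num_real (dotv _ _))).
  move: (`|g0 _|) (`|ustar _|) (`|dotv _ _|) (normr_ge0 (dotv v (X i1 w))) => a b c c0.
  have := sqr_ge0 (a + Lu * b - c); have := sqr_ge0 (a - Lu * b); have := sqr_ge0 c.
  by rewrite !expr2; lra.
Qed.

Let center k := Ex (fun w => zeta (Z i1 w) * dotv (bs k) (X i1 w)).

(** Optimality of [ws] along the segment towards [w], which stays in the simplex; by linearity the
    derivative of the risk is this combination of the centers. *)
Let center_ge0 (w : 'cV[R]_K) : simplex w -> 0 <= \sum_k (w - ws) k 0 * center k.
Proof.
move=> wS; have [_ wsmin] := wsP.
have -> : \sum_k (w - ws) k 0 * center k =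
    Ex (fun o => zeta (Z i1 o) * dotv (mxcols bs *m (w - ws)) (X i1 o)).
  under eq_bigr do rewrite -RintegralZl//.
  rewrite -(integrable_sumr (P := P) _ _).2; last by move=> k; exact: integrable_mulr.
  apply: eq_Rintegral => o _; rewrite dotv_cols mulr_sumr.
  by apply: eq_bigr => k _; rewrite mulrCA.
have uv t o : dotv (mxcols bs *m ws) (X i1 o) + t * dotv (mxcols bs *m (w - ws)) (X i1 o)
    = dotv (mxcols bs *m (ws + t *: (w - ws))) (X i1 o).
  by rewrite [in RHS]mulmxDr -scalemxAr dotvDl dotvZl.
apply: (first_order_condition smoothL).
- move=> t t01; rewrite /finite_eloss.
  by have := finL (mxcols bs *m (ws + t *: (w - ws))); under eq_fun do rewrite -uv.
- move=> t t01; have := wsmin _ (simplex_segment wsS wS t01).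
  have -> : (fun o => dotv (mxcols bs *m ws) (X i1 o)
       + t * dotv (mxcols bs *m (w - ws)) (X i1 o)) =
      fun o => dotv (mxcols bs *m (ws + t *: (w - ws))) (X i1 o).
    by apply/funext => o; exact: uv.
  exact.
- exact: iZV.
- exact: iV2.
Qed.

Lemma cv_event (delta : R) : 0 < delta < 1 ->
  let bad := [set w | exists lk : 'I_J * 'I_K,
    ~ ((lnorm 2 (bcv lk.1 lk.2 w - bs lk.2) <= rateT2 A bs n q C0 delta)%R /\
       (lnorm 1 (bcv lk.1 lk.2 w - bs lk.2) <= rateT1 A bs n q C0 delta)%R)] in
  measurable bad /\
  (P bad <= ((J * K)%:R * (4 * expR (- ((n - n1)%:R * delta ^+ 2))))%:E)%E.
Proof.
move=> d01; have -> : (J * K)%N = #|{: 'I_J * 'I_K}| by rewrite card_prod !card_ord.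
have mgood l k : measurable [set w |
    (lnorm 2 (bcv l k w - bs k) <= rateT2 A bs n q C0 delta)%R /\
    (lnorm 1 (bcv l k w - bs k) <= rateT1 A bs n q C0 delta)%R].
  have mle a c : measurable [set w | lnorm a (bcv l k w - bs k) <= c].
    rewrite -[X in measurable X]setTI; apply: measurable_fun_le => //.
    by apply: measurable_lnorm; exact: random_vector_subc.
  exact: measurableI (mle _ _) (mle _ _).
apply: union_bound => -[l k] /=; first exact: measurableC (mgood l k).
change (P (~` [set w |
    (lnorm 2 (bcv l k w - bs k) <= rateT2 A bs n q C0 delta)%R /\
    (lnorm 1 (bcv l k w - bs k) <= rateT1 A bs n q C0 delta)%R])
  <= (4 * expR (- ((n - n1)%:R * delta ^+ 2)))%:E)%E.
rewrite probability_setC// leeBlDr; last by rewrite fin_num_measure.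
have := cv_rate k l d01; rewrite EFinB => h.
by rewrite addeC -leeBlDr.
Qed.

Lemma half_sample : n%:R <= 2 * (n - n1)%:R :> R.
Proof.
have [nE _ _ _] := folds; rewrite -natrM ler_nat nE -{3}(mul1n n1) -mulnBl mulnA.
rewrite leq_mul2r; case: (J) J2 => [|[|j]]// _.
by rewrite subSS subn0 mul2n -addnn addSn ltnS leq_addl orbT.
Qed.

Lemma good_event (kappa M c4 taub At : R) :
  0 < M -> 0 < kappa ->
  (forall y mu, `|mu| <= 2 * M -> kappa <= derive1 (derive1 (L y)) mu) ->
  ((8 * Kb ^+ 2 + 4) * (2 * Kx) ^+ 4 + 4 * (2 * Kx * Kb) ^+ 4) / (M / 8) ^+ 2 <= kl / 2 ->
  0 < c4 -> c4 <= 1 / 4 -> 4 * c4 <= kl ^+ 2 / (512 * (2 * Kx) ^+ 4) ->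
  0 < taub -> 3 * (2 * Kx) ^+ 2 <= taub -> 3 * (2 * Ky) ^+ 2 <= taub ->
  3 * (Lu ^+ 2 * (2 * Kx * Kb) ^+ 2) <= taub ->
  0 <= At -> J%:R * ((4 * Kx) ^+ 2 * (9 * C0 ^+ 2 + 18 * C0 ^+ 2 / c4)) <= At ^+ 2 ->
  0 < rho -> rho <= 1 / 4 -> rho ^+ 2 <= c4 -> (2 <= p * K)%N ->
  rateT bs n q <= 1 ->
  exists bad : set Omega, [/\ measurable bad,
    (P bad <= ((4 * J%:R + 2) / (p * K)%:R + 5 * expR (- (2 * c4 * n%:R)))%:E)%E &
    forall o, ~ bad o -> forall a, a = lnorm 1 (what o - ws) ->
      kappa * kl / 32 * lnorm 2 (mxcols bs *m (what o - ws)) ^+ 2 <=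
      a * rateT bs n q * (kappa / 4 * (16 * (4 * Kx) ^+ 2 / c4 * ((1 + Kb) * Kb))
        + (34 * taub * (1 + Kb) + 3 * (2 * Ky + Lu * (2 * Kx * Kb)) * At
           + Lu * (At * (2 * (2 * (4 * Kx) * Kb + At)))
           + kappa / 2 * (2 * At ^+ 2 + 1 / 2 * (2 * (4 * Kx) * Kb * At))))].
Proof.
move=> M0 kap0 Hk hM c40 c4q c43 tb0 tb1 tb2 tb3 At0 hAt r0 r4 rc pK2 T1.
have n0 : (0 < n)%N by apply: leq_trans (ltn_ord i1).
have pK0 : (0 < p * K)%N by apply: leq_trans pK2.
have pKR : 0 < (p * K)%:R :> R by rewrite ltr0n.
have nR0 : 0 <= n%:R :> R by [].
have [N [N0 Nc Ninv]] := exists_grid_size r0 rc.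
have rsq := @rho_sqr R p K n n0 pK0.
have T0 : 0 <= rateT bs n q by exact: rateT_ge0.
have lnpK : expR (- (2 * (n%:R * rho ^+ 2))) = ((p * K)%:R ^+ 2)^-1.
  by rewrite rsq expRN expRM_natl lnK ?posrE.
have KpK : (K <= p * K)%N.
  by move: pK0; rewrite muln_gt0 => /andP[p0 _]; rewrite leq_pmull.
have ppK : (p <= p * K)%N.
  by move: pK0; rewrite muln_gt0 => /andP[_ K0]; rewrite leq_pmulr.
have invK : K%:R * ((p * K)%:R ^+ 2)^-1 <= ((p * K)%:R)^-1 :> R.
  rewrite ler_pdivrMr ?exprn_gt0// expr2 mulrA mulVf ?gt_eqF// mul1r ler_nat.
  exact: KpK.
have [d01 r12 r1] := small_bounds r0 r4.
have [x1 x2 x3] := exponent_bounds nR0 c4q c43.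
have Bcv := cv_event d01.
have tg : 0 < 2 * Ky by rewrite mulr_gt0.
have tu : 0 < 2 * Kx * Kb by rewrite !mulr_gt0.
have Bbern := event_bernstein iidYx mxv Kx0 psiX bs tg tu Lu0 tb0 r12 mzeta mg0 mustar
  sg0 su zeta_le tb1 tb2 tb3.
have Bup := event_upper iidYx mxv Kx0 psiX N (@unit_vector R p).
have BupK := event_upper iidYx mxv Kx0 psiX N bs.
have M80 : 0 < M / 8 by rewrite divr_gt0.
have Blow := event_lower iidYx mxv Kx0 psiX N0 Kb0 kl0 tu M80 bsK mustar su moment hM.
have Bg : measurable [set w | (4 * (2 * Ky) ^+ 2 <= avg (fun i => g0 (Z i w) ^+ 2))%R] /\
  (P [set w | (4 * (2 * Ky) ^+ 2 <= avg (fun i => g0 (Z i w) ^+ 2))%R]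
     <= (expR (- (3 * n%:R)))%:E)%E.
  split; last exact: (tail_sqr iidYx tg mg0 sg0).
  apply: (measurable_avg_ge iidYx (f := fun z => g0 z ^+ 2)).
  by apply: measurable_funX.
have Bu : measurable [set w | (4 * (2 * Kx * Kb) ^+ 2 <= avg (fun i => ustar (Z i w) ^+ 2))%R] /\
  (P [set w | (4 * (2 * Kx * Kb) ^+ 2 <= avg (fun i => ustar (Z i w) ^+ 2))%R]
     <= (expR (- (3 * n%:R)))%:E)%E.
  split; last exact: (tail_sqr iidYx tu mustar su).
  apply: (measurable_avg_ge iidYx (f := fun z => ustar z ^+ 2)).
  by apply: measurable_funX.
(* In order: fold estimators, scores, upper bounds for the unit vectors and for the
   candidates, lower bound, second moments of the score at 0 and of the predictor. *)
have [mbad Pbad] := bounded_setU Bcv (bounded_setU Bbern (bounded_setU Bup (bounded_setU BupK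
  (bounded_setU Blow (bounded_setU Bg Bu))))).
eexists; split; [exact: mbad| |].
  apply: (le_trans Pbad); rewrite lee_fin.
  have ex m : (m <= p * K)%N -> ((m * 2) ^ N)%:R <= expR (2 * c4 * n%:R).
    by move=> mK; exact: (grid_count_le mK pK2 rsq Nc).
  have e3 : expR (- (3 * n%:R)) <= expR (- (2 * c4 * n%:R)) :> R.
    by rewrite ler_expR.
  have eup m : (m <= p * K)%N ->
      ((m * 2) ^ N)%:R * expR (- (3 * n%:R)) <= expR (- (2 * c4 * n%:R)) :> R.
    move=> mK; apply: (le_trans (ler_wpM2r (expR_ge0 _) (ex m mK))).
    by rewrite -expRD ler_expR.
  have elow : ((K * 2) ^ N)%:R * expR (- (kl ^+ 2 / (512 * (2 * Kx) ^+ 4) * n%:R))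
      <= expR (- (2 * c4 * n%:R)) :> R.
    apply: (le_trans (ler_wpM2r (expR_ge0 _) (ex K KpK))).
    by rewrite -expRD ler_expR.
  have ebern : (K * 2)%:R * expR (- (2 * (n%:R * rho ^+ 2))) <= 2 / (p * K)%:R.
    by rewrite lnpK natrM mulrAC mulrC ler_wpM2l.
  (* By [half_sample] the exponent (n - n1) (2 rho)^2 is at least 2 n rho^2 = 2 log(pK); one of the
     two factors (pK)^{-1} pays for the [K] candidates. *)
  have ecv : (J * K)%:R * (4 * expR (- ((n - n1)%:R * (2 * rho) ^+ 2))) <= 4 * J%:R / (p * K)%:R.
    apply: (@le_trans _ _ ((J * K)%:R * (4 * expR (- (2 * (n%:R * rho ^+ 2)))))).
      rewrite ler_wpM2l// ler_wpM2l// ler_expR lerN2.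
      rewrite mulrA exprMn (_ : 2 ^+ 2 = 2 * 2 :> R) -?expr2// (mulrA _ (2 * 2)).
      rewrite ler_wpM2r ?sqr_ge0// mulrCA mulrA -mulrA ler_wpM2l// mulrC.
      exact: half_sample.
    rewrite lnpK natrM (_ : J%:R * _ * _ = 4 * J%:R * (K%:R * ((p * K)%:R ^+ 2)^-1)); last by ring.
    by rewrite ler_wpM2l// mulr_ge0.
  have e1 := eup p ppK; have e2 := eup K KpK.
  rewrite (_ : (4 * J%:R + 2) / _ = 4 * J%:R / (p * K)%:R + 2 / (p * K)%:R); last by rewrite mulrDl.
  apply: (le_trans (lerD ecv (lerD ebern (lerD e1 (lerD e2 (lerD elow (lerD e3 e3))))))).
  by rewrite le_eqVlt; apply/orP; left; apply/eqP; ring.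
move=> o nbad a aD.
have nb1 lk : (lnorm 2 (bcv lk.1 lk.2 o - bs lk.2) <= rateT2 A bs n q C0 (2 * rho))%R /\
    (lnorm 1 (bcv lk.1 lk.2 o - bs lk.2) <= rateT1 A bs n q C0 (2 * rho))%R.
  by apply: contrapT => h; apply: nbad; left; exists lk.
have nb2 (ks : 'I_K * bool) : Ex (fun w => zeta (Z i1 w) * dotv ((-1) ^+ ks.2 *: bs ks.1) (xv (Z i1 w)))
     - 34 * rho * taub * lnorm 2 (bs ks.1)
   <= avg (fun i => zeta (Z i o) * dotv ((-1) ^+ ks.2 *: bs ks.1) (xv (Z i o))).
  by rewrite leNgt; apply/negP => h; apply: nbad; right; left; exists ks.
have nb3 (s : {ffun 'I_N -> 'I_p * bool}) : avg (fun i => dotv (grid_point (@unit_vector R p) s) (X i o) ^+ 2)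
    <= (4 * Kx) ^+ 2 * lnorm 2 (grid_point (N := N) (@unit_vector R p) s) ^+ 2.
  by rewrite leNgt; apply/negP => h; apply: nbad; do 2 right; left; exists s.
have nb4 (s : {ffun 'I_N -> 'I_K * bool}) : avg (fun i => dotv (grid_point bs s) (X i o) ^+ 2)
    <= (4 * Kx) ^+ 2 * lnorm 2 (grid_point (N := N) bs s) ^+ 2.
  by rewrite leNgt; apply/negP => h; apply: nbad; do 3 right; left; exists s.
have nb5 (s : {ffun 'I_N -> 'I_K * bool}) : kl / 4 * lnorm 2 (grid_point (N := N) bs s) ^+ 2 <=
   avg (fun i => dotv (grid_point bs s) (X i o) ^+ 2
       * (`|dotv (grid_point bs s) (X i o)| <= M / 8)%R%:R
       * (`|dotv (mxcols bs *m ws) (X i o)| <= M / 8)%R%:R).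
  by rewrite leNgt; apply/negP => h; apply: nbad; do 4 right; left; exists s.
have nb6 : avg (fun i => g0 (Z i o) ^+ 2) <= 4 * (2 * Ky) ^+ 2.
  by rewrite leNgt; apply/negP => /ltW h; apply: nbad; do 5 right; left.
have nb7 : avg (fun i => ustar (Z i o) ^+ 2) <= 4 * (2 * Kx * Kb) ^+ 2.
  by rewrite leNgt; apply/negP => /ltW h; apply: nbad; do 6 right.
clear nbad Bcv Bbern Bup BupK Blow Bg Bu mbad Pbad.
have [whS whmin] := whatP o.
have rho_h2 : rho * h_u bs 2 <= (1 + Kb) * rateT bs n q.
  by apply: rho_h_u2_le => //; exact: ltW.
have h2K : h_u bs 2 <= Kb by apply: h_u2_le => //; exact: ltW.
have h20 : 0 <= h_u bs 2 by exact: h_u_ge0.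
have T2le := @rateT2_le R p K n A bs q C0 q01 pK0 C00.
have T1le := @rho_rateT1_le R p K n A bs q C0 q01 pK0 C00.
have base0 : 0 <= base_rate A n (2 * rho) by rewrite addr_ge0 ?sqrtr_ge0// ltW.
have T20 : 0 <= rateT2 A bs n q C0 (2 * rho).
  have C00' := ltW C00; rewrite /rateT2; case: ifP => _; apply: mulr_ge0 => //;
  by rewrite ?powR_ge0//; apply: mulr_ge0; rewrite ?powR_ge0 ?sqrtr_ge0.
have T10 : 0 <= rateT1 A bs n q C0 (2 * rho).
  have C00' := ltW C00; rewrite /rateT1; case: ifP => _; apply: mulr_ge0 => //;
  by rewrite ?powR_ge0//; apply: mulr_ge0; rewrite ?powR_ge0.
have B0 : 0 <= 4 * Kx by rewrite mulr_ge0// ltW.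
have Zg0 : 0 <= 3 * (2 * Ky + Lu * (2 * Kx * Kb)).
  by rewrite mulr_ge0// addr_ge0// ?mulr_ge0// ltW// !mulr_gt0.
have tau0 : 0 <= At * rateT bs n q by rewrite mulr_ge0.
(* From zeta^2 <= 2 g0^2 + 2 Lu^2 ustar^2, each second moment carrying a factor 4; 2 * 4 is at most
   3^2. *)
have hZg : avg (fun i => G (Y i o) (dotv (mxcols bs *m ws) (X i o)) ^+ 2)
    <= (3 * (2 * Ky + Lu * (2 * Kx * Kb))) ^+ 2.
  apply: (@le_trans _ _ (2 * avg (fun i => g0 (Z i o) ^+ 2)
      + 2 * Lu ^+ 2 * avg (fun i => ustar (Z i o) ^+ 2))).
    rewrite -!avgZ -avgD; apply: ler_avg => i; have := zeta_le (Z i o).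
    rewrite -/(zeta (Z i o)) -(real_normK (num_real (zeta _))).
    rewrite -(real_normK (num_real (g0 _))) -(real_normK (num_real (ustar _))).
    move: (`|zeta _|) (`|g0 _|) (`|ustar _|) (normr_ge0 (zeta (Z i o))) => z g u z0 zgu.
    apply: (@le_trans _ _ ((g + Lu * u) ^+ 2)).
      by rewrite lerXn2r ?nnegrE// (le_trans z0).
    exact: sqr_add_le.
  have h1 := ler_wpM2l (ler0n R 2) nb6.
  have c1 : 0 <= 2 * Lu ^+ 2 by rewrite mulr_ge0// sqr_ge0.
  have h2 := ler_wpM2l c1 nb7; apply: (le_trans (lerD h1 h2)).
  exact: (sqr_add_ge (ltW tg) (ltW tu) (ltW Lu0)).
have hbern k : `|avg (fun i => G (Y i o) (dotv (mxcols bs *m ws) (X i o)) * dotv (bs k) (X i o))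
    - center k| <= 34 * rho * taub * h_u bs 2.
  have c1 : 34 * rho * taub * lnorm 2 (bs k) <= 34 * rho * taub * h_u bs 2.
    apply: ler_wpM2l; last exact: lnorm2_le_h_u.
    by apply: mulr_ge0; [apply: mulr_ge0 => //; exact: ltW|exact: ltW].
  (* The two signs give the two sides of the deviation. *)
  have p1 := nb2 (k, false); have p2 := nb2 (k, true).
  rewrite /= expr0 scale1r in p1.
  have e1 : avg (fun i => zeta (Z i o) * dotv ((-1) ^+ true *: bs k) (xv (Z i o))) =
      - avg (fun i => zeta (Z i o) * dotv (bs k) (xv (Z i o))).
    rewrite -[RHS]mulN1r -avgZ; apply: eq_avg => i.
    by rewrite expr1 scaleN1r -[- bs k]scaleN1r dotvZl; ring.
  have e2 : Ex (fun w => zeta (Z i1 w) * dotv ((-1) ^+ true *: bs k) (xv (Z i1 w))) =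
      - center k.
    rewrite -[RHS]mulN1r -RintegralZl//; apply: eq_Rintegral => w _.
    by rewrite expr1 scaleN1r -[- bs k]scaleN1r dotvZl; ring.
  rewrite /= e1 e2 in p2.
  exact: (distr_le_margin p1 p2 c1).
(* 1 / N <= 2 rho^2 / c4, then rho T1 <= 3 C0 T^2, and T^4 <= T^2 because T <= 1. *)
have T1sq : rateT1 A bs n q C0 (2 * rho) ^+ 2 / N%:R <= 18 * C0 ^+ 2 / c4 * rateT bs n q ^+ 2.
  apply: (@le_trans _ _ (rateT1 A bs n q C0 (2 * rho) ^+ 2 * (2 * rho ^+ 2 / c4))).
    by rewrite ler_wpM2l ?sqr_ge0.
  have h : (rho * rateT1 A bs n q C0 (2 * rho)) ^+ 2 <= (3 * C0 * rateT bs n q ^+ 2) ^+ 2.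
    by rewrite lerXn2r ?nnegrE// ?mulr_ge0 ?sqr_ge0// ltW.
  have h' : rateT bs n q ^+ 2 * rateT bs n q ^+ 2 <= rateT bs n q ^+ 2.
    rewrite -[leRHS]mulr1 ler_wpM2l ?sqr_ge0//.
    by rewrite -[leRHS](expr1n R 2) lerXn2r ?nnegrE.
  rewrite mulrA; exact: (sqr_rate_le c40 h h').
have htau : J%:R * ((4 * Kx) ^+ 2 * (rateT2 A bs n q C0 (2 * rho) ^+ 2
     + rateT1 A bs n q C0 (2 * rho) ^+ 2 / N%:R)) <= (At * rateT bs n q) ^+ 2.
  apply: (@le_trans _ _ (J%:R * ((4 * Kx) ^+ 2 * (9 * C0 ^+ 2 * rateT bs n q ^+ 2
     + 18 * C0 ^+ 2 / c4 * rateT bs n q ^+ 2)))).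
    apply: ler_wpM2l => //; apply: ler_wpM2l; first exact: sqr_ge0.
    apply: lerD => //; rewrite (_ : 9 * C0 ^+ 2 * _ = (3 * C0 * rateT bs n q) ^+ 2).
      by rewrite lerXn2r ?nnegrE// ?mulr_ge0// ltW.
    by move: (rateT bs n q) => t; ring.
  rewrite [leRHS]exprMn; apply: (le_trans _ (ler_wpM2r (sqr_ge0 (rateT bs n q)) hAt)).
  by rewrite le_eqVlt; apply/orP; left; apply/eqP; ring.
have := @prediction_bound R p n J K N n1 (X ^~ o) (fun i => L (Y i o)) (fun i => G (Y i o))
  (fun i => derive1 (G (Y i o))) Lu kappa M (fun i => loss_is_derive smoothL (Y i o))
  (fun i => dloss_is_derive smoothL (Y i o)) (fun i => d2loss_ge0 smoothL (Y i o))
  (fun i => Hk (Y i o)) (fun i => dloss_lipschitz smoothL (Y i o)) M0 kap0 Lu0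
  I bs (fun l k => bcv l k o) (what o) ws center (4 * Kx)
  (rateT1 A bs n q C0 (2 * rho)) (rateT2 A bs n q C0 (2 * rho)) (At * rateT bs n q)
  (h_u bs 2) (3 * (2 * Ky + Lu * (2 * Kx * Kb))) (34 * rho * taub * h_u bs 2) kl a
  N0 B0 T10 T20 tau0 Zg0 kl0 folds whS wsS (lnorm2_le_h_u bs) nb3 nb4 nb5 hbern
  (center_ge0 whS) hZg (fun l k => nb1 (l, k)) htau (whmin ws wsS) aD.
have a0 : 0 <= a by rewrite aD lnorm_ge0.
have a2 : a <= 2 by rewrite aD; exact: lnorm1_simplex_sub.
have ic0 : 0 <= c4^-1 by rewrite invr_ge0 ltW.
have Zg0' : 0 <= 2 * Ky + Lu * (2 * Kx * Kb).
  by rewrite addr_ge0// ?mulr_ge0// ltW// !mulr_gt0.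
have a02 : 0 <= a <= 2 by rewrite a0.
have t01 : 0 <= rateT bs n q <= 1 by rewrite T0.
have h0K : 0 <= h_u bs 2 <= Kb by rewrite h20.
have r01 : 0 <= rho <= 1 by rewrite r1 ltW.
move=> H; exact: (rate_bound (ltW kap0) B0 ic0 (ltW Kb0) Zg0 At0 (ltW Lu0) (ltW tb0)
  a02 t01 h0K r01 rho_h2 Ninv H).
Qed.

End GoodEvent.

(** * The oracle inequality *)

(** The first alternative is absorbed by the second term of the bound, the other by the first term;
    all terms are nonnegative extended reals. *)
Lemma oracle_bound_le (R : realType) (a b s T Psi C1 : R) (phi : \bar R) :
  0 <= b -> 0 <= s -> 0 <= T -> 4 <= C1 -> (0 <= phi)%E ->
  a <= 4 * b \/ (exists2 r, phi = r%:E & 0 < r /\ a * r <= C1 * s * T) ->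
  (a%:E <= C1%:E * (s%:E / phi) * T%:E + C1%:E * b%:E
     + C1%:E * sqrte ((s%:E / phi) * Psi%:E * b%:E))%E.
Proof.
move=> b0 s0 T0 C14 phi0 h; have C10 : 0 <= C1 by exact: le_trans C14.
have sq0 : (0 <= C1%:E * sqrte ((s%:E / phi) * Psi%:E * b%:E))%E.
  by rewrite mule_ge0 ?lee_fin// sqrte_ge0.
apply: le_trans (leeDl _ sq0).
case: h => [ab|[r -> [r0 hr]]].
  have ratio0 : (0 <= C1%:E * (s%:E / phi) * T%:E)%E by rewrite !mule_ge0 ?lee_fin// inve_ge0.
  apply: le_trans (leeDr _ ratio0); rewrite -EFinM lee_fin.
  by apply: (le_trans ab); exact: ler_wpM2r.
have Cb0 : (0 <= C1%:E * b%:E)%E by rewrite mule_ge0 ?lee_fin.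
apply: le_trans (leeDl _ Cb0).
rewrite inver gt_eqF// -!EFinM lee_fin.
rewrite (_ : C1 * _ * _ = C1 * s * T / r); last by ring.
by rewrite ler_pdivlMr.
Qed.

Section OracleInequality.
Variables (R : realType) (p K n : nat) (bs : 'I_K -> 'cV[R]_p) (q Kb c2 : R).
Hypotheses (q01 : 0 <= q <= 1).
Hypotheses (Kb0 : 0 <= Kb) (bsK : forall k, lnorm 2 (bs k) <= Kb) (c20 : 0 < c2).
Variables (w ws : 'cV[R]_K) (S : {set 'I_K}).
Hypotheses (ww : simplex w) (wws : simplex ws) (S0 : S != finset.set0).
Hypothesis hS : (#|S|%:R%:E <= c2%:E * phi2 bs S ws * ((ratePsi bs n q)%:E)^-1)%E.
Let a := lnorm 1 (w - ws).
Let b := lnorm 1 (vrestr (~: S) ws).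

(** For nonempty [S] the restriction on |S| forces a positive compatibility factor. *)
Lemma compatibility_pos : 4 * b < a ->
  exists2 r, phi2 bs S ws = r%:E &
    [/\ 0 < r, r * a ^+ 2 <= 16 * #|S|%:R * lnorm 2 (mxcols bs *m (w - ws)) ^+ 2
      & #|S|%:R * ratePsi bs n q <= c2 * r].
Proof.
move=> /(phi2_simplex_le bs ww wws)[r phiE [r0 hr]]; exists r => //.
have cS : 0 < #|S|%:R :> R by rewrite ltr0n card_gt0.
have Psi0 := ratePsi_ge0 n bs q.
(* If [r = 0], the right-hand side of [hS] is 0 whatever the inverse of the rate is, whereas |S| >=
   1. *)
have := hS; rewrite phiE; have [re|rn0] := eqVneq r 0.
  by rewrite re mule0 mul0e lee_fin leNgt cS.
have rp : 0 < r by rewrite lt_neqAle eq_sym rn0.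
have [->|Pn0] := eqVneq (ratePsi bs n q) 0; first by split; rewrite // mulr0 mulr_ge0 ?ltW.
rewrite inver (negPf Pn0) -!EFinM lee_fin => h; split => //.
by rewrite -ler_pdivlMr// lt_neqAle eq_sym Pn0.
Qed.

(** With h2 the largest l2 norm of a candidate, ||B* D||_2 <= a h2 gives phi^2 <= 16 |S| h2^2, so
    the restriction on |S| becomes Psi <= 16 c2 h2^2. *)
Lemma rho_le_of_compatibility : 4 * b < a ->
  Num.sqrt (ln (p * K)%:R / n%:R) <= 16 * c2 * (1 + Kb) ^+ 2 :> R.
Proof.
move=> ba; have [r _ [r0 hr hPsi]] := compatibility_pos ba.
have cS : 0 < #|S|%:R :> R by rewrite ltr0n card_gt0.
have a0 : 0 < a by apply: le_lt_trans ba; rewrite mulr_ge0 ?lnorm_ge0.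
have h20 := h_u_ge0 bs 2.
have hD : lnorm 2 (mxcols bs *m (w - ws)) <= a * h_u bs 2.
  rewrite mulmx_cols /a lnorm1E; apply: lnorm2_comb_le => // k.
  exact: lnorm2_le_h_u.
have hD2 : lnorm 2 (mxcols bs *m (w - ws)) ^+ 2 <= a ^+ 2 * h_u bs 2 ^+ 2.
  by rewrite -exprMn lerXn2r ?nnegrE ?lnorm_ge0// mulr_ge0// ltW.
have c16 : 0 <= 16 * #|S|%:R :> R by rewrite mulr_ge0// ltW.
have := le_trans hr (ler_wpM2l c16 hD2).
rewrite (mulrC r) (mulrCA (16 * _)) ler_pM2l ?exprn_gt0// => hr2.
have hp : 0 < h_u bs 2.
  rewrite lt_neqAle h20 andbT; apply/eqP => e.
  by move: hr2; rewrite -e expr0n mulr0 leNgt r0.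
have c16' : 0 < 16 * c2 by rewrite mulr_gt0.
apply: (rho_le_of_ratePsi (n := n) q01 bsK Kb0 hp c16').
rewrite -(ler_pM2l cS); apply: (le_trans hPsi).
apply: (le_trans (ler_wpM2l (ltW c20) hr2)).
by rewrite le_eqVlt; apply/orP; left; apply/eqP; ring.
Qed.

(** In phi^2 a^2 <= 16 |S| C6 a T one factor a cancels. *)
Lemma weight_error_le (C1 C6 : R) : 4 <= C1 -> 16 * C6 <= C1 ->
  (4 * b < a -> lnorm 2 (mxcols bs *m (w - ws)) ^+ 2 <= C6 * (a * rateT bs n q)) ->
  (a%:E <= C1%:E * (#|S|%:R%:E / phi2 bs S ws) * (rateT bs n q)%:E
     + C1%:E * b%:E
     + C1%:E * sqrte ((#|S|%:R%:E / phi2 bs S ws) * (ratePsi bs n q)%:E * b%:E))%E.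
Proof.
move=> C14 C16 hD.
have T0 := rateT_ge0 n bs q; have b0 : 0 <= b := lnorm_ge0 _ _.
have a0 : 0 <= a := lnorm_ge0 _ _.
apply: oracle_bound_le => //; first exact: phi2_ge0.
have [ab|ba] := leP a (4 * b); [by left|right].
have [r phiE [r0 hr _]] := compatibility_pos ba; exists r; first exact: phiE.
split; first exact: r0.
have ap : 0 < a by apply: le_lt_trans ba; exact: (mulr_ge0 (ler0n R 4) b0).
have c16 : 0 <= 16 * #|S|%:R :> R by rewrite mulr_ge0.
have := le_trans hr (ler_wpM2l c16 (hD ba)).
move: (rateT bs n q) T0 a ap => T T0 a' ap.
rewrite (_ : r * a' ^+ 2 = a' * (a' * r)); last by ring.
rewrite (_ : 16 * _ * _ = a' * (16 * C6 * (#|S|%:R * T))); last by ring.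
rewrite ler_pM2l// => h.
rewrite -mulrA; apply: (le_trans h); apply: ler_wpM2r => //.
by rewrite mulr_ge0.
Qed.

End OracleInequality.

(* There is no unit vector, so the supremum is over the empty set. *)
Lemma psi2_vnorm0 (R : realType) d (Omega : measurableType d) (P : probability Omega R)
    (V : Omega -> 'cV[R]_0) :
  psi2_vnorm P V = -oo%E.
Proof.
rewrite /psi2_vnorm (_ : [set v | _] = set0) ?image_set0 ?ereal_sup0//.
apply/seteqP; split => // v /=.
by rewrite /lnorm big_ord0 powR0 ?invr_eq0// => /eqP; rewrite eq_sym oner_eq0.
Qed.

(** Both conditions are deterministic, so the uniform event is a finite intersection. *)
Lemma measurable_forall_le (R : realType) d (T : measurableType d) (I : finType)
    (Q1 Q2 : I -> Prop) (f : T -> R) (c : I -> \bar R) :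
  measurable_fun setT f ->
  measurable [set w | forall i, Q1 i -> Q2 i -> ((f w)%:E <= c i)%E].
Proof.
move=> mf; rewrite (_ : [set w | _] = \bigcap_(i in [set i | Q1 i /\ Q2 i])
    [set w | ((f w)%:E <= c i)%E]); last first.
  apply/seteqP; split => w /= h i; first by move=> [h1 h2]; exact: h.
  by move=> h1 h2; exact: h.
apply: fin_bigcap_measurable; first exact: finite_finset.
move=> i _; rewrite -[X in measurable X]setTI.
by apply: emeasurable_fun_le => //; apply/measurable_EFinP.
Qed.

(* M / 8 is a truncation level, c4 bounds N rho^2 for the size N of the averages, tb is
   the Bernstein scale of the scores, and At times the rate bounds the fold prediction errors. *)
Lemma exists_constants (R : realType) (J : nat) (Lu Kx Ky kl Kb C0 : R) :
  0 < Lu -> 0 < Kx -> 0 < Ky -> 0 < kl -> 0 < Kb -> 0 < C0 ->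
  exists M c4 tb At : R,
    [/\ 0 < M,
        ((8 * Kb ^+ 2 + 4) * (2 * Kx) ^+ 4 + 4 * (2 * Kx * Kb) ^+ 4) / (M / 8) ^+ 2 <= kl / 2,
        [/\ 0 < c4, c4 <= 1 / 4 & 4 * c4 <= kl ^+ 2 / (512 * (2 * Kx) ^+ 4)],
        [/\ 0 < tb, 3 * (2 * Kx) ^+ 2 <= tb, 3 * (2 * Ky) ^+ 2 <= tb
          & 3 * (Lu ^+ 2 * (2 * Kx * Kb) ^+ 2) <= tb]
      & 0 <= At /\
        J%:R * ((4 * Kx) ^+ 2 * (9 * C0 ^+ 2 + 18 * C0 ^+ 2 / c4)) <= At ^+ 2].
Proof.
move=> Lu0 Kx0 Ky0 kl0 Kb0 C00.
set S4 := _ + 4 * _.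
have S40 : 0 <= S4.
  apply: addr_ge0; apply: mulr_ge0 => //; first by apply: addr_ge0 => //; rewrite mulr_ge0 ?sqr_ge0.
    by rewrite exprn_ge0// mulr_ge0// ltW.
  by rewrite exprn_ge0// !mulr_ge0// ltW.
clearbody S4.
have Mg0 : 0 <= 2 * S4 / kl by rewrite divr_ge0 ?(ltW kl0)// mulr_ge0.
pose c3 := kl ^+ 2 / (512 * (2 * Kx) ^+ 4).
have c30 : 0 < c3.
  apply: divr_gt0; first exact: exprn_gt0.
  by apply: mulr_gt0; [rewrite ltr0n|apply: exprn_gt0; exact: mulr_gt0].
pose c4 := Num.min (c3 / 4) (1 / 4).
have c40 : 0 < c4 by rewrite lt_min divr_gt0//= divr_gt0.
pose E := J%:R * ((4 * Kx) ^+ 2 * (9 * C0 ^+ 2 + 18 * C0 ^+ 2 / c4)).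
have E0 : 0 <= E.
  apply: mulr_ge0 => //; apply: mulr_ge0; first exact: sqr_ge0.
  apply: addr_ge0; first by rewrite mulr_ge0 ?sqr_ge0.
  by rewrite divr_ge0 ?(ltW c40)// mulr_ge0 ?sqr_ge0.
have u1 : 0 < 3 * (2 * Kx) ^+ 2 by rewrite mulr_gt0// exprn_gt0// mulr_gt0.
have u2 : 0 < 3 * (2 * Ky) ^+ 2 by rewrite mulr_gt0// exprn_gt0// mulr_gt0.
have u3 : 0 <= 3 * (Lu ^+ 2 * (2 * Kx * Kb) ^+ 2).
  by apply: mulr_ge0 => //; apply: mulr_ge0; exact: sqr_ge0.
exists (8 * (1 + 2 * S4 / kl)), c4,
  (3 * (2 * Kx) ^+ 2 + 3 * (2 * Ky) ^+ 2 + 3 * (Lu ^+ 2 * (2 * Kx * Kb) ^+ 2)), (Num.sqrt E).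
have Mg1 : 0 < 1 + 2 * S4 / kl by rewrite ltr_wpDr.
split; first by rewrite mulr_gt0.
- rewrite (mulrC 8) mulfK ?pnatr_eq0// ler_pdivrMr ?exprn_gt0//.
  apply: (@le_trans _ _ (kl / 2 * (1 + 2 * S4 / kl))).
    rewrite (_ : kl / 2 * _ = kl / 2 + S4); last by field; rewrite gt_eqF.
    by rewrite lerDr divr_ge0// ltW.
  apply: ler_wpM2l; first by rewrite divr_ge0// ltW.
  by rewrite expr2 ler_peMl ?(ltW Mg1)// lerDl.
- split=> //; first by rewrite ge_min lexx orbT.
  by rewrite mulrC -ler_pdivlMr// ge_min lexx.
- move: u1 u2 u3.
  move: (3 * (2 * Kx) ^+ 2) (3 * (2 * Ky) ^+ 2) (3 * (Lu ^+ 2 * (2 * Kx * Kb) ^+ 2)).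
  by clear; move=> a b c a0 b0 c0; split; lra.
- by rewrite sqrtr_ge0 sqr_sqrtr.
Qed.
Theorem theorem3
  (R : realType)
  (dY dE : measure_display) (calY : measurableType dY) (calE : measurableType dE)
  (g : R -> calE -> calY) (L : calY -> R -> R) (r : R -> R -> R) (J : nat)
  (q L_u K_x K_y kappa_l K_beta C0 : R) :
  0 <= q <= 1 -> (2 <= J)%N ->
  0 < L_u -> 0 < K_x -> 0 < K_y -> 0 < kappa_l -> 0 < K_beta -> 0 < C0 ->
  (forall mu, measurable_fun setT (fun y => L y mu)) ->
  convex_loss L ->
  smooth_loss L L_u ->
  exists c c1 c2 C1 C2 : R,
    [/\ 0 < c, 0 < c1, 0 < c2, 0 < C1 & 0 < C2] /\
  forall (n n1 p K : nat) (hn : (0 < n)%N)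
    (dO : measure_display) (Omega : measurableType dO)
    (P : probability Omega R)
    (x : 'I_n -> Omega -> covariates R) (eps : 'I_n -> Omega -> calE)
    (Y : 'I_n -> Omega -> calY)
    (beta : nat -> R) (eta : 'I_n -> Omega -> R)
    (A : 'I_K -> {set 'I_p}) (I : 'I_J -> {set 'I_n})
    (lam : 'I_K -> R) (lamcv : 'I_J -> 'I_K -> R)
    (bhat : 'I_K -> Omega -> 'cV[R]_p)
    (bcv : 'I_J -> 'I_K -> Omega -> 'cV[R]_p)
    (what : Omega -> 'cV[R]_K) (bs : 'I_K -> 'cV[R]_p),
  let X i omega := first_covariates p (x i omega) in
  let i1 := Ordinal hn in
  (* data *)
  iid P (fun i omega => (Y i omega, x i omega)) ->
  (forall i, measurable_fun setT (eps i)) ->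
  (forall i, independent2 P (eps i) (x i)) ->
  (forall i, linear_predictor P beta (x i) (eta i)) ->
  (forall i omega, Y i omega = g (eta i omega) (eps i omega)) ->
  true_parameter L P (Y i1) (x i1) beta (eta i1) ->
  (forall b : 'cV[R]_p,
     finite_eloss L P (Y i1) (fun omega => dotv b (X i1 omega))) ->
  (* candidate models, folds, estimators and weights *)
  (forall k, random_vector (bhat k)) ->
  (forall k omega,
     argmin (supported (A k))
       (penalized_loss L (Y ^~ omega) (X ^~ omega) [set: 'I_n]%SET (r (lam k)))
       (bhat k omega)) ->
  equal_folds n1 I ->
  (forall m k, random_vector (bcv m k)) ->
  (forall m k omega,
     argmin (supported (A k))
       (penalized_loss L (Y ^~ omega) (X ^~ omega) (~: I m)%SET (r (lamcv m k)))
       (bcv m k omega)) ->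
  random_vector what ->
  (forall omega,
     argmin (@simplex R K)
       (CV L (Y ^~ omega) (X ^~ omega) I
          (fun m => mxcols (fun k => bcv m k omega)))
       (what omega)) ->
  (forall k, argmin (supported (A k)) (risk L P (Y i1) (X i1)) (bs k)) ->
  (* condition (ii) *)
  psi2_vnorm P (X i1) = K_x%:E ->
  psi2_norm P (fun omega => derive1 (L (Y i1 omega)) 0) = K_y%:E ->
  kappa_l <= lambda_min (covariance_matrix P (X i1)) ->
  (* condition (iii) *)
  (forall k, lnorm 2 (bs k) <= K_beta) ->
  (forall k (delta : R), 0 < delta < 1 ->
     ((1 - 4 * expR (- (n%:R * delta ^+ 2)))%:E <=
      P [set omega |
           (lnorm 2 (bhat k omega - bs k) <= rateT2 A bs n q C0 delta)%R /\
           (lnorm 1 (bhat k omega - bs k) <= rateT1 A bs n q C0 delta)%R])%E) ->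
  (forall k m (delta : R), 0 < delta < 1 ->
     ((1 - 4 * expR (- ((n - n1)%:R * delta ^+ 2)))%:E <=
      P [set omega |
           (lnorm 2 (bcv m k omega - bs k) <= rateT2 A bs n q C0 delta)%R /\
           (lnorm 1 (bcv m k omega - bs k) <= rateT1 A bs n q C0 delta)%R])%E) ->
  rateT bs n q <= c1 ->
  forall ws : 'cV[R]_K,
  argmin (@simplex R K)
    (fun w => risk L P (Y i1) (X i1) (mxcols bs *m w)) ws ->
  ((1 - C2 / (p * K)%:R - C2 * expR (- (c * n%:R)))%:E <=
   P [set omega | forall S : {set 'I_K}, S != finset.set0 ->
        (#|S|%:R%:E <= c2%:E * phi2 bs S ws * ((ratePsi bs n q)%:E)^-1)%E ->
        ((lnorm 1 (what omega - ws)%R)%:E <=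
           C1%:E * (#|S|%:R%:E / phi2 bs S ws) * (rateT bs n q)%:E
         + C1%:E * (lnorm 1 (vrestr (~: S) ws))%:E
         + C1%:E * sqrte ((#|S|%:R%:E / phi2 bs S ws) * (ratePsi bs n q)%:E
                          * (lnorm 1 (vrestr (~: S) ws))%:E))%E])%E.
Proof.
move=> q01 J2 Lu0 Kx0 Ky0 kl0 Kb0 C00 measL _ smoothL.
have [M [c4 [tb [At [M0 hM [c40 c4q c43] [tb0 tb1 tb2 tb3] [At0 hAt]]]]]] :=
  exists_constants J Lu0 Kx0 Ky0 kl0 Kb0 C00.
have M20 : 0 < 2 * M by rewrite mulr_gt0.
have [kap kap0 Hk] := d2loss_lower smoothL M20.
(* [rho <= c5] gives [rho <= 1 / 4] and then [rho ^+ 2 <= rho <= c4]. *)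
pose c5 := Num.min (1 / 4) c4.
have c50 : 0 < c5 by rewrite lt_min c40 andbT divr_gt0.
(* The factor of [rho_le_of_compatibility]: with c2 = c5 / D its conclusion is exactly
   [rho <= c5]. *)
pose D := 16 * (1 + K_beta) ^+ 2.
have D0 : 0 < D by rewrite mulr_gt0// exprn_gt0// addr_gt0.
pose K6 := kap / 4 * (16 * (4 * K_x) ^+ 2 / c4 * ((1 + K_beta) * K_beta))
        + (34 * tb * (1 + K_beta) + 3 * (2 * K_y + L_u * (2 * K_x * K_beta)) * At
           + L_u * (At * (2 * (2 * (4 * K_x) * K_beta + At)))
           + kap / 2 * (2 * At ^+ 2 + 1 / 2 * (2 * (4 * K_x) * K_beta * At))).
pose C6 := K6 / (kap * kappa_l / 32).
have kk0 : 0 < kap * kappa_l / 32 by rewrite divr_gt0// mulr_gt0.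
pose C1 := 4 + `|16 * C6|.
have C14 : 4 <= C1 by rewrite lerDl.
have C16 : 16 * C6 <= C1 by rewrite (le_trans (ler_norm _))// lerDr.
have c20 : 0 < c5 / D by rewrite divr_gt0.
(* c1 = 1 because surplus factors of the rate are bounded by 1; 4 J + 5 dominates both 4 J + 2 and 5
   in [good_event]. *)
exists (2 * c4), 1, (c5 / D), C1, (4 * J%:R + 5); split.
  split; [exact: mulr_gt0|exact: ltr01|exact: c20|exact: lt_le_trans C14|].
  by rewrite ltr_wpDl// mulr_ge0.
move=> n n1 p K hn dO Omega P x eps Y beta eta A I lam lamcv bhat bcv what bs X i1.
move=> iidYx _ _ _ _ _ finL _ _ folds mbcv _ mwhat whatP _ psiX psiY lminX bsK _ cv_rate.
move=> T1 ws wsP.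
have wsS : simplex ws by case: wsP.
set E := [set w | _].
have mE : measurable E.
  apply: measurable_forall_le; apply: measurable_lnorm.
  exact: random_vector_subc.
have K0 : (0 < K)%N.
  rewrite lt0n; apply/eqP => K0; move: (wsS.2); rewrite big1; last first.
    by move=> [k kK]; exfalso; move: kK; rewrite K0.
  by move=> /eqP; rewrite eq_sym oner_eq0.
(* For [p = 0] the vector norm is -oo, which differs from the real [K_x]. *)
have p0 : (0 < p)%N.
  rewrite lt0n; apply/eqP => p0; move: (X) psiX; clear -p0.
  by rewrite p0 => V; rewrite psi2_vnorm0.
have C20 : 0 <= 4 * J%:R + 5 :> R by rewrite addr_ge0// mulr_ge0.
(* For pK = 1 the claimed lower bound is at most 0; otherwise log(pK) > 0, so rho > 0. *)
have [pK2|pK1] := leqP 2 (p * K); last first.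
  have -> : (p * K = 1)%N by apply/eqP; rewrite eqn_leq -ltnS pK1 muln_gt0 p0.
  apply: (@le_trans _ _ 0%E); last exact: measure_ge0.
  rewrite lee_fin divr1 subr_le0 lerBlDr; apply: (@le_trans _ _ (4 * J%:R + 5)).
    by rewrite -[leLHS]add0r lerD// ?mulr_ge0// ler1n.
  by rewrite lerDr mulr_ge0// expR_ge0.
have pK0 : (0 < p * K)%N by exact: ltnW.
have rho0 : 0 < Num.sqrt (ln (p * K)%:R / n%:R) :> R.
  by rewrite sqrtr_gt0 divr_gt0 ?ltr0n// ln_gt0// ltr1n.
have whS o : simplex (what o) by case: (whatP o).
have c2E : 16 * (c5 / D) * (1 + K_beta) ^+ 2 = c5.
  by rewrite (mulrAC 16) -/D mulrC divfK// gt_eqF.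
pose rho : R := Num.sqrt (ln (p * K)%:R / n%:R).
have rho_c5 o (S : {set 'I_K}) : S != finset.set0 ->
    (#|S|%:R%:E <= (c5 / D)%:E * phi2 bs S ws * ((ratePsi bs n q)%:E)^-1)%E ->
    4 * lnorm 1 (vrestr (~: S) ws) < lnorm 1 (what o - ws) -> rho <= c5.
  move=> S0 hS h; rewrite -[leRHS]c2E.
  exact: (rho_le_of_compatibility q01 (ltW Kb0) bsK c20 (whS o) wsS S0 hS h).
(* For [rho > c5] every outcome satisfies the bound, since [rho_c5] excludes the case left to
   [weight_error_le]. *)
have [rc|rc] := leP rho c5; last first.
  rewrite (_ : E = setT) ?probability_setT.
    rewrite lee_fin -addrA -opprD gerBl.
    by rewrite addr_ge0// ?divr_ge0// mulr_ge0// expR_ge0.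
  apply/seteqP; split => // o _ S S0 hS.
  apply: (weight_error_le c20 (whS o) wsS S0 hS C14 C16) => h.
  by have := rho_c5 o S S0 hS h; rewrite leNgt rc.
have r4 : rho <= 1 / 4 by apply: (le_trans rc); rewrite ge_min lexx.
have rc4 : rho ^+ 2 <= c4.
  apply: (@le_trans _ _ rho).
    rewrite expr2 -[leRHS]mul1r ler_wpM2r ?(ltW rho0)//; move: r4; clear; lra.
  by apply: (le_trans rc); rewrite ge_min lexx orbT.
have [bad [mbad Pbad hbad]] := good_event q01 J2 Lu0 Kx0 Ky0 kl0 Kb0 C00 measL smoothL iidYx
  finL folds mbcv whatP psiX psiY lminX bsK cv_rate wsP M0 kap0 Hk hM c40 c4q c43 tb0 tb1 tb2
  tb3 At0 hAt rho0 r4 rc4 pK2 T1.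
apply: (@le_trans _ _ (P (~` bad))).
  rewrite probability_setC// -addrA -opprD EFinB leeB//.
  apply: (le_trans Pbad); rewrite lee_fin; apply: lerD.
    by rewrite ler_wpM2r ?invr_ge0// lerD2l ler_nat.
  by rewrite ler_wpM2r ?expR_ge0// lerDr mulr_ge0.
apply: le_measure; rewrite ?inE//; first exact: measurableC.
move=> o nbad S S0 hS.
apply: (weight_error_le c20 (whS o) wsS S0 hS C14 C16) => h.
have := hbad o nbad _ erefl; rewrite -/K6 => hb.
rewrite /C6 mulrAC ler_pdivlMr// mulrC (mulrC K6).
exact: hb.
Qed.
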